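(* Let $W=(w_1,w_2,\dots,w_n)\in(\mathbb{Z}_{\ge0})^n$, $0<a\in\mathbb{Z}$, and $\sigma W:=(w_{\sigma_1},w_{\sigma_2},\dots,w_{\sigma_n})$ for some $\sigma\in S_n$, where $\sigma_i=\sigma(i)$. If $\mathrm{WGr}(d,n)$ and $\mathrm{WGr}'(d,n)$ are the weighted Grassmann orbifolds associated to $(W,a)$ and $(\sigma W,a)$ respectively, then $\mathrm{WGr}(d,n)$ is weakly equivariantly homeomorphic to $\mathrm{WGr}'(d,n)$. Moreover, this may induce different $q$-cell structures on $\mathrm{WGr}(d,n)$ for different $\sigma$.
   Context: Fix integers $1\le d<n$. Let $M_d(n,d)$ be the set of complex $n\times d$ matrices of rank $d$. For $W=(w_1,\dots,w_n)\in(\mathbb{Z}_{\ge0})^n$ and an integer $a\ge1$, and for $A,B\in M_d(n,d)$, write $A\sim_w B$ if $B=\mathrm{diag}(t^{w_1},\dots,t^{w_n})\,A\,T$ for some $T\in \mathrm{GL}(d,\mathbb{C})$ and $t\in\mathbb{C}^*$ with $t^a=\det(T)$. The weighted Grassmann orbifold associated to $(W,a)$ is $\mathrm{WGr}(d,n):=M_d(n,d)/\!\sim_w$ with the quotient topology; $(\mathbb{C}^* )^n$ acts on it by $(t_1,\dots,t_n)\cdot[A]=[\mathrm{diag}(t_1,\dots,t_n)A]$. For a topological group $G$ and $G$-spaces $X,Y$, a map $f:X\to Y$ is a weakly equivariant homeomorphism if $f$ is a homeomorphism and there is $\eta\in\mathrm{Aut}(G)$ with $f(gx)=\eta(g)f(x)$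 for all $(g,x)\in G\times X$. Here $G=(\mathbb{C}^* )^n$. A $q$-cell is a quotient of an open cell (Euclidean space) by a linear action of a finite group, and a $q$-cell structure is a decomposition built by successively attaching $q$-cells. A Schubert symbol for $d<n$ is a sequence of integers $\lambda=(\lambda_1,\dots,\lambda_d)$ with $1\le\lambda_1<\cdots<\lambda_d\le n$. Put $m=\binom{n}{d}-1$ and fix a total order $\lambda^0<\cdots<\lambda^m$ on the Schubert symbols that preserves the partial order ''$\lambda_j\le\mu_j$ for all $j$''. Let $E(\lambda)$ be the Schubert cell in the Grassmann manifold $\mathrm{Gr}(d,n)$, consisting of the $d$-dimensional subspaces $X\subset\mathbb{C}^n$ with $\dim(X\cap\mathbb{C}^{\lambda_j})=j$ and $\dim(X\cap\mathbb{C}^{\lambda_j-1})=j-1$ for $1\le j\le d$, where $\mathbb{C}^k$ is spanned by the first $k$ standard basis vectors. Let $G(c)$ be the group of $c$-th roots of unity. The orbifold associated to $(W,a)$ has a $q$-cell structure with $q$-cells $E(\lambda^i)/G(c_i)$, $0\le i\le m$, where $c_i=a+\sum_{j=1}^d w_{\lambda^i_j}$ and $t\in G(c_i)$ acts through $\mathrm{diag}(t^{w_1},\dots,t^{w_n})$. The $q$-cell structures meant in the last sentence of the claim are those obtained on $\mathrm{WGr}(d,n)$ by permuting the coordinates of $\mathbb{C}^n$ by $\sigma$, i.e. by carrying over the $q$-cell structure of $\mathrm{WGr}'(d,n)$; their $q$-cells are quotients of permuted Schubert cells (homeomorphic to $E(\lambda^i)$) by the groups $G(\sigma c_i)$, where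 $\sigma c_i:=a+\sum_{j=1}^d w_{\sigma(\lambda^i_j)}$, $0\le i\le m$. *)

(* Defs.v *)
From HB Require Import structures.
From mathcomp Require Import all_boot all_order all_algebra all_fingroup.
From mathcomp Require Import mxrepresentation complex.
From mathcomp Require Import all_classical all_reals topology normedtype.
From mathcomp Require Import generic_quotient.

Set Implicit Arguments.
Unset Strict Implicit.
Unset Printing Implicit Defensive.

Import Order.TTheory GRing.Theory Num.Theory.
Import numFieldNormedType.Exports.

Local Open Scope classical_set_scope.
Local Open Scope ring_scope.
Local Open Scope quotient_scope.

Definition homeomorphism (X Y : topologicalType) (f : X -> Y) : Prop :=
  continuous f /\
  exists g : Y -> X, [/\ continuous g, cancel f g & cancel g f].

Definition topological_automorphism (G : topologicalType) (mul : G -> G -> G)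
    (eta : G -> G) : Prop :=
  homeomorphism eta /\ {morph eta : x y / mul x y}.

Definition weakly_equivariant_homeomorphism (G X Y : topologicalType)
    (mul : G -> G -> G) (actX : G -> X -> X) (actY : G -> Y -> Y)
    (f : X -> Y) : Prop :=
  homeomorphism f /\
  exists eta : G -> G, topological_automorphism mul eta /\
    forall g x, f (actX g x) = actY (eta g) (f x).

(* The data of a q-cell in X: a subset [qopen] of a space [qamb], meant to be
   an open cell of dimension [qdim]; a finite group acting on it; and a map
   [qproj] to X, meant to induce an embedding of the orbit space.  That these
   data really form a q-cell, attached to what has been built before, is
   [qcell_attached]. *)
Record qcell (X : topologicalType) := QCell {
  qdim : nat;
  qgrp : finGroupType;
  qamb : topologicalType;
  qopen : set qamb;
  qact : qgrp -> qamb -> qamb;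
  qproj : qamb -> X }.
Arguments qopen {X} e _ : rename.
Arguments qact {X} e _ _ : rename.
Arguments qproj {X} e _ : rename.

Definition qsupp (X : topologicalType) (e : qcell X) : set X :=
  qproj e @` qopen e.

Section QCells.
Variable R : realType.

Definition closed_disc k : set 'cV[R]_k := [set x | \sum_i x i 0 ^+ 2 <= 1].
Definition open_disc k : set 'cV[R]_k := [set x | \sum_i x i 0 ^+ 2 < 1].
Definition sphere k : set 'cV[R]_k := [set x | \sum_i x i 0 ^+ 2 = 1].

(* The open cell of e is homeomorphic, through psi, to the open unit disc of
   R^k with the finite group acting on it linearly (and orthogonally, so that
   the disc is preserved). The quotient map of the open cell extends to
   Phi : D^k -> X, which is constant on orbits and sends the sphere into Y.
   The last clause says that the union of Y and e carries the topology of
   the adjunction space of Y and D^k / G along Phi : S^(k-1) / G -> Y. *)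
Definition qcell_attached (X : topologicalType) (Y : set X) (e : qcell X)
    : Prop :=
  Y `&` qsupp e = set0 /\
  exists (rG : mx_representation R [set: qgrp e]%SET (qdim e))
    (psi : 'cV[R]_(qdim e) -> qamb e) (psi' : qamb e -> 'cV[R]_(qdim e))
    (Phi : 'cV[R]_(qdim e) -> X),
  [/\ forall g, (rG g)^T *m rG g = 1%:M,
    [/\ {within @open_disc (qdim e), continuous psi},
        {within qopen e, continuous psi'},
        psi @` @open_disc (qdim e) = qopen e,
        forall x, open_disc x -> psi' (psi x) = x
      & forall g x, open_disc x -> psi (rG g *m x) = qact e g (psi x)],
    forall z1 z2, qopen e z1 -> qopen e z2 ->
      (qproj e z1 = qproj e z2 <-> exists g, z2 = qact e g z1),
    [/\ {within @closed_disc (qdim e), continuous Phi},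
        forall x, open_disc x -> Phi x = qproj e (psi x),
        forall x, sphere x -> Y (Phi x)
      & forall g x, closed_disc x -> Phi (rG g *m x) = Phi x]
    & forall A : set X, A `<=` Y `|` qsupp e ->
        closed (A `&` Y : set (subspace Y)) ->
        closed (@closed_disc (qdim e) `&` Phi @^-1` A) ->
        closed (A : set (subspace (Y `|` qsupp e)))].

Definition qcell_structure (X : topologicalType) N (e : 'I_N -> qcell X)
    : Prop :=
  (forall x, exists i, qsupp (e i) x) /\
  forall i : 'I_N, qcell_attached
    [set x | exists2 j : 'I_N, (j < i)%N & qsupp (e j) x] (e i).

Definition carries_qcell (X X' : topologicalType) (f : X -> X')
    (e : qcell X) (e' : qcell X') : Prop :=
  qdim e = qdim e' /\
  exists (phi : qamb e -> qamb e') (alpha : qgrp e -> qgrp e'),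
  [/\ homeomorphism phi, phi @` qopen e = qopen e',
      bijective alpha /\ {morph alpha : g h / (g * h)%g},
      forall g z, qopen e z -> phi (qact e g z) = qact e' (alpha g) (phi z)
    & forall z, qopen e z -> f (qproj e z) = qproj e' (phi z)].

(* Two q-cell structures are different here if they do not decompose X into
   the same subsets and, moreover, no matching of their q-cells preserves the
   dimensions and the isomorphism types of the groups. *)
Definition different_qcell_structures (X : topologicalType) N
    (e e' : 'I_N -> qcell X) : Prop :=
  ~ (exists s : 'S_N, forall i, qsupp (e i) = qsupp (e' (s i))) /\
  ~ (exists s : 'S_N, forall i, qdim (e i) = qdim (e' (s i)) /\
       ([set: qgrp (e i)]%SET \isog [set: qgrp (e' (s i))]%SET)%g).

End QCells.

(* The group of c-th roots of unity, for 0 < c: the exponent c.-1.+1 is c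
   then, and is 1 in the irrelevant case c = 0. *)
Section RootsOfUnity.
Variables (R : realType) (c : nat).
Local Notation C := (R[i] : numClosedFieldType).

Definition unity_roots : seq C :=
  undup (sval (closed_field_poly_normal ('X^(c.-1.+1) - 1 : {poly C}))).

Lemma mem_unity_roots (t : C) : (t \in unity_roots) = (t ^+ c.-1.+1 == 1).
Proof.
rewrite mem_undup; case: closed_field_poly_normal => r /= rE.
rewrite -unity_rootE /root_of_unity rE rootZ ?root_prod_XsubC //.
by rewrite lead_coef_eq0 -size_poly_eq0 size_XnsubC.
Qed.

Definition unity_group := seq_sub unity_roots.
HB.instance Definition _ := Finite.on unity_group.

Definition unity_val (x : unity_group) : C := ssval x.

Lemma unity_valP x : unity_val x ^+ c.-1.+1 = 1.
Proof. by apply/eqP; rewrite -mem_unity_roots (ssvalP x). Qed.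

Lemma unity_one_subproof : (1 : C) \in unity_roots.
Proof. by rewrite mem_unity_roots expr1n. Qed.

Lemma unity_mul_subproof (x y : unity_group) :
  unity_val x * unity_val y \in unity_roots.
Proof. by rewrite mem_unity_roots exprMn !unity_valP mulr1. Qed.

Lemma unity_inv_subproof (x : unity_group) :
  (unity_val x)^-1 \in unity_roots.
Proof. by rewrite mem_unity_roots exprVn unity_valP invr1. Qed.

Definition unity_one : unity_group := SeqSub unity_one_subproof.
Definition unity_mul (x y : unity_group) : unity_group :=
  SeqSub (unity_mul_subproof x y).
Definition unity_inv (x : unity_group) : unity_group :=
  SeqSub (unity_inv_subproof x).

Lemma unity_mulA : associative unity_mul.
Proof. by move=> x y z; apply/val_inj; rewrite /= mulrA. Qed.

Lemma unity_mul1 : left_id unity_one unity_mul.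
Proof. by move=> x; apply/val_inj; rewrite /= mul1r. Qed.

Lemma unity_mulV : left_inverse unity_one unity_inv unity_mul.
Proof.
move=> x; apply/val_inj; rewrite /= mulVf //.
by apply/eqP => x0; move: (unity_valP x); rewrite x0 expr0n /= => /eqP;
  rewrite eq_sym oner_eq0.
Qed.

HB.instance Definition _ :=
  Finite_isGroup.Build unity_group unity_mulA unity_mul1 unity_mulV.

End RootsOfUnity.

Section Grassmann.
Variables (R : realType) (n d : nat).
Local Notation C := (R[i] : numClosedFieldType).

Definition nonzero_rows : set 'rV[C]_n := [set t | forall j, t 0 j != 0].
Definition torus := set_type nonzero_rows.
HB.instance Definition _ := Topological.on torus.

Lemma torus_mul_subproof (s t : torus) :
  (\row_j (\val s 0 j * \val t 0 j)) \in nonzero_rows.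
Proof.
by apply/mem_set => j; rewrite mxE mulf_neq0 //;
  [apply: (set_mem (valP s))|apply: (set_mem (valP t))].
Qed.

Definition torus_mul (s t : torus) : torus :=
  exist (fun v => v \in nonzero_rows) _ (torus_mul_subproof s t).

(* M_d(n, d), with the topology induced from that of n x d matrices. *)
Definition full_rank := set_type [set A : 'M[C]_(n, d) | \rank A = d].
HB.instance Definition _ := Topological.on full_rank.

(* Multiplication by square matrices. These are used for invertible D and T;
   the default value A is irrelevant, see [val_lmul] and [val_rmul]. *)
Definition lmul (D : 'M[C]_n) (A : full_rank) : full_rank :=
  insubd A (D *m \val A).
Definition rmul (A : full_rank) (T : 'M[C]_d) : full_rank :=
  insubd A (\val A *m T).

Lemma val_lmul D A : D \in unitmx -> \val (lmul D A) = D *m \val A.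
Proof.
move=> uD; rewrite val_insubd; case: ifP => // /negP []; apply/mem_set => /=.
rewrite -mxrank_tr trmx_mul mxrankMfree ?mxrank_tr ?(set_mem (valP A)) //.
by rewrite row_free_unit unitmx_tr.
Qed.

Lemma val_rmul A T : T \in unitmx -> \val (rmul A T) = \val A *m T.
Proof.
move=> uT; rewrite val_insubd; case: ifP => // /negP []; apply/mem_set => /=.
by rewrite mxrankMfree ?row_free_unit ?(set_mem (valP A)).
Qed.

Definition wdiag (W : 'I_n -> nat) (t : C) : 'M[C]_n :=
  diag_mx (\row_i t ^+ W i).

Lemma wdiag1 W : wdiag W 1 = 1%:M.
Proof.
rewrite /wdiag -diag_const_mx; congr diag_mx.
by apply/rowP => i; rewrite !mxE expr1n.
Qed.

Lemma wdiagM W s t : wdiag W (s * t) = wdiag W s *m wdiag W t.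
Proof.
rewrite /wdiag mulmx_diag; congr diag_mx.
by apply/rowP => i; rewrite !mxE exprMn.
Qed.

Definition wgr_rel (W : 'I_n -> nat) (a : nat) (A B : full_rank) : Prop :=
  exists (t : C) (T : 'M[C]_d),
    [/\ t != 0, T \in unitmx, t ^+ a = \det T
      & \val B = wdiag W t *m \val A *m T].

Lemma wgr_rel_refl W a A : wgr_rel W a A A.
Proof.
exists 1, 1%:M; split; rewrite ?oner_neq0 ?unitmx1 ?det1 ?expr1n //.
by rewrite wdiag1 mul1mx mulmx1.
Qed.

Lemma wgr_rel_sym W a A B : wgr_rel W a A B -> wgr_rel W a B A.
Proof.
move=> [t [T [t0 uT tT BE]]]; exists t^-1, (invmx T).
split; rewrite ?BE ?invr_neq0 ?unitmx_inv ?det_inv ?exprVn ?tT //.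
by rewrite !mulmxA -wdiagM mulVf // wdiag1 mul1mx mulmxK.
Qed.

Lemma wgr_rel_trans W a A B D :
  wgr_rel W a A B -> wgr_rel W a B D -> wgr_rel W a A D.
Proof.
move=> [t [T [t0 uT tT BE]]] [s [S [s0 uS sS DE]]].
exists (s * t), (T *m S); split; rewrite ?DE ?BE ?mulf_neq0 ?unitmx_mul ?uT //.
  by rewrite exprMn tT sS det_mulmx mulrC.
by rewrite wdiagM !mulmxA.
Qed.

Definition wgr_relb W a : rel full_rank := fun A B => `[< wgr_rel W a A B >].

Lemma wgr_relb_equiv W a : equiv_class_of (wgr_relb W a).
Proof.
split=> [A|A B|B A D]; first by apply/asboolP; exact: wgr_rel_refl.
  by apply/asboolP/asboolP; exact: wgr_rel_sym.
by move=> /asboolP AB /asboolP BD; apply/asboolP; exact: wgr_rel_trans AB BD.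
Qed.

Canonical wgr_equiv W a := EquivRelPack (wgr_relb_equiv W a).

Definition WGr (W : 'I_n -> nat) (a : nat) :=
  quotient_topology {eq_quot (wgr_equiv W a)}.

Definition gr_rel (A B : full_rank) : Prop :=
  exists2 T : 'M[C]_d, T \in unitmx & \val B = \val A *m T.

Definition gr_relb : rel full_rank := fun A B => `[< gr_rel A B >].

Lemma gr_relb_equiv : equiv_class_of gr_relb.
Proof.
split=> [A|A B|B A D].
- by apply/asboolP; exists 1%:M; rewrite ?unitmx1 ?mulmx1.
- by apply/asboolP/asboolP => -[T uT BE]; exists (invmx T);
    rewrite ?unitmx_inv ?BE ?mulmxK.
- move=> /asboolP[T uT BE] /asboolP[S uS DE]; apply/asboolP.
  by exists (T *m S); rewrite ?unitmx_mul ?uT ?DE ?BE ?mulmxA.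
Qed.

Canonical gr_equiv := EquivRelPack gr_relb_equiv.

(* The matrix A stands for the subspace spanned by its columns. *)
Definition Gr := quotient_topology {eq_quot gr_equiv}.

Definition gr_lmul (D : 'M[C]_n) (X : Gr) : Gr := \pi_Gr (lmul D (repr X)).

(* The map [A] |-> [D A] between two weighted Grassmann orbifolds; see
   [torus_act_pi] and [coord_perm_pi] for the cases of interest. *)
Definition wgr_lmul W W' a (D : 'M[C]_n) (x : WGr W a) : WGr W' a :=
  \pi_(WGr W' a) (lmul D (repr x)).

Definition torus_act W a (t : torus) : WGr W a -> WGr W a :=
  wgr_lmul W (diag_mx (\val t)).

(* [perm_mx s] sends the row s i to the row i. *)
Definition coord_perm W a (s : 'S_n) : WGr W a -> WGr (W \o s) a :=
  wgr_lmul (W \o s) (perm_mx s).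

Lemma wgr_lmul_pi W W' a D A : D \in unitmx ->
    (forall t, D *m wdiag W t = wdiag W' t *m D) ->
  wgr_lmul W' D (\pi_(WGr W a) A) = \pi_(WGr W' a) (lmul D A).
Proof.
move=> uD DW; apply/eqmodP/asboolP.
have /eqmodP/asboolP[t [T [t0 uT tT AE]]] :
    \pi_(WGr W a) (repr (\pi_(WGr W a) A)) = \pi_(WGr W a) A by exact: reprK.
by exists t, T; split => //; rewrite !val_lmul // AE !mulmxA DW.
Qed.

Lemma torus_act_pi W a t A :
  torus_act t (\pi_(WGr W a) A) = \pi_(WGr W a) (lmul (diag_mx (\val t)) A).
Proof.
apply: wgr_lmul_pi => [|s].
  rewrite unitmxE det_diag unitfE; apply/prodf_neq0 => i _.
  exact: (set_mem (valP t)).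
rewrite /wdiag !mulmx_diag; congr diag_mx.
by apply/rowP => i; rewrite !mxE mulrC.
Qed.

Lemma coord_perm_pi W a s A :
  coord_perm s (\pi_(WGr W a) A) = \pi_(WGr (W \o s) a) (lmul (perm_mx s) A).
Proof.
apply: wgr_lmul_pi => [|t]; first exact: unitmx_perm.
rewrite -row_permE /wdiag mul_diag_mx; apply/matrixP => i j; rewrite !mxE /=.
by case: (s i =P j); rewrite ?mulr1 ?mulr0.
Qed.

Definition schubert_symbol :=
  {l : {ffun 'I_d -> 'I_n} |
     [forall i : 'I_d, forall j : 'I_d, (i < j)%N ==> (l i < l j)%N]}.

Definition schubert_le (l m : schubert_symbol) : Prop :=
  forall j, (val l j <= val m j)%N.

(* A matrix whose rows span the subspace generated by the basis vectors
   e_(s 0), ..., e_(s (k - 1)). *)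
Definition flag (s : 'S_n) (k : nat) : 'M[C]_n := pid_mx k *m perm_mx s.

(* For s = 1 this is the Schubert cell E(l), and in general the Schubert cell
   for the flag of coordinate subspaces permuted by s. Since indices start
   from 0, C^(l_j) is spanned by the first (l j).+1 basis vectors. *)
Definition schubert_cell (s : 'S_n) (l : schubert_symbol) : set Gr :=
  [set X | forall j : 'I_d,
    \rank ((\val (repr X))^T :&: flag s (val l j).+1)%MS = j.+1 /\
    \rank ((\val (repr X))^T :&: flag s (val l j))%MS = j].

Definition schubert_dim (l : schubert_symbol) : nat :=
  (\sum_(j < d) (val l j - j))%N.

Definition schubert_weight (W : 'I_n -> nat) (a : nat) (s : 'S_n)
    (l : schubert_symbol) : nat :=
  (a + \sum_(j < d) W (s (val l j)))%N.

(* Each X in [schubert_cell s l] has a unique basis whose matrix has the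
   identity as its submatrix of rows s (l 0), ..., s (l (d - 1)). *)
Definition pivot_rows (s : 'S_n) (l : schubert_symbol) (A : 'M[C]_(n, d))
    : 'M[C]_d := rowsub (fun j => s (val l j)) A.

Definition schubert_proj W a (s : 'S_n) (l : schubert_symbol) (X : Gr)
    : WGr W a :=
  \pi_(WGr W a) (rmul (repr X) (invmx (pivot_rows s l (\val (repr X))))).

(* E(l) / G(c), permuted by s, as a q-cell in WGr W a; its real dimension is
   twice the complex dimension of the Schubert cell. *)
Definition schubert_qcell W a (s : 'S_n) (l : schubert_symbol)
    : qcell (WGr W a) :=
  @QCell (WGr W a) (2 * schubert_dim l)%N
    (unity_group R (schubert_weight W a s l)) Gr
    (schubert_cell s l)
    (fun t => gr_lmul (wdiag W (unity_val t)))
    (schubert_proj W a s l).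

End Grassmann.

(* Main.v *)
Require Import Defs.
From mathcomp Require Import all_boot all_order all_algebra all_fingroup.
From mathcomp Require Import mxrepresentation complex generic_quotient.
From mathcomp Require Import all_classical all_reals topology normedtype.
From mathcomp Require Import sequences realfun exp interval_inference ring.

(* Permuting coordinates conjugates diag(t^w) into diag(t^(w o s)), so it descends
   to the orbifolds and carries q-cells to q-cells; the point is the q-cell
   structure itself.
   By Cramer's rule, A ~_w B iff for some t <> 0 every minor satisfies
   p_f(B) = t^(a + w_f) p_f(A), where w_f is the sum of the w_(f j).  As a > 0, this
   bounds t away from 0 and infinity on convergent sequences, so the orbifold is
   Hausdorff, and then the adjunction topology and the continuity of the inverse
   chart are consequences of the compactness of the disc.
   For the characteristic map, identify the disc with a polydisc of matrices
   whose columns y_j are supported on the free positions of the echelon form, and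
   let X be obtained by applying to the frame of pivot vectors e_j deformed
   rotations taking e_j to y_j + (1 - |y_j|) e_j, one after the other.  The pivot
   minor of X is the product of the 1 - |y_j|, hence vanishes exactly on the boundary
   sphere, where X falls into smaller cells. Dividing the first column of X by a norm
   of the Pluecker vector gives the characteristic map to the orbifold.  Inside the
   disc, the real flow diag(r^w), with r chosen so that this norm is traded for
   the pivot minor, gives a lift of it to the Schubert cell; it is inverted by solving
   a monotone equation for r.
   For the last claim, let w be the indicator of the last coordinate and a = 1: the
   transposition of the first and last coordinates changes the group of the
   zero-dimensional q-cell. *)

Set Implicit Arguments.
Unset Strict Implicit.
Unset Printing Implicit Defensive.

Import Order.TTheory GRing.Theory Num.Theory.
Import numFieldNormedType.Exports.

(** * Minors and echelon forms *)

(** Why two normalizations: [schubert_proj] takes the representative whose pivot block is the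
    identity, and this blows up where the pivot minor vanishes. In Gr any other basis would do, but
    in the orbifold A and A T need not be equivalent, so a representative must be fixed up to its
    determinant by a rule that makes sense on the whole closed disc. The Pluecker norm is such a
    rule, being positive and continuous at every matrix of full rank. Inside the disc the two rules
    differ by a positive factor, and since the pivot minor of the frame is itself real and
    nonnegative, a real parameter r is enough to absorb this factor.

    Why the sup norm on columns: it depends only on the moduli of the entries, so roots of unity
    preserve it and all heights. Moreover the sup norm of a matrix is the largest sup norm of its
    columns. Hence a point of the disc is on the sphere exactly when some column y_j has norm 1,
    that is, when some factor of the pivot minor is 0. *)

Section Minors.
Local Open Scope ring_scope.
Variables (F : fieldType) (n d : nat).
Implicit Types (A B : 'M[F]_(n, d)) (f : 'I_d -> 'I_n).

Definition minor f A : F := \det (rowsub f A).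

Lemma rowsubM m (f : 'I_m -> 'I_n) p (A : 'M[F]_(n, p)) q (T : 'M_(p, q)) :
  rowsub f (A *m T) = rowsub f A *m T.
Proof. by apply/matrixP => i j; rewrite !mxE; apply: eq_bigr => k _; rewrite mxE. Qed.

Lemma minorM f A T : minor f (A *m T) = minor f A * \det T.
Proof. by rewrite /minor rowsubM det_mulmx. Qed.

Lemma minor_diag f (D : 'rV[F]_n) A :
  minor f (diag_mx D *m A) = (\prod_j D 0 (f j)) * minor f A.
Proof.
rewrite /minor (_ : rowsub f _ = diag_mx (\row_j D 0 (f j)) *m rowsub f A).
  by rewrite det_mulmx det_diag; under eq_bigr do rewrite mxE.
by apply/matrixP => i j; rewrite !mul_diag_mx !mxE.
Qed.

Lemma exists_minor A : \rank A = d -> exists f, minor f A != 0.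
Proof.
move=> rA; have fA : row_full A by rewrite /row_full rA.
exists (fullrankfun fA).
by rewrite /minor -unitfE -unitmxE fullrowsub_unit.
Qed.

Lemma minor_rank f A : minor f A != 0 -> \rank A = d.
Proof.
rewrite /minor -unitfE -unitmxE => uA; apply/eqP; rewrite eqn_leq rank_leq_col /=.
by rewrite -{1}(mxrank_unit uA) rowsubE mxrankM_maxr.
Qed.

Definition replace_row f j i : 'I_d -> 'I_n := fun k => if k == j then i else f k.

(** All rows but one are those of the identity, so in the expansion along row j only the cofactor at
    (j, j) survives. Through [cramer_minor] this recovers the entries of a normalized matrix from
    ratios of minors. *)
Lemma minor_replace_row f A i j : rowsub f A = 1%:M -> minor (replace_row f j i) A = A i j.
Proof.
move=> A1; rewrite /minor (expand_det_row _ j) (bigD1 j) //= big1 => [|k kj].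
  have -> : cofactor (rowsub (replace_row f j i) A) j j = cofactor (1%:M : 'M[F]_d) j j.
    congr (_ * \det _); rewrite -A1; apply/matrixP => k l; rewrite !mxE /replace_row.
    by rewrite eq_sym (negPf (neq_lift _ _)).
  have -> : cofactor (1%:M : 'M[F]_d) j j = 1.
    have := mul_mx_adj (1%:M : 'M[F]_d); rewrite mul1mx det1.
    by move/matrixP => /(_ j j); rewrite !mxE eqxx.
  by rewrite mxE /replace_row eqxx mulr1 addr0.
have -> : cofactor (rowsub (replace_row f j i) A) j k = cofactor (1%:M : 'M[F]_d) j k.
  congr (_ * \det _); rewrite -A1; apply/matrixP => k' l; rewrite !mxE /replace_row.
  by rewrite eq_sym (negPf (neq_lift _ _)).
have -> : cofactor (1%:M : 'M[F]_d) j k = 0.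
  have := mul_mx_adj (1%:M : 'M[F]_d); rewrite mul1mx det1.
  by move/matrixP => /(_ k j); rewrite !mxE (negPf kj).
by rewrite mulr0.
Qed.

Lemma cramer_minor f A i j : minor f A != 0 ->
  (A *m invmx (rowsub f A)) i j = minor (replace_row f j i) A / minor f A.
Proof.
move=> A0; have uA : rowsub f A \in unitmx by rewrite unitmxE unitfE.
have <- := @minor_replace_row f (A *m invmx (rowsub f A)) i j.
  by rewrite minorM det_inv.
by rewrite rowsubM mulmxV.
Qed.

(** Injectivity of the Pluecker embedding, with track kept of the scalar. Normalized at the same
    rows f, both matrices have ratios of minors as entries, and k cancels there; T is then the
    quotient of the two blocks. *)
Lemma minors_proportional A B k : \rank A = d -> k != 0 ->
  (forall f, minor f B = k * minor f A) ->
  exists T, [/\ T \in unitmx, \det T = k & B = A *m T].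
Proof.
move=> rA k0 AB; have [f fA] := exists_minor rA.
have fB : minor f B != 0 by rewrite AB mulf_neq0.
have uA : rowsub f A \in unitmx by rewrite unitmxE unitfE.
have uB : rowsub f B \in unitmx by rewrite unitmxE unitfE.
exists (invmx (rowsub f A) *m rowsub f B); split.
- by rewrite unitmx_mul unitmx_inv uA.
- by rewrite det_mulmx det_inv -!/(minor _ _) AB mulrCA mulVf ?mulr1.
rewrite mulmxA -[LHS](mulmxKV uB); congr (_ *m _).
apply/matrixP => i j; rewrite !cramer_minor // !AB invfM mulrACA mulfV // mul1r //.
Qed.
End Minors.

Section Triangular.
Local Open Scope ring_scope.
Variables (F : fieldType) (d : nat).
Implicit Types (P : 'M[F]_d).

Definition uppertri P := forall i j : 'I_d, (j < i)%N -> P i j = 0.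

Lemma det_uppertri P : uppertri P -> \det P = \prod_i P i i.
Proof.
move=> tP; rewrite -det_tr det_trig; first by apply: eq_bigr => i _; rewrite mxE.
by apply/is_trig_mxP => i j ij; rewrite mxE tP.
Qed.

Lemma invmx_mul (A B : 'M[F]_d) : A \in unitmx -> B \in unitmx ->
  invmx (A *m B) = invmx B *m invmx A.
Proof.
move=> uA uB; have uAB : A *m B \in unitmx by rewrite unitmx_mul uA.
by rewrite -[RHS](mulmxK uAB) !mulmxA mulmxKV // mulVmx // mul1mx.
Qed.

(** Induction on the column j: in the entry (i, j) of [invmx P *m P] the terms k < j vanish by
    induction and the terms k > j because [P] is triangular. What remains is a multiple of the
    nonzero diagonal entry [P j j]. *)
Lemma uppertri_inv P : P \in unitmx -> uppertri P -> uppertri (invmx P).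
Proof.
move=> uP tP.
have D0 k : P k k != 0.
  by move: uP; rewrite unitmxE unitfE det_uppertri // => /prodf_neq0; apply.
suff H m : forall i j : 'I_d, (j < m)%N -> (j < i)%N -> invmx P i j = 0.
  by move=> i j; apply: (H j.+1).
elim: m => // m IH i j; rewrite ltnS leq_eqVlt => /orP[/eqP jm|]; last exact: IH.
move=> ji; have := mulVmx uP; move/matrixP => /(_ i j); rewrite !mxE.
rewrite (bigD1 j) //= big1 => [|k kj].
  have -> : (i == j) = false by apply/negbTE; rewrite neq_ltn ji orbT.
  by rewrite addr0 => /eqP; rewrite mulf_eq0 (negPf (D0 j)) orbF => /eqP.
case: (ltngtP k j) => kj'.
- by rewrite IH ?mul0r -?jm // (ltn_trans kj').
- by rewrite tP // mulr0.
- by rewrite (val_inj kj') eqxx in kj.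
Qed.

(** If l j < m j, then the rows from j on and the columns up to j form a block of zeros whose sides
    add up to d + 1. Every permutation meets it: otherwise it would send the d - j indices from j on
    injectively to the d - j - 1 indices after j. *)
Lemma det_zero_block (l m : 'I_d -> nat) P :
    {homo l : i j / (i <= j)%N} -> {homo m : i j / (i <= j)%N} ->
    (forall k j, (l j < m k)%N -> P k j = 0) -> \det P != 0 ->
  forall j, (m j <= l j)%N.
Proof.
move=> homl homm P0 dP j; rewrite leqNgt; apply/negP => lm; move/eqP: dP; apply.
rewrite /determinant big1 // => s _.
suff [k kj sk] : exists2 k : 'I_d, (j <= k)%N & (s k <= j)%N.
  rewrite (bigD1 k) //= P0 ?mul0r ?mulr0 //.
  by rewrite (leq_ltn_trans _ (leq_trans lm _)) ?homl ?homm.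
have [/existsP[k /andP[? ?]]|] :=
  boolP [exists k : 'I_d, (j <= k)%N && (s k <= j)%N]; first by exists k.
rewrite negb_exists => /forallP H.
have sub : [set s k | k in [set k : 'I_d | (j <= k)%N]] \subset
    [set k : 'I_d | (j <= k)%N] :\ j.
  apply/fintype.subsetP => _ /imsetP[k + ->]; rewrite !inE => jk.
  by move: (H k); rewrite jk /= -ltnNge => jsk; rewrite (ltnW jsk) andbT neq_ltn jsk orbT.
move: (subset_leq_card sub); rewrite card_imset; last exact: perm_inj.
by rewrite (cardsD1 j [set k | _]) inE leqnn add1n ltnn.
Qed.
End Triangular.

Section Sorting.
Variables (n d : nat).

Lemma sort_injective (f : 'I_d -> 'I_n) : injective f ->
  exists s : 'S_d, forall i j : 'I_d, i < j -> f (s i) < f (s j).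
Proof.
case: d f => [|d'] f fI; first by exists 1%g; case.
pose le := [rel i j : 'I_d'.+1 | f i <= f j].
pose r := sort le (enum 'I_d'.+1).
have sr : size r = d'.+1 by rewrite size_sort size_enum_ord.
have ur : uniq r by rewrite sort_uniq enum_uniq.
have sor : sorted le r by apply: sort_sorted => i j; exact: leq_total.
have gI : injective (fun i : 'I_d'.+1 => nth ord0 r i).
  by move=> i j /eqP; rewrite nth_uniq ?sr // => /eqP/val_inj.
exists (perm gI) => i j ij; rewrite !permE ltn_neqAle.
have tr : transitive le by move=> a b c; rewrite /le /=; exact: leq_trans.
have rf : reflexive le by move=> a; exact: leqnn.
have /= -> := sorted_leq_nth tr rf ord0 sor i j; last exact: ltnW.
- rewrite andbT; apply/negP => /eqP/val_inj/fI/eqP.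
  by rewrite nth_uniq ?sr // => /eqP E; rewrite E ltnn in ij.
- by rewrite inE sr.
- by rewrite inE sr.
Qed.
End Sorting.

Section Echelon.
Local Open Scope ring_scope.
Variables (F : fieldType) (n d : nat) (s : 'S_n).
Implicit Types (A B V : 'M[F]_(n, d)) (l m : 'I_d -> 'I_n).

Definition increasing l := forall i j : 'I_d, (i < j)%N -> (l i < l j)%N.

Definition pivot_block l A : 'M[F]_d := rowsub (fun j => s (l j)) A.

Definition vanish_below l A :=
  forall (i : 'I_n) (j : 'I_d), (l j < i)%N -> A (s i) j = 0.

(** The Schubert condition for the column span of [A], in a form fit for matrix computations.
    Multiplying by the inverse block makes it independent of the basis ([in_cellM]); [in_cellP]
    links it to the dimensions of intersections with the flag. *)
Definition in_cell l A :=
  pivot_block l A \in unitmx /\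
  vanish_below l (A *m invmx (pivot_block l A)).

Lemma increasing_homo l : increasing l -> {homo l : i j / (i <= j)%N}.
Proof.
move=> li i j; rewrite leq_eqVlt => /orP[/eqP/val_inj->//|ij]; exact: ltnW (li _ _ ij).
Qed.

Lemma increasing_lt l i j : increasing l -> (l i < l j)%N = (i < j)%N.
Proof.
move=> li; apply/idP/idP => [|/li //]; apply: contraTT; rewrite -!leqNgt.
exact: increasing_homo.
Qed.

Lemma increasing_inj l : increasing l -> injective l.
Proof.
move=> li i j lij; apply: val_inj; case: (ltngtP i j) => // /li;
  by rewrite lij ltnn.
Qed.

Lemma in_cellM l A T : T \in unitmx -> in_cell l (A *m T) <-> in_cell l A.
Proof.
move=> uT; rewrite /in_cell /pivot_block rowsubM unitmx_mul uT andbT.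
by split=> -[uA]; rewrite invmx_mul // mulmxA mulmxK.
Qed.

Lemma vanish_below_diag l (D : 'rV_n) A :
  vanish_below l A -> vanish_below l (diag_mx D *m A).
Proof. by move=> vA i j lij; rewrite mul_diag_mx mxE vA // mulr0. Qed.

Lemma pivot_block_tri l V :
  increasing l -> vanish_below l V -> uppertri (pivot_block l V).
Proof. by move=> li vV i j ji; rewrite mxE vV // li. Qed.

(** The staircase of zeros makes the pivot block upper triangular, so its inverse is too, and
    multiplying by it preserves the staircase. Thus the test can be made on a basis that is not
    normalized. *)
Lemma in_cell_vanish l V : increasing l -> vanish_below l V ->
  pivot_block l V \in unitmx -> in_cell l V.
Proof.
move=> li vV uV; split=> // i j lji; rewrite mxE big1 // => k _.
have [kj|jk] := leqP k j.
  by rewrite vV ?mul0r // (leq_ltn_trans _ lji) ?increasing_homo.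
by rewrite (uppertri_inv uV (pivot_block_tri li vV)) ?mulr0.
Qed.

Lemma in_cell_diag l (D : 'rV_n) A : increasing l -> (forall i, D 0 i != 0) ->
  in_cell l A -> in_cell l (diag_mx D *m A).
Proof.
move=> li D0 [uA vA].
have -> : diag_mx D *m A =
  diag_mx D *m (A *m invmx (pivot_block l A)) *m pivot_block l A.
  by rewrite mulmxA mulmxKV.
apply/in_cellM => //; apply: in_cell_vanish => //; first exact: vanish_below_diag.
rewrite unitmxE unitfE -[\det _]/(minor _ _) minor_diag mulf_neq0 //.
  by apply/prodf_neq0 => j _.
by rewrite minorM det_inv mulf_neq0 ?invr_neq0 // -unitfE -unitmxE.
Qed.

(** The pivot block at l may be singular here. This is the case of the boundary of the disc, where
    the frame keeps its zeros but drops to a smaller cell. *)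
Lemma vanish_minor_le l m V : increasing l -> increasing m ->
    vanish_below l V -> minor (fun j => s (m j)) V != 0 ->
  forall j, (m j <= l j)%N.
Proof.
move=> li mi vV; apply: det_zero_block.
- exact: (increasing_homo li).
- exact: (increasing_homo mi).
- by move=> k j lm; rewrite mxE vV.
Qed.

Lemma in_cell_minor_le l m A : increasing l -> increasing m ->
    in_cell l A -> minor (fun j => s (m j)) A != 0 ->
  forall j, (m j <= l j)%N.
Proof.
move=> li mi [uA vA] mA; apply: (vanish_minor_le li mi vA).
by rewrite minorM det_inv mulf_neq0 ?invr_neq0 // -unitfE -unitmxE.
Qed.

Lemma in_cell_unique l m A : increasing l -> increasing m ->
  in_cell l A -> in_cell m A -> l =1 m.
Proof.
move=> li mi lA mA j; apply: val_inj; apply/eqP; rewrite eqn_leq.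
have ne k : in_cell k A -> minor (fun j => s (k j)) A != 0.
  by case; rewrite unitmxE unitfE.
by rewrite (in_cell_minor_le mi li mA) ?(in_cell_minor_le li mi lA) // ne.
Qed.

(* The pivots are a choice of rows with nonzero minor whose positions have
   the largest possible sum. *)
Lemma in_cell_exists A : \rank A = d -> exists l, increasing l /\ in_cell l A.
Proof.
move=> rA; have [f0 fA0] := exists_minor rA.
pose P (f : {ffun 'I_d -> 'I_n}) := minor (fun j => s (f j)) A != 0.
have P0 : P [ffun j => (s^-1)%g (f0 j)].
  rewrite /P (_ : minor _ A = minor f0 A) //; congr (\det _).
  by apply/matrixP => i j; rewrite !mxE ffunE permKV.
pose wt (f : {ffun 'I_d -> 'I_n}) := (\sum_j f j)%N.
case: (@arg_maxnP _ _ P wt P0) => f Pf fmax.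
have uA : pivot_block f A \in unitmx by rewrite unitmxE unitfE.
have vA : vanish_below f (A *m invmx (pivot_block f A)).
  (* A nonzero entry below the pivot of column j would allow row i to replace row f j: the minor
     stays nonzero and the sum of positions grows. *)
  move=> i j fji; apply/eqP/negPn/negP; rewrite cramer_minor // => nz.
  pose g := [ffun k => if k == j then i else f k].
  have Pg : P g.
    rewrite /P; apply: contra nz => /eqP g0; rewrite (_ : minor _ A = 0) ?mul0r //.
    rewrite -g0; congr (\det _); apply/matrixP => a b; rewrite !mxE ffunE /replace_row.
    by case: eqP.
  have := fmax _ Pg; apply/negP; rewrite -ltnNge /wt (bigD1 j) //= [X in (_ < X)%N](bigD1 j) //=.
  rewrite ffunE eqxx [X in (_ < i + X)%N](eq_bigr (fun k => f k : nat)) ?ltn_add2r //.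
  by move=> k /negPf kj; rewrite ffunE kj.
have fI : injective f.
  move=> a b fab; apply/eqP/negPn/negP => ab; move/negP: Pf; apply.
  by apply/eqP; apply: (determinant_alternate ab) => k; rewrite !mxE fab.
have [t ti] := sort_injective fI.
exists (f \o t); split=> //.
have E : pivot_block (f \o t) A = row_perm t (pivot_block f A).
  by apply/matrixP => i j; rewrite !mxE.
split; first by rewrite E row_permE unitmx_mul unitmx_perm.
move=> i j /= fti; rewrite E row_permE invmx_mul ?unitmx_perm // mulmxA.
have -> : invmx (perm_mx t) = perm_mx t^-1 :> 'M[F]_d.
  by rewrite -[RHS](mulKmx (unitmx_perm F t)) -perm_mxM mulgV perm_mx1 mulmx1.
by rewrite -col_permE mxE vA.
Qed.

Definition flag_mx (k : nat) : 'M[F]_n := pid_mx k *m perm_mx s.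

Lemma sub_flag p (M : 'M[F]_(p, n)) k :
  reflect (forall r (i : 'I_n), (k <= i)%N -> M r (s i) = 0) (M <= flag_mx k)%MS.
Proof.
apply: (iffP idP) => [/submxP[D ->] r i ki|H].
  rewrite mulmxA mxE (bigD1 i) //= big1 => [|j ji]; last first.
    by move: (D *m _) => E; rewrite !mxE (inj_eq perm_inj) (negPf ji) mulr0.
  rewrite mxE big1 ?mul0r ?addr0 // => j _; rewrite [pid_mx _ _ _]mxE.
  by case: eqP => [->|]; rewrite ?mulr0 // ltnNge ki mulr0.
apply/submxP; exists (M *m perm_mx s^-1).
rewrite -col_permE /flag_mx mulmxA -[M in LHS](mulmxKV (unitmx_perm F s)).
congr (_ *m _); apply/matrixP => r i.
have -> : invmx (perm_mx s) = perm_mx s^-1 :> 'M[F]_n.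
  by rewrite -[RHS](mulKmx (unitmx_perm F s)) -perm_mxM mulgV perm_mx1 mulmx1.
rewrite -col_permE !mxE (bigD1 i) //= big1 => [|j ji].
  rewrite !mxE eqxx /= addr0; case: ltnP => ik; rewrite ?mulr1 // H //.
  by rewrite mul0r.
by rewrite !mxE (_ : (j == i :> nat) = false) ?mulr0 //; exact: negPf ji.
Qed.

(** In a combination of the columns of the normalized matrix N, the coordinate at the pivot
    [s (l i)] is the i-th coefficient. A combination in the flag therefore has zero coefficients
    from m on, while the first m columns lie in the flag by the staircase of zeros. *)
Lemma in_cell_rank l A (k m : nat) : in_cell l A -> (m <= d)%N ->
    (forall i, (l i < k)%N = (i < m)%N) ->
  \rank (A^T :&: flag_mx k)%MS = m.
Proof.
move=> [uA vA] md lk; set N := A *m _ in vA.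
have AE : A = N *m pivot_block l A by rewrite mulmxKV.
have N1 : pivot_block l N = 1%:M by rewrite /pivot_block rowsubM mulmxV.
have rN : row_free N^T.
  rewrite /row_free mxrank_tr; apply/eqP/(@minor_rank _ _ _ (fun j => s (l j))).
  by rewrite /minor -/(pivot_block l N) N1 det1 oner_neq0.
have eA : (A^T :=: N^T)%MS.
  by rewrite AE trmx_mul; apply: eqmxMfull; rewrite row_full_unit unitmx_tr.
rewrite (cap_eqmx eA (eqmx_refl _)).
suff E : (N^T :&: flag_mx k == (pid_mx m : 'M_d) *m N^T)%MS.
  by rewrite (eqmxP E) mxrankMfree // rank_pid_mx.
apply/andP; split; last first.
  rewrite sub_capmx submxMl /=; apply/sub_flag => r i ki.
  rewrite mxE big1 // => j _; rewrite [pid_mx _ _ _]mxE [N^T _ _]mxE.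
  case: andP => [[/eqP/val_inj <- rm]|_]; last by rewrite mul0r.
  by rewrite vA ?mulr0 // (leq_trans _ ki) // lk.
have /submxP[D DE] := capmxSl N^T (flag_mx k).
have /sub_flag fl := capmxSr N^T (flag_mx k).
rewrite DE; have -> : D = D *m pid_mx m.
  apply/matrixP => r i; rewrite mxE (bigD1 i) //= big1 => [|j ji]; last first.
    by rewrite mxE (_ : (j == i :> nat) = false) ?mulr0 //; exact: negPf ji.
  rewrite mxE eqxx addr0 /=; have [im|mi] := ltnP i m; first by rewrite mulr1.
  rewrite mulr0; have := fl r (l i); rewrite leqNgt lk -leqNgt => /(_ mi).
  rewrite DE mxE => {1}<-; rewrite (bigD1 i) //= big1 => [|j ji].
    by rewrite mxE; have /matrixP/(_ i i) := N1; rewrite !mxE eqxx => ->; rewrite mulr1 addr0.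
  by rewrite mxE; have /matrixP/(_ i j) := N1; rewrite !mxE eq_sym (negPf ji) => ->; rewrite mulr0.
by rewrite -mulmxA submxMl.
Qed.

(** For the converse, each jump of dimension yields a vector of the span that lies in the flag up to
    l j and has a nonzero coordinate at [s (l j)]. Together they form a matrix with staircase zeros
    and an invertible triangular pivot block, so they are another basis of the span. *)
Lemma in_cellP l A : increasing l ->
  in_cell l A <->
  forall j : 'I_d, \rank (A^T :&: flag_mx (l j).+1)%MS = j.+1 /\
                   \rank (A^T :&: flag_mx (l j))%MS = j.
Proof.
move=> li; split=> [lA j|H].
  split; apply: (in_cell_rank lA) => //; try exact: ltnW; move=> i.
    by rewrite !ltnS leqNgt increasing_lt // -leqNgt.
  exact: increasing_lt.
have /fin_all_exists[v vP] : forall j : 'I_d, exists v : 'rV_n,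
    [/\ (v <= A^T)%MS, (v <= flag_mx (l j).+1)%MS & ~~ (v <= flag_mx (l j))%MS].
  move=> j; have [r1 r2] := H j.
  have /row_subPn[i ni] : ~~ (A^T :&: flag_mx (l j).+1 <= flag_mx (l j))%MS.
    apply/negP => S; have : (A^T :&: flag_mx (l j).+1 <= A^T :&: flag_mx (l j))%MS.
      by rewrite sub_capmx capmxSl.
    by move/mxrankS; rewrite r1 r2 ltnn.
  exists (row i (A^T :&: flag_mx (l j).+1)%MS); split=> //.
    exact: submx_trans (row_sub _ _) (capmxSl _ _).
  exact: submx_trans (row_sub _ _) (capmxSr _ _).
pose W : 'M[F]_(n, d) := \matrix_(i, j) v j 0 i.
have vW : vanish_below l W.
  by move=> i j lij; rewrite mxE; have [_ /sub_flag ->] := vP j.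
have uW : pivot_block l W \in unitmx.
  rewrite unitmxE unitfE det_uppertri; last exact: pivot_block_tri.
  apply/prodf_neq0 => j _; rewrite !mxE; have [_ /sub_flag v1 v2] := vP j.
  apply: contra v2 => /eqP v0; apply/sub_flag => r i; rewrite ord1 leq_eqVlt.
  by case/orP => [/eqP/val_inj <- //|]; exact: v1.
have /submxP[T TE] : (W^T <= A^T)%MS.
  apply/row_subP => j; have [vA _ _] := vP j.
  by rewrite (_ : row j W^T = v j) //; apply/rowP => i; rewrite !mxE.
have {TE} WE : W = A *m T^T by rewrite -[W]trmxK TE trmx_mul trmxK.
have uT : T^T \in unitmx.
  move: uW; rewrite WE unitmxE unitfE -[\det _]/(minor _ _) minorM mulf_eq0.
  by rewrite negb_or unitmxE unitfE => /andP[].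
by apply/(in_cellM l A uT); rewrite -WE; apply: in_cell_vanish.
Qed.

End Echelon.

(** * Frames parametrized by a polydisc *)

Section Frames.
Local Open Scope ring_scope.

Lemma colM (R : pzSemiRingType) m p q (A : 'M[R]_(m, p)) (B : 'M_(p, q)) j :
  col j (A *m B) = A *m col j B.
Proof. by apply/colP => i; rewrite !mxE; apply: eq_bigr => k _; rewrite !mxE. Qed.

Variables (C : numClosedFieldType) (n d : nat) (s : 'S_n) (l : 'I_d -> 'I_n).
Hypothesis li : increasing l.
Variable nu : 'cV[C]_n -> C.
Hypothesis nu_ge0 : forall v, 0 <= nu v.
Hypothesis nuZ : forall k v, nu (k *: v) = `|k| * nu v.
Hypothesis nu_eq : forall v w : 'cV[C]_n, (forall i, `|v i 0| = `|w i 0|) -> nu v = nu w.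
Implicit Types (Y N : 'M[C]_(n, d)) (v : 'cV[C]_n).

Definition pivot (j : 'I_d) : 'I_n := s (l j).

(** The unconstrained entries of a reduced echelon matrix with pivots l; [card_free] counts them. *)
Definition free (i : 'I_n) (j : 'I_d) : bool :=
  ((s^-1)%g i < l j)%N && [forall k, i != pivot k].

Definition supported Y := forall i j, ~~ free i j -> Y i j = 0.

Definition height v : C := 1 - nu v.

(* For p = pivot j and v_p = 0, this sends e_p to v + height v *: e_p and any other
   e_k to e_k - (v_k)^* *: e_p; unlike row reduction it stays invertible when
   nu v = 1, where height v = 0. *)
Definition rot (j : 'I_d) v : 'M[C]_n :=
  \matrix_(i, k) ((i == k)%:R + v i 0 * (k == pivot j)%:R
     - (i == pivot j)%:R * (v k 0)^*
     + (height v - 1) * (i == pivot j)%:R * (k == pivot j)%:R).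

(** The rotation of the highest index is the rightmost factor, so it acts first on [base]. The
    recursion is on natural numbers, and indices outside 'I_d contribute an irrelevant identity
    factor. *)
Fixpoint rots (y : 'I_d -> 'cV[C]_n) (k : nat) : 'M[C]_n :=
  if k is k'.+1 then
    rots y k' *m (if insub k' is Some j then rot j (y j) else 1%:M)
  else 1%:M.

Lemma rotsS y (j : 'I_d) : rots y j.+1 = rots y j *m rot j (y j).
Proof. by rewrite /= valK. Qed.

Definition base : 'M[C]_(n, d) := \matrix_(i, j) (i == pivot j)%:R.

Definition frame Y : 'M[C]_(n, d) := rots (fun j => col j Y) d *m base.

Lemma pivot_inj : injective pivot.
Proof. by move=> i j /perm_inj; exact: increasing_inj. Qed.

Lemma pivot_not_free k j : free (pivot k) j = false.
Proof.
apply/negbTE; rewrite negb_and negb_forall orbC; apply/orP; left.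
by apply/existsP; exists k; rewrite eqxx.
Qed.

Lemma rotE_ne j v p (V : 'M_(n, p)) i q : i != pivot j ->
  (rot j v *m V) i q = V i q + v i 0 * V (pivot j) q.
Proof.
move=> ij; rewrite mxE.
under eq_bigr => k _.
  rewrite mxE (negPf ij) mul0r subr0 mulr0 mul0r addr0 mulrDl -mulrA.
  over.
rewrite big_split /= -mulr_sumr; congr (_ + _ * _).
  rewrite (bigD1 i) //= eqxx mul1r big1 ?addr0 // => k ki.
  by rewrite eq_sym (negPf ki) mul0r.
rewrite (bigD1 (pivot j)) //= eqxx mul1r big1 ?addr0 // => k ki.
by rewrite (negPf ki) mul0r.
Qed.

Lemma rotE_pivot j v p (V : 'M_(n, p)) q : v (pivot j) 0 = 0 ->
  (rot j v *m V) (pivot j) q =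
    height v * V (pivot j) q - \sum_k (v k 0)^* * V k q.
Proof.
move=> v0; rewrite mxE.
rewrite (eq_bigr (fun k => height v * ((k == pivot j)%:R * V k q) - (v k 0)^* * V k q)).
  2: by move=> k _; rewrite mxE eqxx v0 [pivot j == k]eq_sym /=; ring.
rewrite big_split /= -mulr_sumr sumrN; congr (_ * _ - _).
rewrite (bigD1 (pivot j)) //= eqxx mul1r big1 ?addr0 // => k ki.
by rewrite (negPf ki) mul0r.
Qed.

Lemma unitmx_injP p (A : 'M[C]_p) :
  (forall v : 'cV_p, A *m v = 0 -> v = 0) -> A \in unitmx.
Proof.
move=> H; rewrite -unitmx_tr -row_free_unit -kermx_eq0; apply/eqP/row_matrixP => i.
apply: trmx_inj; rewrite row0 trmx0; apply: H.
by apply: trmx_inj; rewrite trmx_mul trmxK -row_mul mulmx_ker row0 trmx0.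
Qed.

Lemma nu0 : nu 0 = 0.
Proof. by rewrite -(scale0r (0 : 'cV_n)) nuZ normr0 mul0r. Qed.

(** A kernel vector w satisfies w_i = - v_i w_p off the pivot p, and the pivot row then reads
    (height v + sum of |v_k|^2) w_p = 0. Both summands are nonnegative and cannot vanish together: v
    = 0 gives height 1. *)
Lemma rot_unit j v : v (pivot j) 0 = 0 -> nu v <= 1 -> rot j v \in unitmx.
Proof.
move=> v0 v1; apply: unitmx_injP => w w0.
have wE i : i != pivot j -> w i 0 = - v i 0 * w (pivot j) 0.
  move=> ij; have /matrixP/(_ i 0) := w0; rewrite rotE_ne // mxE => /eqP.
  by rewrite addr_eq0 mulNr => /eqP.
have /matrixP/(_ (pivot j) 0) := w0; rewrite rotE_pivot // mxE.
rewrite (_ : \sum_k _ = - (\sum_k `|v k 0| ^+ 2) * w (pivot j) 0); last first.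
  rewrite -sumrN mulr_suml; apply: eq_bigr => k _.
  have [->|/wE ->] := eqVneq k (pivot j); first by rewrite v0 normr0 expr0n oppr0 mul0r conjC0 mul0r.
  by rewrite normCKC !mulNr mulrN mulrA.
rewrite mulNr opprK -mulrDl => /eqP; rewrite mulf_eq0 paddr_eq0 ?subr_ge0 //; last first.
  by apply: sumr_ge0 => k _; rewrite exprn_ge0.
have wp0 : w (pivot j) 0 = 0 -> w = 0.
  move=> wp; apply/colP => i; rewrite [RHS]mxE.
  by have [->//|/wE ->] := eqVneq i (pivot j); rewrite wp mulr0.
case/orP => [/andP[h0 S0]|/eqP //]; case/negP: (oner_neq0 C).
move: h0; rewrite subr_eq0 => /eqP ->; apply/eqP; rewrite (_ : v = 0) ?nu0 //.
apply/colP => i; apply/eqP; rewrite mxE -normr_eq0 -sqrf_eq0.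
by move: S0; rewrite psumr_eq0 => [/allP/(_ i (mem_index_enum _)) //|k _]; rewrite exprn_ge0.
Qed.

Definition bounded Y := forall j, nu (col j Y) <= 1.

Section OneFrame.
Variable Y : 'M[C]_(n, d).
Hypotheses (sY : supported Y) (bY : bounded Y).
Notation Q := (rots (fun j => col j Y)).

Lemma col_pivot0 k j : col j Y (pivot k) 0 = 0.
Proof. by rewrite mxE sY // pivot_not_free. Qed.

Lemma rots_unit k : Q k \in unitmx.
Proof.
elim: k => [|k IH]; first by rewrite unitmx1.
rewrite [Q _]/= unitmx_mul IH; case: insubP => [j _ _|_]; last exact: unitmx1.
by rewrite rot_unit ?col_pivot0.
Qed.

(** [rot j] changes only its own pivot row and the rows where the column y_j may be nonzero. *)
Lemma rots_fix k i p (V : 'M_(n, p)) q :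
  (forall j : 'I_d, (j < k)%N -> i != pivot j /\ ~~ free i j) ->
  (Q k *m V) i q = V i q.
Proof.
elim: k V => [|k IH] V H; first by rewrite mul1mx.
rewrite [Q _]/= -mulmxA IH => [|j jk]; last exact/H/ltnW.
case: insubP => [j _ jk|_]; last by rewrite mul1mx.
have [|ij fij] := H j; first by rewrite jk.
by rewrite rotE_ne // mxE sY // mul0r addr0.
Qed.

Lemma free_pivot (j k : 'I_d) : (k < j)%N -> pivot j != pivot k /\ ~~ free (pivot j) k.
Proof.
by move=> kj; rewrite pivot_not_free (inj_eq pivot_inj) -val_eqE neq_ltn kj orbT.
Qed.

Lemma free_above (j k : 'I_d) i : (k < j)%N -> (l j < (s^-1)%g i)%N ->
  i != pivot k /\ ~~ free i k.
Proof.
move=> kj ji; have ki := ltn_trans (li kj) ji; split.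
  by apply: contraTneq ki => ->; rewrite permK ltnn.
by rewrite /free ltnNge (ltnW ki).
Qed.

Lemma rot_base j k : k != j -> rot j (col j Y) *m col k base = col k base.
Proof.
move=> kj; have bj : col k base (pivot j) 0 = 0.
  by rewrite !mxE (inj_eq pivot_inj) eq_sym (negPf kj).
apply/colP => i; have [->|ij] := eqVneq i (pivot j); last by rewrite rotE_ne // bj mulr0 addr0.
rewrite rotE_pivot ?col_pivot0 // bj mulr0 sub0r big1 ?oppr0 // => i' _; rewrite [col k base _ _]mxE.
by rewrite [base _ _]mxE; case: eqP => [->|]; rewrite ?mulr0 // col_pivot0 conjC0 mul0r.
Qed.

Lemma rots_base (k : 'I_d) m : (k < m)%N -> Q m *m col k base = Q k.+1 *m col k base.
Proof.
elim: m => // m IH; rewrite ltnS leq_eqVlt => /orP[/eqP -> //|km].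
rewrite -IH // [Q m.+1]/= -mulmxA; congr (_ *m _).
case: insubP => [i _ im|_]; last by rewrite mul1mx.
by rewrite rot_base // -val_eqE neq_ltn im km.
Qed.

(** The rotations after j come first in the product and fix e_j, since the columns of [Y] vanish at
    pivot rows. The rotation j then turns e_j into y_j + height e_j, and only the earlier ones
    remain. *)
Lemma col_frame j : col j (frame Y) = Q j *m (col j Y + height (col j Y) *: col j base).
Proof.
rewrite /frame colM (@rots_base j d) // rotsS -mulmxA.
congr (_ *m _); apply/colP => i; have [->|ij] := eqVneq i (pivot j); last first.
  by rewrite rotE_ne // !mxE eqxx (negPf ij) mulr0 add0r addr0 mulr1.
rewrite rotE_pivot ?col_pivot0 // big1 => [|i' _].
  by rewrite !mxE eqxx sY ?pivot_not_free // subr0 add0r.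
by rewrite [col j base _ _]mxE [base _ _]mxE; case: eqP => [->|]; rewrite ?mulr0 // col_pivot0 conjC0 mul0r.
Qed.

Lemma frame_rank : \rank (frame Y) = d.
Proof.
rewrite /frame -mxrank_tr trmx_mul mxrankMfree; last by rewrite row_free_unit unitmx_tr rots_unit.
rewrite mxrank_tr; apply: (@minor_rank _ _ _ pivot).
rewrite /minor (_ : rowsub _ _ = 1%:M) ?det1 ?oner_neq0 //.
by apply/matrixP => i j; rewrite !mxE (inj_eq pivot_inj).
Qed.

(** These are rows that the earlier rotations do not touch. They include the pivot row of j and all
    rows below it, which suffices for the triangular shape and for its diagonal. *)
Lemma frame_fix i (j : 'I_d) : (forall k : 'I_d, (k < j)%N -> i != pivot k /\ ~~ free i k) ->
  frame Y i j = Y i j + height (col j Y) * (i == pivot j)%:R.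
Proof.
move=> H; have -> : frame Y i j = col j (frame Y) i 0 by rewrite [RHS]mxE.
by rewrite col_frame rots_fix // !mxE.
Qed.

Lemma frame_vanish : vanish_below s l (frame Y).
Proof.
move=> i j ji; rewrite frame_fix => [|k kj]; last by apply: (free_above kj); rewrite permK.
rewrite sY; last by rewrite /free permK ltnNge (ltnW ji).
rewrite add0r (inj_eq perm_inj) (_ : _ == _ = false) ?mulr0 //.
by apply/negbTE; rewrite -val_eqE neq_ltn ji orbT.
Qed.

Lemma pivot_frame_diag j : pivot_block s l (frame Y) j j = height (col j Y).
Proof.
rewrite mxE frame_fix => [|k kj]; last exact: free_pivot.
by rewrite -/(pivot j) sY ?pivot_not_free // eqxx add0r mulr1.
Qed.

Lemma pivot_frame_tri : uppertri (pivot_block s l (frame Y)).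
Proof. exact: pivot_block_tri frame_vanish. Qed.

Lemma det_pivot_frame :
  \det (pivot_block s l (frame Y)) = \prod_j height (col j Y).
Proof.
rewrite (det_uppertri pivot_frame_tri); apply: eq_bigr => j _.
exact: pivot_frame_diag.
Qed.

End OneFrame.

(** * Recovering the polydisc point from a normalized matrix *)

Section Inverse.
Variable N : 'M[C]_(n, d).

(** When N is the normalized frame of [Y] and Q the product of the rotations before j, this is y_j /
    height y_j; see [iframe_frame]. *)
Definition slope j (Q : 'M[C]_n) : 'cV[C]_n :=
  \col_i (if free i j then (invmx Q *m N) i j else 0).

(** The inverse of y |-> y / height y, which carries the open unit ball of [nu] onto the whole
    space. *)
Definition shrink v : 'cV[C]_n := (1 + nu v)^-1 *: v.

(** The columns of the preimage are found one after the other: those before j determine the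
    rotations that must be undone to read off column j. *)
Fixpoint irots (k : nat) : 'M[C]_n :=
  if k is k'.+1 then
    irots k' *m (if insub k' is Some j then rot j (shrink (slope j (irots k'))) else 1%:M)
  else 1%:M.

Definition iframe : 'M[C]_(n, d) :=
  \matrix_(i, j) shrink (slope j (irots j)) i 0.

Lemma col_iframe j : col j iframe = shrink (slope j (irots j)).
Proof. by apply/colP => i; rewrite !mxE. Qed.

Lemma rots_iframe k : rots (fun j => col j iframe) k = irots k.
Proof.
elim: k => //= k ->; case: insubP => // j _ jk.
by rewrite col_iframe -jk.
Qed.

Lemma nu_shrink v : nu (shrink v) = nu v / (1 + nu v).
Proof.
rewrite nuZ ger0_norm 1?mulrC // invr_ge0 addr_ge0 //.
Qed.

Lemma height_shrink v : height (shrink v) = (1 + nu v)^-1.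
Proof.
have n0 : 1 + nu v != 0 by rewrite gt_eqF // ltr_wpDr.
by rewrite /height nu_shrink -{1}(mulfV n0) -mulrBl addrK mul1r.
Qed.

Lemma supported_iframe : supported iframe.
Proof. by move=> i j /negPf fij; rewrite !mxE fij mulr0. Qed.

Lemma iframe_lt1 j : nu (col j iframe) < 1.
Proof.
rewrite col_iframe nu_shrink ltr_pdivrMr ?mul1r; first by rewrite ltrDr.
by rewrite ltr_wpDr.
Qed.

Lemma iframe_eq Y :
  (forall j, col j Y = shrink (slope j (rots (fun j => col j Y) j))) ->
  Y = iframe.
Proof.
move=> H; have E k : rots (fun j => col j Y) k = irots k.
  by elim: k => //= k IH; rewrite IH; case: insubP => // j _ jk; rewrite H jk IH.
apply/matrixP => i j; have -> : Y i j = col j Y i 0 by rewrite mxE.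
by rewrite H E !mxE.
Qed.

(** It suffices to write N = X R for some matrix R: comparing pivot blocks then shows that R is the
    inverse of the pivot block of X. The equality is checked column by column after undoing the
    rotations before j, which turns the columns k < j of X into the unit vectors e_k. *)
Lemma frame_iframe : pivot_block s l N = 1%:M -> vanish_below s l N ->
  frame iframe *m invmx (pivot_block s l (frame iframe)) = N.
Proof.
move=> N1 vN; set Y := iframe; pose X := frame Y.
have sY : supported Y := supported_iframe.
have bY : bounded Y by move=> j; exact: ltW (iframe_lt1 j).
have uQ k : irots k \in unitmx by rewrite -rots_iframe rots_unit.
pose h j := height (col j Y).
have hE j : h j = (1 + nu (slope j (irots j)))^-1 by rewrite /h col_iframe height_shrink.
have h0 j : h j != 0 by rewrite hE invr_neq0 // gt_eqF // ltr_wpDr.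
have fixN i (j : 'I_d) : (forall k : 'I_d, (k < j)%N -> i != pivot k /\ ~~ free i k) ->
    (invmx (irots j) *m N) i j = N i j.
  move=> H; have := rots_fix sY (invmx (irots j) *m N) j H.
  by rewrite rots_iframe mulKVmx // => <-.
(* The diagonal turns y_j + h e_j into slope plus e_j. The entries above it are the coordinates at
   earlier pivots that appear when the earlier rotations are undone on column j of N. *)
pose R : 'M[C]_d := \matrix_(k, j) (if k == j then (h j)^-1 else
   if (k < j)%N then (invmx (irots j) *m N) (pivot k) j else 0).
have NE : N = X *m R.
  suff NEj j : col j N = X *m col j R.
    apply/matrixP => i j; have /colP/(_ i) := NEj j.
    by rewrite -colM [LHS]mxE [RHS]mxE.
  have -> : X *m col j R = irots j *m ((h j)^-1 *: (col j Y + h j *: col j base)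
      + \sum_(k < d | (k < j)%N) R k j *: col k base).
    rewrite mulmxDr -scalemxAr -rots_iframe -col_frame // mulmx_sumr.
    rewrite [LHS](_ : _ = \sum_k R k j *: col k X); last first.
      by apply/colP => i; rewrite !mxE summxE; apply: eq_bigr => k _; rewrite !mxE mulrC.
    rewrite (bigD1 j) //= [R j j]mxE eqxx; congr (_ + _).
    rewrite (bigID (fun k : 'I_d => (k < j)%N)) /= [X in _ + X]big1 ?addr0.
      apply: eq_big => [k|k /andP[kj kj']].
        by case: eqP => //= ->; rewrite ltnn.
      by rewrite -scalemxAr /X /frame colM (@rots_base Y sY k d) ?(@rots_base Y sY k j).
    by move=> k /andP[kj kj']; rewrite [R k j]mxE (negPf kj) (negPf kj') scale0r.
  rewrite -[LHS](mulKVmx (uQ j)); congr (_ *m _); rewrite -colM.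
  apply/colP => i; set M := invmx (irots j) *m N.
  have fixM : (forall k : 'I_d, (k < j)%N -> i != pivot k /\ ~~ free i k) -> M i j = N i j.
    exact: fixN.
  have -> : (h j)^-1 *: (col j Y + h j *: col j base) =
      \col_i ((if free i j then M i j else 0) + (i == pivot j)%:R).
    apply/colP => i'; rewrite col_iframe /shrink -hE -scalerDr scalerA mulVf // scale1r.
    by rewrite mxE [slope _ _ _ _]mxE [col _ _ _ _]mxE [base _ _]mxE [RHS]mxE.
  rewrite [LHS]mxE [RHS]mxE summxE [X in X + _]mxE.
  have sumE k : i = pivot k -> \sum_(k0 < d | (k0 < j)%N) (R k0 j *: col k0 base) i 0 =
      if (k < j)%N then R k j else 0.
    move=> ->; case: ifP => kj.
      rewrite (bigD1 k) //= big1 ?addr0 => [|k' /andP[_ kk']].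
        by rewrite mxE [col _ _ _ _]mxE [base _ _]mxE eqxx mulr1.
      rewrite mxE [col _ _ _ _]mxE [base _ _]mxE (inj_eq pivot_inj) [k == _]eq_sym.
      by rewrite (negPf kk') mulr0.
    rewrite big1 // => k' k'j; rewrite mxE [col _ _ _ _]mxE [base _ _]mxE (inj_eq pivot_inj).
    by case: eqP => [E|]; rewrite ?mulr0 //; rewrite -E kj in k'j.
  have [/existsP[k /eqP ik]|] := boolP [exists k, i == pivot k].
    rewrite (sumE _ ik) ik (inj_eq pivot_inj) pivot_not_free add0r.
    have Nk : N (pivot k) j = (k == j)%:R by have /matrixP/(_ k j) := N1; rewrite !mxE.
    case: (ltngtP k j) => kj.
    - have kj' : (k == j) = false by apply/negbTE; rewrite -val_eqE neq_ltn kj.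
      by rewrite kj' add0r [R k j]mxE kj' kj.
    - rewrite addr0 -Nk -ik fixM // ik => k' k'j; exact/free_pivot/(ltn_trans k'j).
    - rewrite addr0 -Nk -ik fixM // ik => k' k'j; apply: free_pivot; rewrite kj //.
  rewrite negb_exists => /forallP ni.
  rewrite big1 ?addr0 => [|k _]; last first.
    by rewrite mxE [col _ _ _ _]mxE [base _ _]mxE (negPf (ni k)) mulr0.
  rewrite (negPf (ni j)) addr0; case: ifP => // fij.
  have lji : (l j < (s^-1)%g i)%N.
    move: fij; rewrite /free (introT forallP ni) andbT => /negbT; rewrite -leqNgt leq_eqVlt.
    case/orP => // /eqP/val_inj E; move: (ni j); rewrite /pivot E permKV eqxx //.
  rewrite fixM => [|k kj]; last exact: free_above kj lji.
  by rewrite -(permKV s i) vN.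
have PR : pivot_block s l X *m R = 1%:M by rewrite /pivot_block -rowsubM -NE.
have [uP _] := mulmx1_unit PR.
by rewrite -[RHS]/N [in RHS]NE -[in RHS](mulKmx uP R) PR mulmx1.
Qed.

End Inverse.

(** The inverse of the pivot block is triangular, so column j of the normalized frame combines the
    columns k <= j of X. Undoing the rotations before j turns the columns k < j into unit vectors at
    pivots, invisible at free positions, and column j into y_j + h e_j with coefficient 1 / h. Hence
    the slope is y_j / h, and [shrink] returns y_j. *)
Lemma iframe_frame Y : supported Y -> (forall j, nu (col j Y) < 1) ->
  Y = iframe (frame Y *m invmx (pivot_block s l (frame Y))).
Proof.
move=> sY bY'; have bY : bounded Y by move=> j; exact: ltW.
have h0 j : height (col j Y) != 0 by rewrite gt_eqF // subr_gt0.
set X := frame Y; set P := pivot_block s l X.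
have uP : P \in unitmx.
  by rewrite unitmxE unitfE det_pivot_frame //; apply/prodf_neq0.
have tP : uppertri P := pivot_frame_tri sY.
have tR := uppertri_inv uP tP.
apply: iframe_eq => j; set Q := rots _ _.
have uQ : Q \in unitmx by exact: rots_unit.
have Rjj : invmx P j j = (height (col j Y))^-1.
  have /matrixP/(_ j j) := mulmxV uP; rewrite !mxE eqxx (bigD1 j) //= big1 => [|k kj].
    rewrite pivot_frame_diag // addr0 => E; apply: (mulfI (h0 j)).
    by rewrite E mulfV.
  case: (ltngtP k j) => kj'.
  - by rewrite tP // mul0r.
  - by rewrite tR // mulr0.
  - by rewrite (val_inj kj') eqxx in kj.
have slopeE : slope (X *m invmx P) j Q = (height (col j Y))^-1 *: col j Y.
  apply/colP => i; rewrite [LHS]mxE [RHS]mxE [col _ _ _ _]mxE.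
  case: ifP => fij; last by rewrite sY ?fij // mulr0.
  rewrite mulmxA mxE (bigD1 j) //= big1 => [|k kj].
    rewrite Rjj addr0 mulrC; congr (_ * _).
    have -> : (invmx Q *m X) i j = (invmx Q *m col j X) i 0.
      by rewrite -colM [RHS]mxE.
    rewrite col_frame // mulKmx // !mxE; case/andP: fij => _ /forallP/(_ j)/negPf ->.
    by rewrite mulr0 addr0.
  case: (ltngtP k j) => kj'; last by rewrite (val_inj kj') eqxx in kj.
    have -> : (invmx Q *m X) i k = (invmx Q *m col k X) i 0.
      by rewrite -colM [RHS]mxE.
    rewrite /X /frame colM (@rots_base Y sY k d) // -(@rots_base Y sY k j) //.
    rewrite mulKmx // !mxE; case/andP: fij => _ /forallP/(_ k)/negPf ->.
    by rewrite mul0r.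
  by rewrite tR // mulr0.
rewrite slopeE /shrink nuZ ger0_norm; last by rewrite invr_ge0 subr_ge0 ltW.
rewrite -[X in X + _](mulVf (h0 j)) -mulrDr {2}/height subrK mulr1 invrK.
by rewrite scalerA mulfV // scale1r.
Qed.

(** * Equivariance under unitary diagonal matrices *)

Section Equivariance.
Variable (g : 'rV[C]_n).
Hypothesis g1 : forall i, `|g 0 i| = 1.

(** The action of diag(g) on reduced echelon matrices: the column factor restores the pivots to
    1. *)
Definition twist Y : 'M[C]_(n, d) :=
  \matrix_(i, j) (g 0 i / g 0 (pivot j) * Y i j).

Lemma nu_twist Y j : nu (col j (twist Y)) = nu (col j Y).
Proof. by apply: nu_eq => i; rewrite !mxE !normrM normfV !g1 invr1 !mul1r. Qed.

(** Conjugation by diag(g) turns [rot j] into the rotation of the twisted column: the height depends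
    on moduli only, and the conjugate of each g_i is its inverse, which accounts for the conjugated
    entries in the pivot row. *)
Lemma frame_twist Y :
  frame (twist Y) = diag_mx g *m frame Y *m diag_mx (\row_j (g 0 (pivot j))^-1).
Proof.
have g0 i : g 0 i != 0 by rewrite -normr_gt0 g1.
have gc i : (g 0 i)^* = (g 0 i)^-1 by rewrite invC_norm g1 expr1n invr1 mul1r.
have rotE j : rot j (col j (twist Y)) *m diag_mx g = diag_mx g *m rot j (col j Y).
  apply/matrixP => i k; rewrite mul_mx_diag mul_diag_mx !mxE.
  rewrite /height nu_twist !rmorphM fmorphV /= !gc invrK.
  have [->|kj] := eqVneq k (pivot j); have [->|ij] := eqVneq i (pivot j);
    rewrite ?eqxx ?mulr1 ?mulr0 ?mul1r ?mul0r ?subr0 ?addr0.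
  - by rewrite mulVf // divff // !mul1r mulrC.
  - by rewrite !add0r mulrAC mulfVK.
  - by rewrite eq_sym (negPf kj) !add0r mulrN mulNr [X in - X]mulrC !mulrA mulfV ?mul1r.
  - by rewrite mulrC; case: eqP => [->|] //; rewrite !mulr0.
have rotsE k : rots (fun j => col j (twist Y)) k *m diag_mx g =
    diag_mx g *m rots (fun j => col j Y) k.
  elim: k => [|k IH] /=; first by rewrite mulmx1 mul1mx.
  rewrite mulmxA -IH -!mulmxA; congr (_ *m _).
  by case: insubP => [j _ _|_]; rewrite ?rotE ?mulmx1 ?mul1mx.
rewrite /frame mulmxA -rotsE -!mulmxA; congr (_ *m _).
apply/matrixP => i j; rewrite mul_diag_mx mul_mx_diag !mxE.
by case: eqP => [->|]; rewrite ?mul0r ?mulr0 // mul1r mulfV.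
Qed.

End Equivariance.

Lemma card_ord_lt m p : (m <= p)%N -> #|[set i : 'I_p | (i < m)%N]| = m.
Proof.
move=> mp.
have wI : injective (widen_ord mp) by move=> i j /(congr1 val) /= /val_inj.
rewrite -[RHS]card_ord -(card_imset _ wI).
apply: eq_card => i; rewrite inE; apply/idP/imsetP => [im|[j _ ->]]; last exact: (valP j).
by exists (Ordinal im) => //; apply: val_inj.
Qed.

(** Column j has l j positions before its pivot, of which j lie in the rows of earlier pivots. *)
Lemma card_free :
  #|[set p : 'I_n * 'I_d | free p.1 p.2]| = (\sum_(j < d) (l j - j))%N.
Proof.
rewrite -sum1_card (eq_bigl (fun p : 'I_n * 'I_d => free p.1 p.2)) => [|p]; last by rewrite inE.
rewrite -(pair_big_dep xpredT (fun i j => free i j) (fun _ _ => 1%N)).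
rewrite (exchange_big_dep xpredT) //=; apply: eq_bigr => j _.
pose A := s @: [set i : 'I_n | (i < l j)%N].
pose B := pivot @: [set k : 'I_d | (k < j)%N].
have BA : B \subset A.
  apply/fintype.subsetP => _ /imsetP[k + ->]; rewrite inE => kj.
  by apply: imset_f; rewrite inE li.
have <- : #|A :\: B| = (l j - j)%N.
  rewrite cardsDS // card_imset; last exact: perm_inj.
  by rewrite card_imset ?card_ord_lt // 1?ltnW //; exact: pivot_inj.
rewrite -sum1_card; apply: eq_bigl => i; rewrite !inE /free andbC.
have -> : i \in A = ((s^-1)%g i < l j)%N.
  by rewrite -{1}(permKV s i) mem_imset ?inE //; exact: perm_inj.
case: ltnP => ij; rewrite ?andbF // ?andbT; apply/idP/idP => [/forallP H|/negP H].
  by apply/negP; case/imsetP => k _ ik; move: (H k); rewrite ik eqxx.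
apply/forallP => k; apply/eqP => ik; apply: H; apply/imsetP; exists k => //.
rewrite inE -(increasing_lt _ _ li).
by move: ij; rewrite ik permK.
Qed.

End Frames.

(** * Topology of the orbifold *)

Section MatrixLimits.
Local Open Scope classical_set_scope.
Local Open Scope ring_scope.
Variables (K : numFieldType) (T : Type) (F : set_system T).
Context {FF : Filter F}.

Lemma cvg_mx m n (f : T -> 'M[K]_(m, n)) (A : 'M[K]_(m, n)) :
  (forall i j, f x i j @[x --> F] --> A i j) -> f x @[x --> F] --> A.
Proof.
move=> H B [P PA PB].
have H' : \forall x \near F, forall p : 'I_m * 'I_n, P p.1 p.2 (f x p.1 p.2).
  by apply: filter_forall => p; exact: H (PA p.1 p.2).
by apply: filterS H' => x Hx; apply: PB => i j; exact: (Hx (i, j)).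
Qed.

Lemma cvg_coord m n (f : T -> 'M[K]_(m, n)) (A : 'M[K]_(m, n)) i j :
  f x @[x --> F] --> A -> f x i j @[x --> F] --> A i j.
Proof. by move=> fA; exact: (cvg_comp _ _ fA (@coord_continuous _ _ _ i j A)). Qed.

Lemma cvg_sumr (I : Type) (r : seq I) (P : pred I) (f : I -> T -> K) (a : I -> K) :
  (forall i, P i -> f i x @[x --> F] --> a i) ->
  \sum_(i <- r | P i) f i x @[x --> F] --> \sum_(i <- r | P i) a i.
Proof. by move=> H; apply: cvg_big => //; exact: add_continuous. Qed.

Lemma cvg_prodr (I : Type) (r : seq I) (P : pred I) (f : I -> T -> K) (a : I -> K) :
  (forall i, P i -> f i x @[x --> F] --> a i) ->
  \prod_(i <- r | P i) f i x @[x --> F] --> \prod_(i <- r | P i) a i.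
Proof. by move=> H; apply: cvg_big => //; exact: mul_continuous. Qed.

Lemma cvg_mulmx m n p (f : T -> 'M[K]_(m, n)) (g : T -> 'M[K]_(n, p))
    (A : 'M[K]_(m, n)) (B : 'M[K]_(n, p)) :
  f x @[x --> F] --> A -> g x @[x --> F] --> B ->
  f x *m g x @[x --> F] --> A *m B.
Proof.
move=> fA gB; apply: cvg_mx => i j; rewrite !mxE.
under eq_fun do rewrite mxE.
by apply: cvg_sumr => k _; apply: cvgM; exact: cvg_coord.
Qed.

Lemma cvg_det n (f : T -> 'M[K]_n) (A : 'M[K]_n) :
  f x @[x --> F] --> A -> \det (f x) @[x --> F] --> \det A.
Proof.
move=> fA; rewrite /determinant; apply: cvg_sumr => s _; apply: cvgM; first exact: cvg_cst.
by apply: cvg_prodr => i _; exact: cvg_coord.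
Qed.

Lemma cvg_invmx n (f : T -> 'M[K]_n) (A : 'M[K]_n) : A \in unitmx ->
  f x @[x --> F] --> A -> invmx (f x) @[x --> F] --> invmx A.
Proof.
move=> uA fA; have dA : \det A != 0 by rewrite -unitfE -unitmxE.
have fd := cvg_det fA.
have E : \forall x \near F, (\det (f x))^-1 *: \adj (f x) = invmx (f x).
  near=> x; rewrite /invmx unitmxE unitfE ifT //.
  by near: x; exact: cvgr_neq0 fd dA.
apply: cvg_trans (near_eq_cvg E) _.
rewrite /invmx uA; apply: cvg_mx => i j; rewrite !mxE.
under eq_fun do rewrite !mxE.
apply: cvgM; first exact: cvgV.
apply: cvgM; first exact: cvg_cst.
by apply: cvg_det; apply: cvg_mx => i' j'; under eq_fun do rewrite !mxE; rewrite !mxE; exact: cvg_coord.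
Unshelve. all: by end_near.
Qed.

Lemma cvg_rowsub m n p (f : T -> 'M[K]_(m, n)) (h : 'I_p -> 'I_m) (A : 'M[K]_(m, n)) :
  f x @[x --> F] --> A -> rowsub h (f x) @[x --> F] --> rowsub h A.
Proof.
by move=> fA; apply: cvg_mx => i j; under eq_fun do rewrite mxE; rewrite mxE; exact: cvg_coord.
Qed.

Lemma cvg_minor n d (f : T -> 'M[K]_(n, d)) h (A : 'M[K]_(n, d)) :
  f x @[x --> F] --> A -> minor h (f x) @[x --> F] --> minor h A.
Proof. by move=> fA; apply: cvg_det; exact: cvg_rowsub. Qed.

Lemma cvg_exp (f : T -> K) (a : K) k :
  f x @[x --> F] --> a -> f x ^+ k @[x --> F] --> a ^+ k.
Proof.
move=> fa; elim: k => [|k IH]; first by under eq_fun do rewrite expr0; exact: cvg_cst.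
by under eq_fun do rewrite exprS; rewrite exprS; exact: cvgM.
Qed.

Lemma cvg_diag_mx n (f : T -> 'rV[K]_n) (A : 'rV[K]_n) :
  f x @[x --> F] --> A -> diag_mx (f x) @[x --> F] --> diag_mx A.
Proof.
move=> fA; apply: cvg_mx => i j; under eq_fun do rewrite mxE; rewrite mxE.
case: (i == j) => /=; first exact: cvg_coord.
by under eq_fun do rewrite mulr0n; exact: cvg_cst.
Qed.

Lemma cvg_row n (f : 'I_n -> T -> K) (g : 'I_n -> K) :
  (forall j, f j x @[x --> F] --> g j) ->
  \row_j f j x @[x --> F] --> (\row_j g j : 'rV[K]_n).
Proof.
move=> fg; apply: cvg_mx => i j; under eq_fun do rewrite mxE; rewrite mxE.
exact: fg.
Qed.
End MatrixLimits.

Section ComplexTopology.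
Local Open Scope classical_set_scope.
Local Open Scope ring_scope.

Lemma near_dist_lt (K : numFieldType) (V : pseudoMetricNormedZmodType K) (a : V) (e : K) :
  0 < e -> \forall b \near a, `|a - b| < e.
Proof.
by move=> e0; apply/nbhs_ballP; exists e => //= b; rewrite -ball_normE.
Qed.

Local Open Scope complex_scope.
Variable R : realType.
Local Notation C := (R[i] : numClosedFieldType).

Lemma continuous_of_dist (K K' : numFieldType) (V : pseudoMetricNormedZmodType K)
    (V' : pseudoMetricNormedZmodType K') (f : V -> V') (r : K' -> K) :
  (forall e, 0 < e -> 0 < r e /\ forall a b, `|a - b| < r e -> `|f a - f b| < e) ->
  continuous f.
Proof.
move=> H a; apply/cvgrPdist_lt => e /H[r0 fe].
exact: (filterS (fe a) (near_dist_lt a r0)).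
Qed.

Lemma real_complex_continuous : continuous (fun a : R => a%:C : C).
Proof.
apply: (@continuous_of_dist R C R C _ (fun e => complex.Re e)) => e e0.
have {e0} [er e0] : e = (complex.Re e)%:C /\ 0 < complex.Re e.
  by move: e0; case: e => x y; rewrite ltcE /= => /andP[/eqP -> ->].
split=> // a b ab; rewrite -rmorphB /= normc_def /= expr0n /= addr0 sqrtr_sqr er.
by rewrite ltcR.
Qed.

Lemma Re_continuous : continuous (fun z : C => complex.Re z).
Proof.
apply: (@continuous_of_dist C R C R _ (fun e => e%:C)) => e e0.
split=> [|a b ab]; first by rewrite ltcR.
rewrite -ltcR; apply: le_lt_trans ab.
by rewrite -raddfB /=; exact: normc_ge_Re.
Qed.

Lemma conjC_continuous : continuous (fun z : C => z^*%R).
Proof.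
apply: (@continuous_of_dist C C C C _ id) => e e0; split=> // a b.
by rewrite -rmorphB norm_conjC.
Qed.

Lemma compact_cdisc (M : C) : exists K : set C, compact K /\
  forall z : C, `|z| <= M -> K z.
Proof.
have [r rP] : exists r : R, forall z : C, `|z| <= M -> `|complex.Re z| <= r /\ `|complex.Im z| <= r.
  exists (complex.Re M) => z zM.
  move: zM; rewrite normc_def lecE => /andP[_ zM].
  split; apply: le_trans zM; rewrite -sqrtr_sqr ler_sqrt ?addr_ge0 ?sqr_ge0 //.
    by rewrite lerDl sqr_ge0.
  by rewrite lerDr sqr_ge0.
have cK := @rV_compact R 2 (fun _ => `[- r, r]%classic) (fun _ => @segment_compact _ _ _).
exists ((fun v : 'rV[R]_2 => (v ord0 ord0)%:C + 'i * (v ord0 ord_max)%:C : C) @`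
  [set v : 'rV[R]_2 | forall i, `[- r, r]%classic (v ord0 i)]); split.
  apply: continuous_compact cK; apply: continuous_subspaceT => v.
  have vc j : (fun w : 'rV[R]_2 => (w ord0 j)%:C : C) @ v --> ((v ord0 j)%:C : C).
    exact: (cvg_comp _ _ (@coord_continuous _ _ _ ord0 j v) (@real_complex_continuous _)).
  exact: (cvgD (vc ord0) (cvgM (cvg_cst ('i : C)) (vc ord_max))).
move=> z /rP[zr zi]; exists (\row_i if i == 0 then complex.Re z else complex.Im z); last first.
  by rewrite !mxE -complexE.
by move=> i /=; rewrite mxE in_itv /= -ler_norml; case: ifP.
Qed.
End ComplexTopology.

Section Compactness.
Local Open Scope classical_set_scope.
Local Open Scope ring_scope.
Variable R : realType.

Lemma cV_box_compact k (r : R) :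
  compact [set v : 'cV[R]_k | forall i, - r <= v i 0 <= r].
Proof.
have cK := @rV_compact R k (fun _ => `[- r, r]%classic) (fun _ => @segment_compact _ _ _).
rewrite (_ : mkset _ = trmx @` [set v : 'rV_k | forall i, `[- r, r]%classic (v ord0 i)]).
  apply: continuous_compact cK; apply: continuous_subspaceT => v.
  apply: (@cvg_mx _ _ (nbhs v)) => i j; under eq_fun do rewrite mxE; rewrite mxE.
  exact: coord_continuous.
apply/seteqP; split=> [v vr|_ [v vr <-] i]; last first.
  by have := vr i; rewrite /= in_itv /= mxE.
by exists v^T; rewrite ?trmxK // => i /=; rewrite in_itv /= mxE vr.
Qed.
End Compactness.

(** The summand 1 in the bound forces a violating t to have |t| > 1, so that |t| ^+ k >= |t|
    whatever the exponent k > 0. *)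
Lemma norm_le_of_pow (K : numFieldType) (t al be x y : K) (k : nat) : (0 < k)%N ->
  (0 < al)%R -> (0 <= be)%R -> (al / 2%:R < x)%R -> (y < be + 1)%R ->
  y = (`|t| ^+ k * x)%R -> (`|t| <= 1 + (be + 1) / (al / 2%:R))%R.
Proof.
move=> k0 al0 be0 xal ybe yE.
have al2 : (0 < al / 2%:R)%R by rewrite divr_gt0.
have q0 : (0 <= (be + 1) / (al / 2%:R))%R by rewrite divr_ge0 ?addr_ge0 // ltW.
rewrite real_leNgt ?normr_real //; last by rewrite ger0_real // addr_ge0.
apply/negP => tM.
have t1 : (1 < `|t|)%R by apply: le_lt_trans tM; rewrite lerDl.
have tk : ((be + 1) / (al / 2%:R) < `|t| ^+ k)%R.
  apply: (@lt_le_trans _ _ `|t|%R); first by apply: le_lt_trans tM; rewrite lerDr.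
  by rewrite -{1}(expr1 `|t|%R) ler_weXn2l // ltW.
suff : (be + 1 < be + 1)%R by rewrite ltxx.
apply: lt_trans ybe; rewrite yE.
apply: (@lt_trans _ _ (`|t| ^+ k * (al / 2%:R))%R); first by rewrite -ltr_pdivrMr.
by rewrite ltr_pM2l // exprn_gt0 // (lt_trans _ t1).
Qed.

(** * Open projections and the Hausdorff property *)

Section FullRank.
Local Open Scope classical_set_scope.
Local Open Scope ring_scope.
Local Open Scope quotient_scope.
Variables (R : realType) (n d : nat).
Local Notation C := (R[i] : numClosedFieldType).
Local Notation M := (full_rank R n d).

Lemma full_rankE (A : M) : \rank (\val A) = d.
Proof. exact: (set_mem (valP A)). Qed.

Lemma val_full_rank_continuous : continuous (fun A : M => \val A : 'M[C]_(n, d)).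
Proof. exact: initial_continuous. Qed.

Lemma cvg_full_rank (T : Type) (F : set_system T) {FF : Filter F} (f : T -> M) (A : M) :
  \val (f x) @[x --> F] --> (\val A : 'M[C]_(n, d)) -> f x @[x --> F] --> A.
Proof.
move=> fA B [_ [[U oU <-] UA] UB].
by apply: filterS UB _; apply: fA; exact: open_nbhs_nbhs.
Qed.

Lemma lmul_continuous (D : 'M[C]_n) : D \in unitmx ->
  continuous (@lmul R n d D).
Proof.
move=> uD A; apply: (@cvg_full_rank _ (nbhs A)).
rewrite val_lmul //; under eq_fun do rewrite val_lmul //.
apply: (@cvg_mulmx _ _ (nbhs A)); first exact: cvg_cst.
exact: val_full_rank_continuous.
Qed.

Lemma wdiag_unit (W : 'I_n -> nat) (t : C) : t != 0 -> wdiag W t \in unitmx.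
Proof.
move=> t0; rewrite unitmxE det_diag unitfE; apply/prodf_neq0 => i _.
by rewrite mxE expf_neq0.
Qed.

Lemma minor_wdiag (W : 'I_n -> nat) (t : C) (A : 'M[C]_(n, d)) f :
  minor f (wdiag W t *m A) = t ^+ (\sum_j W (f j)) * minor f A.
Proof.
rewrite minor_diag; under eq_bigr do rewrite mxE.
by rewrite prodrXr.
Qed.

Lemma wgr_relP W a (A B : M) : wgr_rel W a A B <->
  exists2 t : C, t != 0 &
    forall f, minor f (\val B) = t ^+ (a + \sum_j W (f j)) * minor f (\val A).
Proof.
split=> [[t [T [t0 uT tT BE]]]|[t t0 H]].
  by exists t => // f; rewrite BE minorM minor_wdiag -tT exprD mulrC mulrA.
have r : \rank (wdiag W t *m \val A) = d.
  by rewrite -(val_lmul A (wdiag_unit W t0)) full_rankE.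
have [T [uT tT BE]] : exists T : 'M[C]_d, [/\ T \in unitmx, \det T = t ^+ a &
    \val B = wdiag W t *m \val A *m T].
  apply: (minors_proportional r (expf_neq0 a t0)) => f.
  by rewrite H minor_wdiag exprD mulrA.
by exists t, T.
Qed.

Section Quotient.
Variables (W : 'I_n -> nat) (a : nat) (Q0 : quotType M).
Local Notation Q := (quotient_topology Q0).
Hypothesis Q0P : forall A B : M, \pi_Q A = \pi_Q B <-> wgr_rel W a A B.

(** The saturation of U is a union of preimages of U under the maps A |-> diag(t^w) A T. The section
    is stated for any quotient type with these fibres, so that it serves both for [WGr] and, with
    zero weights and a = 1, for [Gr]. *)
Lemma pi_open (U : set M) : open U -> open ((\pi_Q : M -> Q) @` U).
Proof.
move=> oU; change (open ((\pi_Q : M -> Q) @^-1` ((\pi_Q : M -> Q) @` U))).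
pose I := {tT : C * 'M[C]_d | [&& tT.1 != 0, tT.2 \in unitmx & tT.1 ^+ a == \det tT.2]}.
have -> : (\pi_Q : M -> Q) @^-1` ((\pi_Q : M -> Q) @` U) =
    \bigcup_(i in [set: I])
      ((fun A : M => rmul (lmul (wdiag W (val i).1) A) (val i).2) @^-1` U).
  apply/seteqP; split=> [A [B UB /esym/Q0P [t [T [t0 uT tT BE]]]]|].
    have iP : [&& (t, T).1 != 0, (t, T).2 \in unitmx & (t, T).1 ^+ a == \det (t, T).2].
      by apply/and3P; split=> //=; rewrite tT.
    exists (exist _ (t, T) iP) => //=; rewrite (_ : rmul _ _ = B) //.
    by apply: val_inj; rewrite val_rmul // val_lmul ?wdiag_unit.
  move=> A [[[t T] /= /and3P[/= t0 uT /eqP tT]] _ /= UA].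
  eexists; first exact: UA; apply/esym/Q0P; exists t, T; split=> //.
  by rewrite val_rmul // val_lmul ?wdiag_unit.
apply: bigcup_open => -[[t T] /= /and3P[/= t0 uT _]] _.
have /continuousP : continuous (fun A : M => rmul (lmul (wdiag W t) A) T).
  move=> A; apply: (@cvg_full_rank _ (nbhs A)).
  rewrite val_rmul // val_lmul ?wdiag_unit //.
  under eq_fun do rewrite val_rmul // val_lmul ?wdiag_unit //.
  apply: (@cvg_mulmx _ _ (nbhs A)); last exact: cvg_cst.
  apply: (@cvg_mulmx _ _ (nbhs A)); first exact: cvg_cst.
  exact: val_full_rank_continuous.
by apply.
Qed.

Hypothesis a0 : (0 < a)%N.

(** If the classes of A0 and B0 cannot be separated, any two neighborhoods U and V contain
    equivalent matrices. The parameters t of these equivalences generate a proper filter G; once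
    they are confined to a compact set, a cluster point t0 relates A0 to B0. *)
Lemma quotient_hausdorff : hausdorff_space Q.
Proof.
move=> p q; rewrite -[p]reprK -[q]reprK.
move: (repr p) (repr q) => A0 B0 pq.
pose S (U V : set M) := [set t : C | exists A B : M, [/\ U A, V B &
  forall f, minor f (\val B) = t ^+ (a + \sum_j W (f j)) * minor f (\val A)]].
pose G := filter_from [set UV : set M * set M | nbhs A0 UV.1 /\ nbhs B0 UV.2]
  (fun UV => S UV.1 UV.2).
have S0 U V : nbhs A0 U -> nbhs B0 V -> S U V !=set0.
  move=> /nbhs_interior A0U /nbhs_interior B0V.
  have piI (A1 : M) (U1 : set M) : nbhs A1 U1 -> nbhs (\pi_Q A1) ((\pi_Q : M -> Q) @` U1).
    rewrite nbhsE => -[U2 [oU2 UA2] U21]; apply: (@filterS _ _ _ ((\pi_Q : M -> Q) @` U2)).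
      exact: image_subset.
    by apply: open_nbhs_nbhs; split; [exact: pi_open|exists A1].
  have [_ [[A UA <-] [B VB /esym/Q0P/wgr_relP[t t0 AB]]]] := pq _ _ (piI _ _ A0U) (piI _ _ B0V).
  by exists t, A, B; split=> //; apply: nbhs_singleton.
have PG : ProperFilter G.
  apply: filter_from_proper => [|[U V] [/= ? ?]]; last exact: S0.
  apply: filter_from_filter; first by exists (setT, setT); split; exact: filterT.
  move=> [U1 V1] [U2 V2] /= [? ?] [? ?]; exists (U1 `&` U2, V1 `&` V2).
    by split; exact: filterI.
  by move=> t [A [B [[? ?] [? ?] AB]]]; split; exists A, B.
have cm f (A : M) : (fun A : M => minor f (\val A) : C) @ A --> (minor f (\val A) : C).
  by apply: (@cvg_minor _ _ (nbhs A)); exact: val_full_rank_continuous.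
have [g gA0] := exists_minor (full_rankE A0).
(* Near A0 the minor g stays above half its modulus, and near B0 it is bounded, so the equation
   between these minors bounds t. Only an upper bound is needed here; t0 != 0 is shown at the
   end. *)
pose al := `|minor g (\val A0)|; pose be := `|minor g (\val B0)|.
have al0 : 0 < al by rewrite normr_gt0.
have be0 : 0 <= be := normr_ge0 _.
pose Mx : C := 1 + (be + 1) / (al / 2%:R).
have [K [cK KM]] := compact_cdisc Mx.
have GK : G K.
  exists ([set A : M | al / 2%:R < `|minor g (\val A)|], [set B : M | `|minor g (\val B)| < be + 1]).
    split=> /=.
      have := near_dist_lt (minor g (\val A0)) (divr_gt0 al0 (ltr0Sn C 1)).
      move=> N; apply: (@filterS _ (nbhs A0) _ _ _ _ (cm g A0 _ N)) => A /= H.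
      have := lerB_dist (minor g (\val A0)) (minor g (\val A0) - minor g (\val A)).
      rewrite subKr -/al => H2; apply: lt_le_trans H2.
      by rewrite ltrBrDr [ltRHS]splitr ltrD2l.
    have := near_dist_lt (minor g (\val B0)) (ltr01 : 0 < 1 :> C).
    move=> N; apply: (@filterS _ (nbhs B0) _ _ _ _ (cm g B0 _ N)) => B /= H.
    rewrite -[minor g (\val B)](subrK (minor g (\val B0))) addrC.
    apply: le_lt_trans (ler_normD _ _) _.
    by rewrite ltrD2l distrC.
  move=> t [A [B [/= Aal Bbe AB]]]; apply: KM.
  apply: (@norm_le_of_pow _ _ _ _ _ _ _ _ al0 be0 Aal Bbe); last first.
    by rewrite AB normrM normrX.
  by rewrite addn_gt0 a0.
have [t0 [_ Gt0]] := cK G PG GK.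
have AB0 f : minor f (\val B0) = t0 ^+ (a + \sum_j W (f j)) * minor f (\val A0).
  (* If the equation failed at (A0, B0, t0), it would fail on a whole neighborhood; but t0 is a
     cluster point of parameters for which it holds at matrices near A0 and B0. *)
  apply/eqP/negPn/negP => ne.
  pose h (X : M * M * C) : C :=
    minor f (\val X.1.2) - X.2 ^+ (a + \sum_j W (f j)) * minor f (\val X.1.1).
  have hc : h X @[X --> (A0, B0, t0)] --> h (A0, B0, t0).
    have FF : Filter (nbhs (A0, B0, t0)) by exact: nbhs_filter.
    have c1 : X.1.1 @[X --> (A0, B0, t0)] --> A0.
      exact: (cvg_comp _ _ (@cvg_fst _ _ _ _ _) (@cvg_fst _ _ _ _ _)).
    have c2 : X.1.2 @[X --> (A0, B0, t0)] --> B0.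
      exact: (cvg_comp _ _ (@cvg_fst _ _ _ _ _) (@cvg_snd _ _ _ _ _)).
    have c3 : X.2 @[X --> (A0, B0, t0)] --> t0 by exact: cvg_snd.
    apply: cvgB; first exact: (cvg_comp _ _ c2 (cm f B0)).
    apply: cvgM; first exact: cvg_exp c3.
    exact: (cvg_comp _ _ c1 (cm f A0)).
  have hne : h (A0, B0, t0) != 0 by rewrite subr_eq0.
  have /= [[UV Wt] /= [[[U V] /= [UA VB] UVs] Wt0] UVW] :=
    @cvgr_neq0 _ _ _ _ (nbhs_filter _) _ _ hc hne.
  have GUV : G (S U V) by exists (U, V).
  have [t [[A [B [UA' VB' AB]]] Wt']] := Gt0 (S U V) Wt GUV Wt0.
  have := UVW (A, B, t) (conj (UVs (A, B) (conj UA' VB')) Wt').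
  by rewrite /h /= AB subrr eqxx.
(* With t0 = 0 every minor of B0 would vanish, all exponents being positive. *)
have t00 : t0 != 0.
  have [f fB] := exists_minor (full_rankE B0).
  by apply: contraNneq fB => t00; rewrite AB0 t00 expr0n addn_eq0 (gtn_eqF a0) mul0r.
by apply/Q0P/wgr_relP; exists t0.
Qed.
End Quotient.

End FullRank.

Section FullRankQ.
Local Open Scope classical_set_scope.
Local Open Scope ring_scope.
Local Open Scope quotient_scope.
Variables (R : realType) (n d : nat).
Local Notation C := (R[i] : numClosedFieldType).
Local Notation M := (full_rank R n d).

Lemma pi_WGrP W a (A B : M) :
  \pi_(WGr R d W a) A = \pi_(WGr R d W a) B <-> wgr_rel W a A B.
Proof.
have E := rwP (@eqmodP M (@wgr_equiv R n d W a) A B).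
have H := iff_sym (rwP (asboolP (wgr_rel W a A B))).
change ((\pi_{eq_quot (wgr_equiv R d W a)} A = \pi_{eq_quot (wgr_equiv R d W a)} B) <-> wgr_rel W a A B).
exact: iff_trans E H.
Qed.

Lemma pi_GrP (A B : M) :
  \pi_(Gr R n d) A = \pi_(Gr R n d) B <-> gr_rel A B.
Proof.
have E := rwP (@eqmodP M (@gr_equiv R n d) A B).
have H := iff_sym (rwP (asboolP (gr_rel A B))).
change ((\pi_{eq_quot (gr_equiv R n d)} A = \pi_{eq_quot (gr_equiv R n d)} B) <-> gr_rel A B).
exact: iff_trans E H.
Qed.

(** With zero weights diag(t^w) is the identity, and for a = 1 the equation t = det T merely defines
    t. *)
Lemma gr_rel_wgr_rel (A B : M) : gr_rel A B <-> wgr_rel (fun _ : 'I_n => 0%N) 1 A B.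
Proof. have D1 (t : C) : wdiag (fun _ : 'I_n => 0%N) t = 1%:M :> 'M[C]_n.
  by rewrite -(wdiag1 R (fun _ : 'I_n => 0%N)); congr diag_mx; apply/rowP => i; rewrite !mxE.
split=> [[T uT BE]|[t [T [_ uT _ BE]]]]; last by exists T; rewrite ?BE ?D1 ?mul1mx.
by exists (\det T), T; rewrite D1 mul1mx expr1; split=> //; rewrite -unitfE -unitmxE.
Qed.

Lemma WGr_hausdorff (W : 'I_n -> nat) a : (0 < a)%N -> hausdorff_space (WGr R d W a).
Proof.  by apply: quotient_hausdorff => A B; exact: pi_WGrP. Qed.

Lemma Gr_hausdorff : hausdorff_space (Gr R n d).
Proof.
apply: (@quotient_hausdorff R n d (fun _ : 'I_n => 0%N) 1 {eq_quot (gr_equiv R n d)}) => // A B.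
exact: iff_trans (pi_GrP A B) (gr_rel_wgr_rel A B).
Qed.

End FullRankQ.

(** * Adjunction topology and inverse charts from compactness *)

Section Attach.
Local Open Scope classical_set_scope.

(** A is covered by its part in Y, cut out by a closed set, and by the image of the part of D lying
    over A. That image is compact, hence closed in a Hausdorff space. *)
Lemma attach_closed (T X : topologicalType) (D : set T) (Phi : T -> X) (Y e : set X) :
  hausdorff_space X -> compact D -> continuous Phi -> closed Y -> e `<=` Phi @` D ->
  forall A : set X, A `<=` Y `|` e -> closed (A `&` Y : set (subspace Y)) ->
    closed (D `&` Phi @^-1` A) -> closed (A : set (subspace (Y `|` e))).
Proof.
move=> hX cD cPhi cY eD A AYe /closed_subspaceP[V cV VA] cDA.
apply/closed_subspaceP; exists ((V `&` Y) `|` Phi @` (D `&` Phi @^-1` A)).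
  apply: closedU; first exact: closedI.
  apply: compact_closed => //; apply: continuous_compact; first exact: continuous_subspaceT.
  by apply: subclosed_compact cDA cD _ => x [].
rewrite VA; apply/seteqP; split=> [x [[[[Ax _] _]|[t [_ ?] <-]] Yex]|x [Ax Yex]]; split=> //.
have [Yx|/eD[t Dt tx]] := AYe _ Ax; first by left.
by right; exists t => //; split=> //=; rewrite tx.
Qed.

(** As w tends to z in E, the points psi' w have cluster points y in the compact D. Continuity gives
    Phi y = proj z, which excludes the boundary, so y is in U; then psi y = z and y = psi' z. The
    detour through Phi is what excludes y from the boundary, where psi need not be continuous. *)
Lemma chart_inverse_continuous (T X Q : topologicalType) (U D : set T) (E : set Q)
    (psi : T -> Q) (psi' : Q -> T) (Phi : T -> X) (proj : Q -> X) :
  hausdorff_space T -> hausdorff_space X -> hausdorff_space Q ->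
  open U -> compact D -> U `<=` D ->
  {within U, continuous psi} -> continuous Phi -> {within E, continuous proj} ->
  (forall x, U x -> E (psi x) /\ psi' (psi x) = x) ->
  (forall z, E z -> U (psi' z) /\ psi (psi' z) = z) ->
  (forall x, U x -> Phi x = proj (psi x)) ->
  (forall x z, D x -> ~ U x -> E z -> Phi x <> proj z) ->
  {within E, continuous psi'}.
Proof.
move=> hT hX hQ oU cD UD cpsi cPhi cproj psiK psi'K PhiE PhiN.
have UE := subspace_continuousP U psi; have EE := subspace_continuousP E proj.
apply/subspace_continuousP => z Ez.
pose F := psi' @ within E (nbhs z).
have PW : ProperFilter (within E (nbhs z)).
  by apply: within_nbhs_proper; apply: subset_closure.
have PF : ProperFilter F by exact: fmap_proper_filter.
have FD : F D.
  by apply: (@filterS _ _ _ E); [move=> w Ew; exact/UD/(psi'K w Ew).1|exact: withinT].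
have FB B : nbhs z B -> F (psi' @` (B `&` E)).
  move=> zB; rewrite /F /fmap /=; apply: filterS zB => w Bw Ew.
  by exists w.
apply: (@compact_cluster_set1 _ (psi' z) F D) => //.
  by apply: filterS UD _; apply: open_nbhs_nbhs; split=> //; exact: (psi'K z Ez).1.
have sub y : cluster F y -> y = psi' z.
  move=> Fy.
  have Dy : D y.
    by apply: (compact_closed hT cD) => B By; exact: Fy FD By.
  have Phiy : Phi y = proj z.
    apply: hX => V V' yV zV'.
    have nV : nbhs y (Phi @^-1` V) by exact: cPhi.
    have /EE/(_ z Ez V' zV') nV' := cproj.
    have [_ [[w [wV' Ew] <-] /= wV]] := Fy _ _ (FB _ nV') nV.
    exists (Phi (psi' w)); split=> //.
    by have [Uw ww] := psi'K w Ew; rewrite PhiE // ww; exact: wV'.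
  have Uy : U y by apply: contrapT => /(PhiN y z Dy)/(_ Ez); apply.
  suff <- : psi y = z by rewrite (psiK y Uy).2.
  apply: hQ => V V' yV zV'.
  have /UE/(_ y Uy V yV) nV := cpsi.
  have [_ [[w [wV' Ew] <-] /= wV]] := Fy _ _ (FB _ zV') nV.
  have [Uw ww] := psi'K w Ew.
  by exists w; split=> //; rewrite -ww; exact: wV.
apply/seteqP; split=> [y /sub //|_ ->].
have [y [_ Fy]] := cD F PF FD.
by rewrite -(sub y Fy).
Qed.
End Attach.

(** * Schubert cells *)

Section Cells.
Local Open Scope classical_set_scope.
Local Open Scope ring_scope.
Local Open Scope quotient_scope.
Variables (R : realType) (n d : nat).
Local Notation C := (R[i] : numClosedFieldType).
Local Notation M := (full_rank R n d).
Implicit Types (s : 'S_n) (l : schubert_symbol n d) (A B : M).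

Lemma symbol_increasing l : increasing (val l).
Proof. by move=> i j ij; have /forallP/(_ i)/forallP/(_ j)/implyP := valP l; apply. Qed.

Lemma in_cell_gr_rel s l A B : gr_rel A B ->
  in_cell s (val l) (\val A) <-> in_cell s (val l) (\val B).
Proof. by move=> [T uT ->]; rewrite (in_cellM _ _ _ uT). Qed.

Lemma schubert_cellE s l (X : Gr R n d) :
  schubert_cell s l X <-> in_cell s (val l) (\val (repr X)).
Proof. exact: iff_sym (in_cellP s (\val (repr X)) (symbol_increasing l)). Qed.

Lemma gr_rel_repr A : gr_rel (repr (\pi_(Gr R n d) A)) A.
Proof. by apply/pi_GrP; exact: reprK. Qed.

Lemma schubert_cell_pi s l A :
  schubert_cell s l (\pi_(Gr R n d) A) <-> in_cell s (val l) (\val A).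
Proof. exact: iff_trans (schubert_cellE _ _ _) (in_cell_gr_rel _ _ (gr_rel_repr A)). Qed.

Lemma in_cell_wdiag s l (W : 'I_n -> nat) (t : C) (A : 'M[C]_(n, d)) : t != 0 ->
  in_cell s (val l) A -> in_cell s (val l) (wdiag W t *m A).
Proof.
move=> t0; apply: in_cell_diag; first exact: symbol_increasing.
by move=> i; rewrite mxE expf_neq0.
Qed.

Lemma in_cell_wgr_rel s l W a A B : wgr_rel W a A B ->
  in_cell s (val l) (\val A) -> in_cell s (val l) (\val B).
Proof.
move=> [t [T [t0 uT _ ->]]] lA.
by apply/(in_cellM _ _ _ uT); apply: in_cell_wdiag.
Qed.

Definition normal_mx s l A : M := rmul A (invmx (pivot_rows s l (\val A))).

Lemma val_normal_mx s l A : in_cell s (val l) (\val A) ->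
  \val (normal_mx s l A) = \val A *m invmx (pivot_rows s l (\val A)).
Proof. by move=> [uA _]; rewrite val_rmul ?unitmx_inv. Qed.

Lemma pivot_rowsM s l (A : 'M[C]_(n, d)) T : pivot_rows s l (A *m T) = pivot_rows s l A *m T.
Proof. exact: rowsubM. Qed.

Lemma pivot_rows_normal s l A : in_cell s (val l) (\val A) ->
  pivot_rows s l (\val (normal_mx s l A)) = 1%:M.
Proof. by move=> lA; rewrite val_normal_mx // pivot_rowsM mulmxV //; case: lA. Qed.

Lemma pivot_rows_wdiag s l (W : 'I_n -> nat) (t : C) (A : 'M[C]_(n, d)) :
  pivot_rows s l (wdiag W t *m A) =
  diag_mx (\row_j t ^+ W (s (val l j))) *m pivot_rows s l A.
Proof. by apply/matrixP => i j; rewrite [LHS]mxE !mul_diag_mx !mxE. Qed.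

Lemma schubert_proj_pi W a s l A : in_cell s (val l) (\val A) ->
  schubert_proj W a s l (\pi_(Gr R n d) A) = \pi_(WGr R d W a) (normal_mx s l A).
Proof.
move=> lA; apply: (congr1 (fun B => \pi_(WGr R d W a) B)).
have lr : in_cell s (val l) (\val (repr (\pi_(Gr R n d) A))).
  by apply/schubert_cellE/schubert_cell_pi.
apply: val_inj; rewrite !val_normal_mx //.
have [T uT ->] := gr_rel_repr A; set B := \val (repr _).
rewrite pivot_rowsM invmx_mul //; last by case: lr.
by rewrite mulmxA mulmxK.
Qed.

(** Multiplying by diag(t^w) scales the pivot determinant by t to the sum of the pivot weights. The
    inverse of the new block thus has determinant t^a precisely when t^c det = 1, where c is the
    weight of the cell. *)
Lemma wgr_rel_normal W a s l A (t : C) : t != 0 -> in_cell s (val l) (\val A) ->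
  t ^+ (schubert_weight W a s l) * \det (pivot_rows s l (\val A)) = 1 ->
  wgr_rel W a A (normal_mx s l (lmul (wdiag W t) A)).
Proof.
move=> t0 lA tA; have uD := wdiag_unit W t0.
have lDA : in_cell s (val l) (\val (lmul (wdiag W t) A)).
  by rewrite (val_lmul _ uD); exact: in_cell_wdiag.
exists t, (invmx (pivot_rows s l (\val (lmul (wdiag W t) A)))); split=> //.
- by rewrite unitmx_inv; case: lDA.
- rewrite det_inv val_lmul // pivot_rows_wdiag det_mulmx det_diag.
  under eq_bigr do rewrite mxE.
  rewrite prodrXr; move: tA; rewrite /schubert_weight exprD -mulrA => tA.
  by apply: (mulIf (_ : t ^+ (\sum_j W (s (val l j))) * \det (pivot_rows s l (\val A)) != 0));
    rewrite ?tA ?mulVf //; apply: contraTneq (oner_neq0 C) => E; rewrite -tA E mulr0 eqxx.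
- by rewrite val_normal_mx // val_lmul.
Qed.

(** Each class in the cell has a representative with identity pivot block: the determinant can be
    rescaled by any t^c with t != 0, and c-th roots exist in C because c >= a > 0. *)
Lemma qsupp_pi W a s l A : (0 < a)%N ->
  qsupp (schubert_qcell R W a s l) (\pi_(WGr R d W a) A) <-> in_cell s (val l) (\val A).
Proof.
move=> a0; split=> [[X /schubert_cellE lX /pi_WGrP XA]|lA].
  apply: (@in_cell_wgr_rel s l W a _ _ XA); rewrite (val_normal_mx lX).
  have uX : invmx (pivot_rows s l (\val (repr X))) \in unitmx by rewrite unitmx_inv; case: lX.
  exact/(in_cellM _ _ _ uX).
have c0 : (0 < schubert_weight W a s l)%N by rewrite addn_gt0 a0.
have dA : \det (pivot_rows s l (\val A)) != 0 by case: lA; rewrite unitmxE unitfE.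
pose t : C := (schubert_weight W a s l).-root (\det (pivot_rows s l (\val A)))^-1.
have tc : t ^+ schubert_weight W a s l * \det (pivot_rows s l (\val A)) = 1.
  by rewrite rootCK // mulVf.
have t0 : t != 0.
  by apply: contra_eq_neq tc => ->; rewrite expr0n (gtn_eqF c0) mul0r eq_sym oner_neq0.
have lD : in_cell s (val l) (\val (lmul (wdiag W t) A)).
  by rewrite (val_lmul _ (wdiag_unit W t0)); exact: in_cell_wdiag.
exists (\pi_(Gr R n d) (lmul (wdiag W t) A)); first exact/schubert_cell_pi.
rewrite /= schubert_proj_pi //; apply/pi_WGrP/wgr_rel_sym.
exact: wgr_rel_normal.
Qed.

Lemma in_cell_symbol s A : exists l, in_cell s (val l) (\val A).
Proof.
have [l [li lA]] := in_cell_exists s (full_rankE A).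
have lP : [forall i : 'I_d, forall j : 'I_d, (i < j)%N ==> (finfun l i < finfun l j)%N].
  apply/forallP => i; apply/forallP => j; apply/implyP => ij; rewrite !ffunE; exact: li.
exists (exist _ (finfun l) lP) => /=.
have E : pivot_block s (finfun l) (\val A) = pivot_block s l (\val A).
  by apply/matrixP => i j; rewrite !mxE ffunE.
by case: lA => uA vA; split; rewrite E // => i j; rewrite ffunE; exact: vA.
Qed.

Lemma symbol_unique s l (m : schubert_symbol n d) A : in_cell s (val l) (\val A) ->
  in_cell s (val m) (\val A) -> l = m.
Proof.
move=> lA mA; apply/val_inj/ffunP => j.
exact: (in_cell_unique (symbol_increasing l) (symbol_increasing m) lA mA).
Qed.

Lemma gr_lmul_pi (D : 'M[C]_n) A : D \in unitmx ->
  gr_lmul D (\pi_(Gr R n d) A) = \pi_(Gr R n d) (lmul D A).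
Proof.
move=> uD; apply/pi_GrP; have [T uT AE] := gr_rel_repr A.
by exists T => //; rewrite !val_lmul // AE mulmxA.
Qed.

Lemma weight_predK W a s l : (0 < a)%N ->
  (schubert_weight W a s l).-1.+1 = schubert_weight W a s l :> nat.
Proof. by move=> a0; rewrite prednK // addn_gt0 a0. Qed.

Lemma unity_neq0 c (g : unity_group R c) : unity_val g != 0.
Proof.
by apply: contra_eq_neq (unity_valP g) => ->; rewrite expr0n eq_sym oner_neq0.
Qed.

Lemma unity_norm c (g : unity_group R c) : `|unity_val g| = 1.
Proof.
apply/eqP; rewrite -(@pexpr_eq1 _ _ c.-1.+1) // -normrX unity_valP normr1 //.
Qed.

(** This is where G(c) arises. If two matrices with identity pivot block are related by (t, T),
    comparing pivot determinants gives t^(sum of pivot weights) det T = 1, that is, t^c = 1.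
    Conversely, for t^c = 1 the same comparison shows det T = t^a. *)
Lemma wgr_rel_normals W a s l A B : (0 < a)%N ->
  in_cell s (val l) (\val A) -> in_cell s (val l) (\val B) ->
  wgr_rel W a (normal_mx s l A) (normal_mx s l B) <->
  exists g : unity_group R (schubert_weight W a s l),
    gr_rel (lmul (wdiag W (unity_val g)) A) B.
Proof.
move=> a0 lA lB; have pA := pivot_rows_normal lA; have pB := pivot_rows_normal lB.
have [uA _] := lA; have [uB _] := lB.
split=> [[t [T [t0 uT tT BE]]]|[g [T uT BE]]].
  have tc : t ^+ (schubert_weight W a s l).-1.+1 = 1.
    rewrite weight_predK // /schubert_weight exprD tT.
    move: pB; rewrite BE pivot_rowsM pivot_rows_wdiag pA mulmx1 => /(congr1 determinant).
    rewrite det_mulmx det_diag det1 mulrC => <-; congr (_ * _).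
    by under [RHS]eq_bigr do rewrite mxE; rewrite prodrXr.
  have tG : t \in unity_roots R (schubert_weight W a s l) by rewrite Defs.mem_unity_roots tc.
  exists (SeqSub tG); exists (invmx (pivot_rows s l (\val A)) *m T *m pivot_rows s l (\val B)).
    by rewrite !unitmx_mul unitmx_inv uA uT.
  rewrite val_lmul ?wdiag_unit //= !mulmxA.
  move: BE; rewrite (val_normal_mx lA) (val_normal_mx lB).
  by move/(congr1 (mulmx^~ (pivot_rows s l (\val B)))); rewrite (mulmxKV uB) !mulmxA.
have g0 := unity_neq0 g; set t := unity_val g in g0 BE.
exists t, (pivot_rows s l (\val A) *m T *m invmx (pivot_rows s l (\val B))).
have E : \val (normal_mx s l B) = wdiag W t *m \val (normal_mx s l A) *m
     (pivot_rows s l (\val A) *m T *m invmx (pivot_rows s l (\val B))).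
  rewrite (val_normal_mx lA) (val_normal_mx lB) BE (val_lmul _ (wdiag_unit W g0)).
  by rewrite !mulmxA (mulmxKV uA).
split; [exact: g0| | |exact: E]; first by rewrite !unitmx_mul unitmx_inv uA uT.
move: pB; rewrite E pivot_rowsM pivot_rows_wdiag pA mulmx1 => /(congr1 determinant).
rewrite det_mulmx det_diag det1; under eq_bigr do rewrite mxE.
rewrite prodrXr => H; have := unity_valP g; rewrite weight_predK // exprD -/t -H mulrC.
by apply: mulfI; rewrite expf_neq0.
Qed.

Lemma Gr_pi (z : Gr R n d) : exists A, z = \pi_(Gr R n d) A.
Proof. by exists (repr z); apply/esym; exact: reprK. Qed.

Lemma WGr_pi W a (z : WGr R d W a) : exists A, z = \pi_(WGr R d W a) A.
Proof. by exists (repr z); apply/esym; exact: reprK. Qed.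

Lemma schubert_proj_orbit W a s l z1 z2 : (0 < a)%N ->
  schubert_cell s l z1 -> schubert_cell s l z2 ->
  (schubert_proj W a s l z1 = schubert_proj W a s l z2 <->
   exists g : unity_group R (schubert_weight W a s l),
     z2 = gr_lmul (wdiag W (unity_val g)) z1).
Proof.
have [[A ->] [B ->]] := (Gr_pi z1, Gr_pi z2).
move=> a0 /schubert_cell_pi lA /schubert_cell_pi lB.
rewrite (schubert_proj_pi _ _ lA) (schubert_proj_pi _ _ lB).
apply: (iff_trans (pi_WGrP _ _ _ _)); apply: (iff_trans (wgr_rel_normals _ a0 lA lB)).
split=> -[g gAB]; exists g; move: gAB;
  rewrite (gr_lmul_pi _ (wdiag_unit W (unity_neq0 g))).
  by move=> H; apply/esym/pi_GrP.
by move=> H; apply/pi_GrP/esym.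
Qed.

(** The choice of [repr] is not continuous, so continuity is checked on matrices. There
    normalization is continuous wherever the pivot block is invertible, and neighborhoods descend
    because the projection to [Gr] is open. *)
Lemma schubert_proj_continuous W a s l :
  {within schubert_cell s l, continuous (@schubert_proj R n d W a s l)}.
Proof.
apply/subspace_continuousP => z; have [A ->] := Gr_pi z; move=> lA B.
have {}lA := (schubert_cell_pi s l A).1 lA.
move=> piB; have {}piB : nbhs (\pi_(WGr R d W a) (normal_mx s l A)) B.
  by rewrite -(schubert_proj_pi W a lA).
have uA : pivot_rows s l (\val A) \in unitmx by case: lA.
have cA : (fun B : M => normal_mx s l B) @ A --> normal_mx s l A.
  have cv := @val_full_rank_continuous R n d A.
  have cp : (fun B : M => pivot_rows s l (\val B)) @ A --> pivot_rows s l (\val A).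
    exact: (@cvg_rowsub _ _ (nbhs A) _ _ _ _ _ _ _ cv).
  have cd := @cvg_det _ _ (nbhs A) (nbhs_filter A) _ _ _ cp.
  have nz : \forall B \near A, pivot_rows s l (\val B) \in unitmx.
    have : \det (pivot_rows s l (\val A)) != 0 by rewrite -unitfE -unitmxE.
    move/(@cvgr_neq0 _ _ _ _ _ _ _ cd); apply: (@filterS _ (nbhs A)) => B0.
    by rewrite unitmxE unitfE.
  apply: (@cvg_full_rank _ _ _ _ (nbhs A)).
  rewrite (val_normal_mx lA).
  apply: cvg_trans (@cvg_mulmx _ _ (nbhs A) _ _ _ _ _ _ _ _ cv (@cvg_invmx _ _ (nbhs A) _ _ _ _ uA cp)).
  apply: near_eq_cvg; apply: (@filterS _ (nbhs A) _ _ _ _ nz) => B0 uB0.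
  by rewrite val_rmul ?unitmx_inv.
have nA : nbhs A [set A' : M | B (\pi_(WGr R d W a) (normal_mx s l A'))].
  exact: (cA _ (@pi_continuous M {eq_quot (wgr_equiv R d W a)} (normal_mx s l A) B piB)).
have [U [oU UA] UB] : exists2 U : set M, open_nbhs A U &
    U `<=` [set A' : M | B (\pi_(WGr R d W a) (normal_mx s l A'))].
  by move: nA; rewrite nbhsE.
suff nU : nbhs (\pi_(Gr R n d) A) ((\pi_(Gr R n d) : M -> Gr R n d) @` U).
  change (nbhs (\pi_(Gr R n d) A) [set z | schubert_cell s l z -> B (schubert_proj W a s l z)]).
  apply: (@filterS _ (nbhs (\pi_(Gr R n d) A)) _ _ _ _ nU) => _ [A' UA' <-] /schubert_cell_pi lA'.
  change (B (schubert_proj W a s l (\pi_(Gr R n d) A'))).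
  by rewrite (schubert_proj_pi _ _ lA'); exact: UB.
apply: open_nbhs_nbhs; split; last by exists A.
apply: (@pi_open _ _ _ (fun _ : 'I_n => 0%N) 1 {eq_quot (gr_equiv R n d)}) => // A1 B1.
exact: iff_trans (pi_GrP A1 B1) (gr_rel_wgr_rel A1 B1).
Qed.

End Cells.

(** * Characteristic maps *)

Section SupNorm.
Local Open Scope ring_scope.
Lemma entry_le_mx_norm (K : numDomainType) m n (A : 'M[K]_(m, n)) i j : `|A i j| <= `|A|.
Proof.
have -> : `|A| = mx_norm A by [].
rewrite mx_normE -[leLHS]nngE num_le.
exact: (le_bigmax _ (fun p : 'I_m * 'I_n => `|A p.1 p.2|%:nng) (i, j)).
Qed.
End SupNorm.

Section Modulus.
Local Open Scope classical_set_scope.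
Local Open Scope ring_scope.
Local Open Scope complex_scope.
Variable R : realType.
Local Notation C := (R[i] : numClosedFieldType).

(** Norms over C are themselves elements of R[i]; this is the underlying real number, to which real
    square roots, logarithms and orders apply. *)
Definition modulus (V : normedZmodType C) (z : V) : R := complex.Re `|z|.

Lemma modulusE (V : normedZmodType C) (z : V) : `|z| = (modulus z)%:C.
Proof. by rewrite RRe_real // normr_real. Qed.

Lemma modulus_ge0 (V : normedZmodType C) (z : V) : 0 <= modulus z.
Proof. by rewrite -ler0c -modulusE. Qed.

Lemma modulus_eq0 (V : normedZmodType C) (z : V) : (modulus z == 0) = (z == 0).
Proof. by rewrite -(inj_eq (@complexI R)) -modulusE normr_eq0. Qed.

Lemma modulusM (z w : C) : modulus (z * w) = modulus z * modulus w.
Proof. by apply: complexI; rewrite rmorphM /= -!modulusE normrM. Qed.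

Lemma modulusX (z : C) k : modulus (z ^+ k) = modulus z ^+ k.
Proof. by apply: complexI; rewrite rmorphXn /= -!modulusE normrX. Qed.

Lemma modulusV (z : C) : modulus z^-1 = (modulus z)^-1.
Proof. by apply: complexI; rewrite fmorphV /= -!modulusE normfV. Qed.

Lemma modulus_real (r : R) : modulus (r%:C : C) = `|r|.
Proof. by rewrite /modulus normc_def /= expr0n addr0 sqrtr_sqr. Qed.

Lemma modulus_cvg (V : normedModType C) (T : Type) (F : set_system T) {FF : Filter F}
    (f : T -> V) (v : V) :
  f x @[x --> F] --> v -> modulus (f x) @[x --> F] --> modulus v.
Proof.
move=> fv; exact: (cvg_comp _ _ (cvg_norm fv) (@Re_continuous R _)).
Qed.

Lemma modulusZ (V : normedModType C) (z : C) (v : V) : modulus (z *: v) = modulus z * modulus v.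
Proof. by apply: complexI; rewrite rmorphM /= -!modulusE normrZ. Qed.

Lemma modulus_entry m n (A : 'M[C]_(m, n)) i j : modulus (A i j) <= modulus A.
Proof. by rewrite -lecR -!modulusE; exact: entry_le_mx_norm. Qed.

Lemma mx_norm_attained m n (A : 'M[C]_(m, n)) : A != 0 ->
  exists i j, modulus A = modulus (A i j).
Proof.
rewrite -normr_eq0 => /mx_norm_neq0[[i j] /= E]; exists i, j.
by rewrite /modulus -E.
Qed.

Lemma modulus_le m n (A : 'M[C]_(m, n)) (r : R) : 0 <= r ->
  (forall i j, modulus (A i j) <= r) -> modulus A <= r.
Proof.
have [->|A0] := eqVneq A 0; last by have [i [j ->]] := mx_norm_attained A0.
by move=> r0 _; rewrite (_ : modulus _ = 0) //; apply/eqP; rewrite modulus_eq0.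
Qed.

Lemma modulus_sqr (z : C) : modulus z ^+ 2 = complex.Re z ^+ 2 + complex.Im z ^+ 2.
Proof.
by rewrite /modulus normc_def /= sqr_sqrtr // addr_ge0 ?sqr_ge0.
Qed.

Lemma eq_modulus_mx m n (A B : 'M[C]_(m, n)) :
  (forall i j, modulus (A i j) = modulus (B i j)) -> modulus A = modulus B.
Proof.
move=> AB; apply/eqP; rewrite eq_le !modulus_le ?modulus_ge0 // => i j.
  by rewrite -AB modulus_entry.
by rewrite AB modulus_entry.
Qed.

Lemma modulus_col m n (A : 'M[C]_(m, n)) j : modulus (col j A) <= modulus A.
Proof. by apply: modulus_le => [|i k]; rewrite ?modulus_ge0 // mxE modulus_entry. Qed.

Lemma modulus_col_attained m n (A : 'M[C]_(m, n)) : A != 0 ->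
  exists j, modulus (col j A) = modulus A.
Proof.
move=> A0; have [i [j E]] := mx_norm_attained A0; exists j.
apply/eqP; rewrite eq_le modulus_col /= E.
have -> : A i j = col j A i ord0 by rewrite mxE.
exact: modulus_entry.
Qed.

End Modulus.

(** * The real disc as a polydisc of complex matrices *)

Section Coordinates.
Local Open Scope classical_set_scope.
Local Open Scope ring_scope.
Local Open Scope complex_scope.
Variables (R : realType) (n d k : nat) (F : {set 'I_n * 'I_d}).
Hypothesis cardF : #|F| = k.
Local Notation C := (R[i] : numClosedFieldType).
Local Notation X := ({q | q \in F} * bool)%type.
Implicit Types (x : 'cV[R]_(2 * k)) (Z : 'M[C]_(n, d)).

Lemma card_coord : #|{: X}| = (2 * k)%N.
Proof. by rewrite card_prod card_sig card_bool mulnC cardF. Qed.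

Definition coord_of (p : X) : 'I_(2 * k) := cast_ord card_coord (enum_rank p).
Definition of_coord (i : 'I_(2 * k)) : X := enum_val (cast_ord (esym card_coord) i).

Lemma coord_ofK : cancel coord_of of_coord.
Proof. by move=> p; rewrite /of_coord cast_ordK enum_rankK. Qed.

Lemma of_coordK : cancel of_coord coord_of.
Proof. by move=> i; rewrite /coord_of enum_valK cast_ordKV. Qed.

Lemma sum_coord (f : 'I_(2 * k) -> R) :
  \sum_i f i = \sum_(q : {q | q \in F}) (f (coord_of (q, false)) + f (coord_of (q, true))).
Proof.
rewrite (reindex coord_of); last by exists of_coord => p _; [exact: coord_ofK|exact: of_coordK].
rewrite [RHS](eq_bigr (fun q => \sum_b f (coord_of (q, b)))) => [|q _].
  by rewrite pair_bigA; apply: eq_bigr => -[].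
by rewrite big_bool /= addrC.
Qed.

Definition on_support Z := forall i j, (i, j) \notin F -> Z i j = 0.

Definition to_mx x : 'M[C]_(n, d) := \matrix_(i, j)
  if insub (i, j) is Some q then x (coord_of (q, false)) 0 +i* x (coord_of (q, true)) 0 else 0.

Definition of_mx Z : 'cV[R]_(2 * k) := \col_p
  let: (q, b) := of_coord p in
  if b then complex.Im (Z (val q).1 (val q).2) else complex.Re (Z (val q).1 (val q).2).

Lemma to_mx_support x : on_support (to_mx x).
Proof. by move=> i j ijF; rewrite mxE insubN. Qed.

Lemma to_mxE x (q : {q | q \in F}) : to_mx x (val q).1 (val q).2 =
  x (coord_of (q, false)) 0 +i* x (coord_of (q, true)) 0.
Proof. by rewrite mxE -surjective_pairing valK. Qed.

Lemma to_mxK : cancel to_mx of_mx.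
Proof.
move=> x; apply/colP => p; rewrite mxE -{2}(of_coordK p).
by case: (of_coord p) => q [] /=; rewrite to_mxE.
Qed.

Lemma of_mxK Z : on_support Z -> to_mx (of_mx Z) = Z.
Proof.
move=> sZ; apply/matrixP => i j; have [ijF|ijF] := boolP ((i, j) \in F); last first.
  by rewrite to_mx_support // sZ.
have := to_mxE (of_mx Z) (exist (fun q => q \in F) (i, j) ijF) => /= ->.
by rewrite !mxE !coord_ofK /=; case: (Z i j).
Qed.

Definition sqnorm Z : R := \sum_i \sum_j modulus (Z i j) ^+ 2.

Lemma sqnorm_to_mx x : sqnorm (to_mx x) = \sum_i x i 0 ^+ 2.
Proof.
rewrite sum_coord /sqnorm pair_bigA /=.
rewrite (bigID (fun p => p \in F)) /= [X in _ + X]big1 ?addr0 => [|[i j] ijF]; last first.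
  rewrite to_mx_support // (_ : modulus _ = 0) ?expr0n //.
  by apply/eqP; rewrite modulus_eq0.
rewrite big_sub; apply: eq_bigr => q _.
by rewrite to_mxE modulus_sqr.
Qed.

Lemma to_mx_cvg (T : Type) (G : set_system T) {FG : Filter G} (f : T -> 'cV[R]_(2 * k)) x :
  f t @[t --> G] --> x -> to_mx (f t) @[t --> G] --> (to_mx x : 'M[C]_(n, d)).
Proof.
move=> fx; apply: (@cvg_mx _ _ G) => i j; rewrite mxE; under eq_fun do rewrite mxE.
case: insub => [q|]; last exact: cvg_cst.
have E (y : 'cV[R]_(2 * k)) : y (coord_of (q, false)) 0 +i* y (coord_of (q, true)) 0 =
    (y (coord_of (q, false)) 0)%:C + 'i * (y (coord_of (q, true)) 0)%:C :> C.
  by simpc.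
have c b : (fun t => (f t (coord_of (q, b)) 0)%:C : C) @ G --> ((x (coord_of (q, b)) 0)%:C : C).
  have := @cvg_coord _ _ G _ _ f x (coord_of (q, b)) 0 fx.
  by move=> H; exact: (cvg_comp _ _ H (@real_complex_continuous R _)).
have -> : (fun t => f t (coord_of (q, false)) 0 +i* f t (coord_of (q, true)) 0 : C) =
    (fun t => (f t (coord_of (q, false)) 0)%:C + 'i * (f t (coord_of (q, true)) 0)%:C : C).
  by apply/funext => t; exact: E.
rewrite E; have := cvgD (c false) (cvgM (cvg_cst ('i : C)) (c true)).
exact.
Qed.

Definition norm2 x : R := Num.sqrt (\sum_i x i 0 ^+ 2).

(** Cutting 1 - |x| off at 0 keeps the scale positive and continuous on the whole space, so the maps
    built on it are globally continuous. From the sphere outwards the image has sup norm exactly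
    1. *)
Definition disc_scale x : R := Num.max (1 - norm2 x) 0 + modulus (to_mx x).

(* The disc is carried onto the polydisc of matrices of sup norm at most 1,
   radially, by x |-> x / (1 - |x| + sup |x|). *)
Definition polydisc x : 'M[C]_(n, d) := (disc_scale x)^-1%:C *: to_mx x.

Lemma modulus_le_norm2 Z : modulus Z <= Num.sqrt (sqnorm Z).
Proof.
apply: modulus_le => [|i j]; first exact: sqrtr_ge0.
rewrite -[leLHS]ger0_norm ?modulus_ge0 // -sqrtr_sqr ler_sqrt; last first.
  by apply: sumr_ge0 => i' _; apply: sumr_ge0 => j' _; rewrite sqr_ge0.
rewrite /sqnorm (bigD1 i) //= (bigD1 j) //= -addrA lerDl addr_ge0 //.
  by apply: sumr_ge0 => j' _; rewrite sqr_ge0.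
by apply: sumr_ge0 => i' _; apply: sumr_ge0 => j' _; rewrite sqr_ge0.
Qed.

Lemma norm2E x : norm2 x = Num.sqrt (sqnorm (to_mx x)).
Proof. by rewrite sqnorm_to_mx. Qed.

Lemma disc_scale_gt0 x : 0 < disc_scale x.
Proof.
rewrite /disc_scale; have [x1|x1] := ltP (norm2 x) 1.
  by apply: ltr_pwDl; rewrite ?modulus_ge0 // lt_max subr_gt0 x1.
apply: ltr_wpDl; first by rewrite le_max lexx orbT.
rewrite lt_def modulus_ge0 andbT modulus_eq0; apply: contraTneq x1 => Z0.
rewrite norm2E Z0 /sqnorm big1 ?sqrtr0 -?ltNge ?ltr01 // => i _.
rewrite big1 // => j _; rewrite mxE (_ : modulus _ = 0) ?expr0n //.
by apply/eqP; rewrite modulus_eq0.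
Qed.

Lemma modulus_polydisc x : modulus (polydisc x) = modulus (to_mx x) / disc_scale x.
Proof.
by rewrite modulusZ modulus_real ger0_norm ?invr_ge0 ?(ltW (disc_scale_gt0 x)) // mulrC.
Qed.

Lemma polydisc_le1 x : modulus (polydisc x) <= 1.
Proof.
by rewrite modulus_polydisc ler_pdivrMr ?disc_scale_gt0 // mul1r lerDr le_max lexx orbT.
Qed.

Lemma polydisc_lt1 x : norm2 x < 1 -> modulus (polydisc x) < 1.
Proof.
by move=> x1; rewrite modulus_polydisc ltr_pdivrMr ?disc_scale_gt0 // mul1r ltrDr lt_max subr_gt0 x1.
Qed.

Lemma polydisc_eq1 x : 1 <= norm2 x -> modulus (polydisc x) = 1.
Proof.
move=> x1; have s0 := disc_scale_gt0 x; rewrite modulus_polydisc.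
by move: s0; rewrite /disc_scale max_r ?subr_le0 // add0r => s0; rewrite divff // gt_eqF.
Qed.

Lemma polydisc_support x : on_support (polydisc x).
Proof. by move=> i j ijF; rewrite mxE to_mx_support // mulr0. Qed.

Lemma sqnormZ (a : R) Z : sqnorm (a%:C *: Z) = a ^+ 2 * sqnorm Z.
Proof.
rewrite /sqnorm mulr_sumr; apply: eq_bigr => i _; rewrite mulr_sumr; apply: eq_bigr => j _.
by rewrite mxE modulusM modulus_real exprMn real_normK ?num_real.
Qed.

Lemma norm2_polydisc x : Num.sqrt (sqnorm (polydisc x)) = norm2 x / disc_scale x.
Proof.
rewrite sqnormZ norm2E sqrtrM ?sqr_ge0 // sqrtr_sqr ger0_norm 1?mulrC //.
by rewrite invr_ge0 ltW ?disc_scale_gt0.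
Qed.

(** The scale can be read off the image Z, as its inverse is 1 + |Z| - sup |Z|. The same formula
    produces the preimage in [polydisc_surj]. *)
Lemma polydisc_inj x x' : norm2 x < 1 -> norm2 x' < 1 -> polydisc x = polydisc x' -> x = x'.
Proof.
have E y : norm2 y < 1 ->
    (disc_scale y)^-1 = 1 + Num.sqrt (sqnorm (polydisc y)) - modulus (polydisc y).
  move=> y1; rewrite norm2_polydisc modulus_polydisc; have s0 := disc_scale_gt0 y.
  have s0' : disc_scale y != 0 by rewrite gt_eqF.
  apply: (mulIf s0'); rewrite mulVf // mulrBl mulrDl mul1r !mulfVK //.
  by rewrite /disc_scale max_l ?subr_ge0 1?ltW //; ring.
move=> x1 x1' xx'; apply: (can_inj to_mxK).
have sE : (disc_scale x)^-1 = (disc_scale x')^-1 by rewrite (E x x1) xx' -(E x' x1').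
have s0 : (disc_scale x')^-1%:C != 0 :> C.
  by rewrite -[0]/(0%:C) (inj_eq (@complexI R)) invr_neq0 // gt_eqF ?disc_scale_gt0.
by apply: (scalerI s0); move: xx'; rewrite /polydisc sE.
Qed.

Lemma polydisc_surj Z : on_support Z -> modulus Z < 1 ->
  exists2 x, norm2 x < 1 & polydisc x = Z.
Proof.
move=> sZ Z1; pose r := Num.sqrt (sqnorm Z); pose mu := modulus Z.
have rmu : mu <= r by exact: modulus_le_norm2.
have q0 : 0 < 1 + r - mu by rewrite -addrA ltr_pwDl // subr_ge0.
pose kap := (1 + r - mu)^-1.
have k0 : 0 < kap by rewrite invr_gt0.
have xE : to_mx (of_mx (kap%:C *: Z)) = kap%:C *: Z.
  by rewrite of_mxK // => i j ijF; rewrite mxE sZ // mulr0.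
set x := of_mx _ in xE.
have xn : norm2 x = kap * r.
  rewrite norm2E xE sqnormZ sqrtrM ?sqr_ge0 // sqrtr_sqr ger0_norm //; exact: ltW.
have x1 : norm2 x < 1.
  by rewrite xn mulrC ltr_pdivrMr // mul1r -addrA addrCA ltrDl subr_gt0.
exists x => //; have sE : disc_scale x = kap.
  rewrite /disc_scale max_l; last by rewrite subr_ge0 ltW.
  rewrite xn xE modulusZ modulus_real (ger0_norm (ltW k0)) -/mu.
  have -> : 1 = kap * (1 + r - mu) by rewrite mulVf // gt_eqF.
  by ring.
rewrite /polydisc sE xE scalerA -rmorphM /= mulVf ?scale1r // gt_eqF //.
Qed.

Lemma norm2_cvg (T : Type) (G : set_system T) {FG : Filter G} (f : T -> 'cV[R]_(2 * k)) x :
  f t @[t --> G] --> x -> norm2 (f t) @[t --> G] --> norm2 x.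
Proof.
move=> fx; apply: (@continuous_cvg _ _ _ G _ _ (@Num.sqrt R)); first exact: sqrt_continuous.
apply: (@cvg_sumr _ _ G) => i _; apply: (@cvg_exp _ _ G).
exact: (@cvg_coord _ _ G).
Qed.

Lemma disc_scale_cvg (T : Type) (G : set_system T) {FG : Filter G} (f : T -> 'cV[R]_(2 * k)) x :
  f t @[t --> G] --> x -> disc_scale (f t) @[t --> G] --> disc_scale x.
Proof.
move=> fx; apply: cvgD; last by apply: (@modulus_cvg R _ _ G); exact: to_mx_cvg.
have c1 : 1 - norm2 (f t) @[t --> G] --> 1 - norm2 x.
  by apply: cvgB; [exact: cvg_cst|exact: norm2_cvg].
have c2 : {for 1 - norm2 x, continuous ((id : R -> R) \max cst 0)}.
  by apply: continuous_max; [exact: cvg_id|exact: cvg_cst].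
exact: (cvg_comp _ _ c1 c2).
Qed.

Lemma polydisc_cvg (T : Type) (G : set_system T) {FG : Filter G} (f : T -> 'cV[R]_(2 * k)) x :
  f t @[t --> G] --> x -> polydisc (f t) @[t --> G] --> (polydisc x : 'M[C]_(n, d)).
Proof.
move=> fx; have sc : (fun t => (disc_scale (f t))^-1%:C : C) @ G --> ((disc_scale x)^-1%:C : C).
  have sV : (disc_scale (f t))^-1 @[t --> G] --> (disc_scale x)^-1.
    by apply: cvgV; [rewrite gt_eqF ?disc_scale_gt0|exact: disc_scale_cvg].
  exact: (cvg_comp _ _ sV (@real_complex_continuous R _)).
apply: (@cvg_mx _ _ G) => i j; rewrite mxE; under eq_fun do rewrite mxE.
have cz := @cvg_coord _ _ G _ _ (fun t => to_mx (f t)) _ i j (@to_mx_cvg _ _ FG _ _ fx).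
exact: (cvgM sc cz).
Qed.

End Coordinates.

Section FrameLimits.
Local Open Scope classical_set_scope.
Local Open Scope ring_scope.
Variables (R : realType) (n d : nat) (s : 'S_n) (l : 'I_d -> 'I_n).
Local Notation C := (R[i] : numClosedFieldType).

Definition sup_norm (v : 'cV[C]_n) : C := `|v|.

Variables (T : Type) (G : set_system T).
Context {FG : Filter G}.

Lemma rot_cvg j (f : T -> 'cV[C]_n) (v : 'cV[C]_n) : f t @[t --> G] --> v ->
  rot s l sup_norm j (f t) @[t --> G] --> rot s l sup_norm j v.
Proof.
move=> fv; apply: (@cvg_mx _ _ G) => i k; rewrite mxE; under eq_fun do rewrite mxE.
have cv i0 := @cvg_coord _ _ G _ _ f v i0 0 fv.
have ch : (fun t => height sup_norm (f t) : C) @ G --> (height sup_norm v : C).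
  exact: (cvgB (cvg_cst _) (cvg_norm fv)).
have cc : (fun t => (f t k 0)^* : C) @ G --> ((v k 0)^* : C).
  exact: (cvg_comp _ _ (cv k) (@conjC_continuous R _)).
exact: (cvgD (cvgB (cvgD (cvg_cst _) (cvgM (cv i) (cvg_cst _))) (cvgM (cvg_cst _) cc))
  (cvgM (cvgM (cvgB ch (cvg_cst _)) (cvg_cst _)) (cvg_cst _))).
Qed.

Lemma col_cvg m p (f : T -> 'M[C]_(m, p)) (A : 'M[C]_(m, p)) j : f t @[t --> G] --> A ->
  col j (f t) @[t --> G] --> col j A.
Proof.
move=> fA; apply: (@cvg_mx _ _ G) => i k; rewrite mxE; under eq_fun do rewrite mxE.
exact: (@cvg_coord _ _ G _ _ f A i j fA).
Qed.

Lemma frame_cvg (f : T -> 'M[C]_(n, d)) (Y : 'M[C]_(n, d)) : f t @[t --> G] --> Y ->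
  frame s l sup_norm (f t) @[t --> G] --> frame s l sup_norm Y.
Proof.
move=> fY; apply: (@cvg_mulmx _ _ G); last exact: cvg_cst.
suff H k : rots s l sup_norm (fun j => col j (f t)) k @[t --> G] -->
    rots s l sup_norm (fun j => col j Y) k by exact: H.
elim: k => [|k IH]; first exact: (@cvg_cst _ (1%:M : 'M[C]_n) _ G FG).
apply: (@cvg_mulmx _ _ G _ _ _ _ _ _ _ _ IH).
case: insubP => [j _ _|_]; last exact: (@cvg_cst _ (1%:M : 'M[C]_n) _ G FG).
by apply: rot_cvg; apply: col_cvg.
Qed.
End FrameLimits.

Section FullRankLimits.
Local Open Scope classical_set_scope.
Local Open Scope ring_scope.
Variables (R : realType) (n d : nat) (T : topologicalType).
Local Notation C := (R[i] : numClosedFieldType).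

Lemma cvg_full_rank_eq (f : T -> full_rank R n d) (x : T) (g : T -> 'M[C]_(n, d)) :
  (forall t, \val (f t) = g t) -> g t @[t --> x] --> g x -> f t @[t --> x] --> f x.
Proof.
move=> fg; have -> : g = (fun t => \val (f t)) by apply/funext => t; rewrite fg.
move=> H; exact: (@cvg_full_rank _ _ _ _ (nbhs x) _ f (f x) H).
Qed.
End FullRankLimits.

(** * The characteristic map and its lift to the Schubert cell *)

Section Chart.
Local Open Scope classical_set_scope.
Local Open Scope ring_scope.
Local Open Scope complex_scope.
Local Open Scope quotient_scope.
Variables (R : realType) (n d : nat).
Hypothesis d0 : (0 < d)%N.
Local Notation C := (R[i] : numClosedFieldType).
Local Notation M := (full_rank R n d).
Variables (W : 'I_n -> nat) (a : nat) (s : 'S_n) (l : schubert_symbol n d).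
Hypothesis a0 : (0 < a)%N.
Local Notation disc := 'cV[R]_(2 * schubert_dim l).
Local Notation nu := (@sup_norm R n).
Local Notation weight := (schubert_weight W a s l).
Implicit Types (x : disc).

Lemma sup_norm_ge0 (v : 'cV[C]_n) : 0 <= nu v.
Proof. exact: normr_ge0. Qed.

Lemma sup_normZ (k : C) (v : 'cV[C]_n) : nu (k *: v) = `|k| * nu v.
Proof. exact: normrZ. Qed.

Lemma eq_sup_norm (v w : 'cV[C]_n) : (forall i, `|v i 0| = `|w i 0|) -> nu v = nu w.
Proof.
move=> vw; rewrite /sup_norm !modulusE (eq_modulus_mx (B := w)) // => i j.
by rewrite ord1 /modulus vw.
Qed.

Definition free_set : {set 'I_n * 'I_d} := finset (fun p => free s (val l) p.1 p.2).

Lemma card_free_dim : #|free_set| = schubert_dim l.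
Proof. exact: card_free (symbol_increasing l). Qed.

Definition chart_polydisc x : 'M[C]_(n, d) := polydisc card_free_dim x.

Lemma on_support_free (Z : 'M[C]_(n, d)) :
  on_support free_set Z <-> supported s (val l) Z.
Proof. by split=> sZ i j ij; apply: sZ; move: ij; rewrite inE. Qed.

Lemma chart_supported x : supported s (val l) (chart_polydisc x).
Proof. exact/on_support_free/polydisc_support. Qed.

Lemma chart_bounded x : bounded nu (chart_polydisc x).
Proof.
move=> j; rewrite /sup_norm modulusE -[1]/(1%:C) lecR.
exact: le_trans (modulus_col _ _) (polydisc_le1 _ _).
Qed.

Definition chart_frame x : 'M[C]_(n, d) := frame s (val l) nu (chart_polydisc x).

Lemma chart_frame_rank x : \rank (chart_frame x) = d.
Proof.
exact: (frame_rank (symbol_increasing l) sup_normZ (chart_supported x) (@chart_bounded x)).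
Qed.

Definition chart_point x : M := exist _ (chart_frame x) (mem_set (chart_frame_rank x)).

Lemma chart_frame_cvg (T : Type) (G : set_system T) {FG : Filter G} (f : T -> disc) x :
  f t @[t --> G] --> x -> chart_frame (f t) @[t --> G] --> (chart_frame x : 'M[C]_(n, d)).
Proof. by move=> fx; apply: (@frame_cvg _ _ _ _ _ _ G); exact: polydisc_cvg. Qed.

(** An l1 norm of the Pluecker vector. Summing over all row selections instead of increasing ones
    costs only a factor d!, as repeated rows give minor 0. *)
Definition plucker_norm (A : 'M[C]_(n, d)) : R :=
  \sum_(f : {ffun 'I_d -> 'I_n}) modulus (minor f A).

Lemma plucker_norm_gt0 (A : 'M[C]_(n, d)) : \rank A = d -> 0 < plucker_norm A.
Proof.
move=> /exists_minor[f fA]; rewrite /plucker_norm (bigD1 (finfun f)) //= ltr_pwDl //.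
  rewrite lt_def modulus_ge0 andbT modulus_eq0.
  have -> : minor (finfun f) A = minor f A; last exact: fA.
  by congr (\det _); apply/matrixP => i j; rewrite !mxE ffunE.
by apply: sumr_ge0 => *; exact: modulus_ge0.
Qed.

Lemma plucker_norm_cvg (T : Type) (G : set_system T) {FG : Filter G} (f : T -> 'M[C]_(n, d)) A :
  f t @[t --> G] --> (A : 'M[C]_(n, d)) -> plucker_norm (f t) @[t --> G] --> plucker_norm A.
Proof.
move=> fA; apply: (@cvg_sumr _ _ G) => h _.
exact: (@modulus_cvg R C _ G FG _ _ (@cvg_minor _ _ G _ _ _ f h A fA)).
Qed.

Definition pivot_det x : R := modulus (\det (pivot_rows s l (chart_frame x))).

(** The pivot minor is a product of heights, which are real and nonnegative on the closed polydisc,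
    so no phase is lost by taking the modulus. *)
Lemma pivot_detE x : \det (pivot_rows s l (chart_frame x)) = (pivot_det x)%:C.
Proof.
rewrite -modulusE ger0_norm //.
have := det_pivot_frame (symbol_increasing l) nu (chart_supported x).
rewrite -[pivot_block _ _ _]/(pivot_rows s l (chart_frame x)) => ->.
by apply: prodr_ge0 => j _; rewrite subr_ge0; exact: chart_bounded.
Qed.

Lemma pivot_det_eq0 x : (pivot_det x == 0) = (1 <= norm2 x).
Proof.
rewrite /pivot_det modulus_eq0.
have := det_pivot_frame (symbol_increasing l) nu (chart_supported x).
rewrite -[pivot_block _ _ _]/(pivot_rows s l (chart_frame x)) => ->.
have hE j : (height nu (col j (chart_polydisc x)) == 0) =
    (modulus (col j (chart_polydisc x)) == 1).
  by rewrite /height /sup_norm modulusE subr_eq0 eq_sym -[1]/(1%:C) (inj_eq (@complexI R)).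
have [x1|x1] := leP 1 (norm2 x).
  have p1 := polydisc_eq1 card_free_dim x1.
  have [j jE] : exists j, modulus (col j (chart_polydisc x)) = modulus (chart_polydisc x).
    by apply: modulus_col_attained; rewrite -modulus_eq0 p1 oner_eq0.
  by apply/prodf_eq0; exists j => //; rewrite hE jE /chart_polydisc p1.
apply/negbTE/prodf_neq0 => j _; rewrite hE lt_eqF //.
exact: le_lt_trans (modulus_col _ _) (polydisc_lt1 card_free_dim x1).
Qed.

Lemma pivot_det_cvg (T : Type) (G : set_system T) {FG : Filter G} (f : T -> disc) x :
  f t @[t --> G] --> x -> pivot_det (f t) @[t --> G] --> pivot_det x.
Proof.
move=> fx; exact: (@modulus_cvg R C _ G FG _ _ (@cvg_minor _ _ G _ _ _ (fun t => chart_frame (f t))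
  (fun j => s (val l j)) _ (chart_frame_cvg fx))).
Qed.

(** Scaling a single column divides every maximal minor by exactly the norm, without a d-th root;
    this needs d > 0. *)
Definition chart_scaling x : 'M[C]_d :=
  diag_mx (\row_j (if j == Ordinal d0 then (plucker_norm (chart_frame x))^-1%:C else 1)).

Lemma det_chart_scaling x : \det (chart_scaling x) = (plucker_norm (chart_frame x))^-1%:C.
Proof.
rewrite det_diag (bigD1 (Ordinal d0)) //= mxE eqxx big1 ?mulr1 // => j j0.
by rewrite mxE (negPf j0).
Qed.

Lemma plucker_norm_frame_gt0 x : 0 < plucker_norm (chart_frame x).
Proof. exact/plucker_norm_gt0/chart_frame_rank. Qed.

Lemma chart_scaling_unit x : chart_scaling x \in unitmx.
Proof.
rewrite unitmxE det_chart_scaling unitfE -[0]/(0%:C) (inj_eq (@complexI R)).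
by rewrite invr_neq0 // gt_eqF // plucker_norm_frame_gt0.
Qed.

Definition chart_map x : WGr R d W a := \pi_(WGr R d W a) (rmul (chart_point x) (chart_scaling x)).

Lemma chart_map_continuous : continuous chart_map.
Proof.
move=> x; apply: (@continuous_comp _ _ _ (fun x => rmul (chart_point x) (chart_scaling x))
   (\pi_(WGr R d W a) : M -> WGr R d W a)); last exact: pi_continuous.
apply: (@cvg_full_rank_eq _ _ _ _ _ x (fun t => chart_frame t *m chart_scaling t)
  (fun t => val_rmul (chart_point t) (chart_scaling_unit t))).
have cX : chart_frame t @[t --> x] --> (chart_frame x : 'M[C]_(n, d)) by
  exact: (@chart_frame_cvg _ (nbhs x) (nbhs_filter x) (fun t => t) x (@cvg_id _ (nbhs x))).
apply: (@cvg_mulmx _ _ (nbhs x)); first exact: cX.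
apply: (@cvg_diag_mx _ _ (nbhs x)); apply: (@cvg_row _ _ (nbhs x)) => j.
case: eqP => _; last exact: cvg_cst.
have cp : (plucker_norm (chart_frame t))^-1 @[t --> x] --> (plucker_norm (chart_frame x))^-1.
  have n0 : plucker_norm (chart_frame x) != 0 by rewrite gt_eqF // plucker_norm_frame_gt0.
  exact: (cvgV n0 (@plucker_norm_cvg _ (nbhs x) (nbhs_filter x) _ _ cX)).
exact: (cvg_comp _ _ cp (@real_complex_continuous R _)).
Qed.

(* The inverse of the scaling of [chart_map] is realized, up to the equivalence
   defining WGr, by diag(r^w) for this r. *)
Definition flow_time x : R := expR (ln (plucker_norm (chart_frame x) / pivot_det x) / weight%:R).

Lemma weight_gt0 : (0 < weight)%N.
Proof. by rewrite addn_gt0 a0. Qed.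

Lemma flow_time_gt0 x : 0 < flow_time x.
Proof. exact: expR_gt0. Qed.

Lemma pivot_det_gt0 x : norm2 x < 1 -> 0 < pivot_det x.
Proof. by move=> x1; rewrite lt_def modulus_ge0 andbT pivot_det_eq0 -ltNge. Qed.

Lemma flow_timeX x : norm2 x < 1 ->
  flow_time x ^+ weight = plucker_norm (chart_frame x) / pivot_det x.
Proof.
move=> x1; rewrite /flow_time -expRM_natl mulrC mulfVK ?pnatr_eq0 -?lt0n ?weight_gt0 //.
by rewrite lnK // posrE divr_gt0 ?plucker_norm_frame_gt0 ?pivot_det_gt0.
Qed.

Lemma flow_time_cvg x : norm2 x < 1 -> flow_time t @[t --> x] --> flow_time x.
Proof.
move=> x1; have q0 : 0 < plucker_norm (chart_frame x) / pivot_det x.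
  by rewrite divr_gt0 ?plucker_norm_frame_gt0 ?pivot_det_gt0.
have n0 : pivot_det x != 0 by rewrite gt_eqF // pivot_det_gt0.
have cX := @chart_frame_cvg _ (nbhs x) (nbhs_filter x) (fun t => t) x (@cvg_id _ (nbhs x)).
have cp := @pivot_det_cvg _ (nbhs x) (nbhs_filter x) (fun t => t) x (@cvg_id _ (nbhs x)).
have cq : plucker_norm (chart_frame t) / pivot_det t @[t --> x] -->
    plucker_norm (chart_frame x) / pivot_det x.
  exact: (cvgM (@plucker_norm_cvg _ (nbhs x) (nbhs_filter x) _ _ cX) (cvgV n0 cp)).
have cl : ln (plucker_norm (chart_frame t) / pivot_det t) / weight%:R @[t --> x] -->
    ln (plucker_norm (chart_frame x) / pivot_det x) / weight%:R.
  exact: (cvgM (cvg_comp _ _ cq (continuous_ln q0)) (cvg_cst _)).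
exact: (cvg_comp _ _ cl (@continuous_expR R _)).
Qed.

Definition flow x : 'M[C]_n := wdiag W (flow_time x)%:C.

Lemma flow_neq0 x : (flow_time x)%:C != 0 :> C.
Proof. by rewrite -[0]/(0%:C) (inj_eq (@complexI R)) gt_eqF ?flow_time_gt0. Qed.

Lemma flow_unit x : flow x \in unitmx.
Proof. exact/wdiag_unit/flow_neq0. Qed.

Definition chart_cell x : Gr R n d := \pi_(Gr R n d) (lmul (flow x) (chart_point x)).

Lemma chart_cell_cvg x : norm2 x < 1 -> chart_cell t @[t --> x] --> chart_cell x.
Proof.
move=> x1; apply: (@continuous_comp _ _ _ (fun x => lmul (flow x) (chart_point x))
   (\pi_(Gr R n d) : M -> Gr R n d)); last exact: pi_continuous.
apply: (@cvg_full_rank_eq _ _ _ _ _ x (fun t => flow t *m chart_frame t)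
  (fun t => val_lmul (chart_point t) (flow_unit t))).
apply: (@cvg_mulmx _ _ (nbhs x)); last first.
  exact: (@chart_frame_cvg _ (nbhs x) (nbhs_filter x) (fun t => t) x (@cvg_id _ (nbhs x))).
apply: (@cvg_diag_mx _ _ (nbhs x)); apply: (@cvg_row _ _ (nbhs x)) => j.
apply: (@cvg_exp _ _ (nbhs x)).
exact: (cvg_comp _ _ (flow_time_cvg x1) (@real_complex_continuous R _)).
Qed.

End Chart.

(** * Phases as real orthogonal matrices *)

Section PhaseMatrices.
Local Open Scope ring_scope.
Local Open Scope complex_scope.
Variables (R : realType) (n d k : nat) (F : {set 'I_n * 'I_d}).
Hypothesis cardF : #|F| = k.
Local Notation C := (R[i] : numClosedFieldType).
Implicit Types (tau : 'I_n -> 'I_d -> C) (x : 'cV[R]_(2 * k)).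

(** The real matrix of multiplication by z, with [false] for the real part and [true] for the
    imaginary part. *)
Definition rot2 (z : C) (b b' : bool) : R :=
  if b == b' then complex.Re z else if b then complex.Im z else - complex.Im z.

Definition phase_mx tau : 'M[R]_(2 * k) := \matrix_(p, q)
  (if (of_coord cardF p).1 == (of_coord cardF q).1 then
     rot2 (tau (val (of_coord cardF p).1).1 (val (of_coord cardF p).1).2)
       (of_coord cardF p).2 (of_coord cardF q).2
   else 0).

Lemma phase_mxE tau x (q : {q | q \in F}) b :
  (phase_mx tau *m x) (coord_of cardF (q, b)) 0 =
  rot2 (tau (val q).1 (val q).2) b false * x (coord_of cardF (q, false)) 0 +
  rot2 (tau (val q).1 (val q).2) b true * x (coord_of cardF (q, true)) 0.
Proof.
rewrite mxE (sum_coord cardF) (bigD1 q) //= big1 ?addr0 => [|u uq].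
  by rewrite !mxE !coord_ofK /= eqxx.
by rewrite !mxE !coord_ofK /= [q == u]eq_sym (negPf uq) !mul0r addr0.
Qed.

Lemma to_mx_phase tau x i j :
  to_mx cardF (phase_mx tau *m x) i j = tau i j * to_mx cardF x i j.
Proof.
have [ijF|ijF] := boolP ((i, j) \in F); last by rewrite !to_mx_support // mulr0.
have E (y : 'cV[R]_(2 * k)) := to_mxE cardF y (exist (fun q => q \in F) (i, j) ijF).
move: (E (phase_mx tau *m x)) (E x) => /= -> ->; rewrite !phase_mxE /= /rot2 /=.
by case: (tau i j) => u v; simpc => /=; rewrite [X in _ +i* X]addrC.
Qed.

Lemma mulmx_faithful (A B : 'M[R]_(2 * k)) :
  (forall x : 'cV[R]_(2 * k), A *m x = B *m x) -> A = B.
Proof.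
move=> AB; apply/matrixP => i j; have /colP/(_ i) := AB (col j 1%:M).
by rewrite -!colM !mulmx1 !mxE.
Qed.

Lemma phase_mx1 : phase_mx (fun _ _ => 1) = 1%:M.
Proof.
apply: mulmx_faithful => x; apply: (can_inj (to_mxK cardF)).
by apply/matrixP => i j; rewrite to_mx_phase mul1r mul1mx.
Qed.

Lemma phase_mxM tau tau' :
  phase_mx (fun i j => tau i j * tau' i j) = phase_mx tau *m phase_mx tau'.
Proof.
apply: mulmx_faithful => x; apply: (can_inj (to_mxK cardF)).
by apply/matrixP => i j; rewrite -mulmxA !to_mx_phase mulrA.
Qed.

Lemma phase_mx_eq tau tau' : (forall i j, tau i j = tau' i j) -> phase_mx tau = phase_mx tau'.
Proof. by move=> E; apply/matrixP => p q; rewrite !mxE E. Qed.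

Lemma trmx_phase tau : (phase_mx tau)^T = phase_mx (fun i j => (tau i j)^*%R).
Proof.
apply/matrixP => p q; rewrite !mxE eq_sym; case: eqP => // ->.
case: (of_coord cardF p) (of_coord cardF q) => [u b] [u' b'] /=.
by case: (tau _ _) => a c; case: b; case: b'; rewrite /rot2 //= opprK.
Qed.

Lemma phase_mx_orthogonal tau : (forall i j, `|tau i j| = 1) ->
  (phase_mx tau)^T *m phase_mx tau = 1%:M.
Proof.
move=> t1; rewrite trmx_phase -phase_mxM -phase_mx1; apply: phase_mx_eq => i j.
by rewrite mulrC -normCK t1 expr1n.
Qed.

Lemma norm2_phase tau x : (forall i j, `|tau i j| = 1) -> norm2 (phase_mx tau *m x) = norm2 x.
Proof.
move=> t1; rewrite !(norm2E cardF); congr (Num.sqrt _).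
apply: eq_bigr => i _; apply: eq_bigr => j _.
by rewrite to_mx_phase modulusM {1}/modulus t1 mul1r.
Qed.

Lemma polydisc_phase tau x i j : (forall i j, `|tau i j| = 1) ->
  polydisc cardF (phase_mx tau *m x) i j = tau i j * polydisc cardF x i j.
Proof.
move=> t1; have sE : disc_scale cardF (phase_mx tau *m x) = disc_scale cardF x.
  rewrite /disc_scale norm2_phase // (eq_modulus_mx (B := to_mx cardF x)) // => i' j'.
  by rewrite to_mx_phase modulusM {1}/modulus t1 mul1r.
rewrite /polydisc sE [LHS]mxE [X in _ * X = _]to_mx_phase [X in _ = _ * X]mxE.
exact: mulrCA.
Qed.

End PhaseMatrices.

Section ChartProperties.
Local Open Scope classical_set_scope.
Local Open Scope ring_scope.
Local Open Scope complex_scope.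
Local Open Scope quotient_scope.
Variables (R : realType) (n d : nat).
Hypothesis d0 : (0 < d)%N.
Local Notation C := (R[i] : numClosedFieldType).
Local Notation M := (full_rank R n d).
Variables (W : 'I_n -> nat) (a : nat) (s : 'S_n) (l : schubert_symbol n d).
Hypothesis a0 : (0 < a)%N.
Local Notation disc := 'cV[R]_(2 * schubert_dim l).
Local Notation weight := (schubert_weight W a s l).
Local Notation G := (unity_group R weight).
Implicit Types (x : disc) (g : G).

(** The character by which g acts on the entry (i, j) of an echelon matrix once the pivot of column
    j is brought back to 1. *)
Definition phase g (i : 'I_n) (j : 'I_d) : C :=
  unity_val g ^+ W i / unity_val g ^+ W (s (val l j)).

Lemma norm_phase g i j : `|phase g i j| = 1.
Proof. by rewrite normrM normfV !normrX unity_norm !expr1n divr1. Qed.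

Definition chart_rot g : 'M[R]_(2 * schubert_dim l) := phase_mx (card_free_dim s l) (phase g).

Lemma chart_rot_repr : mx_repr [set: G]%SET chart_rot.
Proof.
split=> [|g h _ _].
  rewrite -(phase_mx1 R (card_free_dim s l)); apply: phase_mx_eq => i j.
  by rewrite /phase !expr1n divr1.
rewrite -phase_mxM; apply: phase_mx_eq => i j.
by rewrite /phase /= !exprMn invfM mulrACA.
Qed.

Definition chart_representation : mx_representation R [set: G]%SET (2 * schubert_dim l) :=
  MxRepresentation chart_rot_repr.

Lemma chart_polydisc_rot g x : chart_polydisc s (chart_rot g *m x) =
  twist s (val l) (\row_i unity_val g ^+ W i) (chart_polydisc s x).
Proof.
apply/matrixP => i j; rewrite [LHS](polydisc_phase _ _ _ _ (norm_phase g)) [RHS]mxE.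
by rewrite [(\row__ _) _ _]mxE [(\row__ _) _ (pivot _ _ _)]mxE.
Qed.

Definition pivot_phase g : 'M[C]_d := diag_mx (\row_j (unity_val g ^+ W (s (val l j)))^-1).

Lemma det_pivot_phase g : \det (pivot_phase g) = (unity_val g ^+ \sum_j W (s (val l j)))^-1.
Proof.
rewrite det_diag -prodrXr -prodfV; apply: eq_bigr => j _; by rewrite mxE.
Qed.

Lemma pivot_phase_unit g : pivot_phase g \in unitmx.
Proof.
rewrite unitmxE det_pivot_phase unitfE.
exact: invr_neq0 (expf_neq0 _ (unity_neq0 g)).
Qed.

Lemma chart_frame_rot g x : chart_frame s (chart_rot g *m x) =
  wdiag W (unity_val g) *m chart_frame s x *m pivot_phase g.
Proof.
rewrite /chart_frame chart_polydisc_rot (frame_twist _ _ (@eq_sup_norm R n)); last first.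
  by move=> i; rewrite mxE normrX unity_norm expr1n.
congr (_ *m diag_mx _); apply/rowP => j; rewrite [LHS]mxE [RHS]mxE.
by rewrite [(\row__ _) _ (pivot _ _ _)]mxE.
Qed.

Lemma chart_frame_vanish x : vanish_below s (val l) (chart_frame s x).
Proof.
exact: (@frame_vanish C n d s (val l) (symbol_increasing l) (@sup_norm R n) _ (@chart_supported R n d s l x)).
Qed.

Opaque chart_frame chart_polydisc chart_rot.

Lemma modulus_minor_rot g x f :
  modulus (minor f (chart_frame s (chart_rot g *m x))) = modulus (minor f (chart_frame s x)).
Proof.
have m1 k : modulus (unity_val g ^+ k) = 1.
  by rewrite modulusX [modulus _](_ : _ = 1) ?expr1n // /modulus unity_norm.
rewrite chart_frame_rot minorM minor_wdiag det_pivot_phase !modulusM modulusV !m1.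
by rewrite invr1 mul1r mulr1.
Qed.

Lemma plucker_norm_rot g x : plucker_norm (chart_frame s (chart_rot g *m x)) = plucker_norm (chart_frame s x).
Proof. by apply: eq_bigr => f _; exact: modulus_minor_rot. Qed.

Lemma pivot_det_rot g x : pivot_det s (chart_rot g *m x) = pivot_det s x.
Proof. exact: modulus_minor_rot. Qed.

Lemma unity_weight g : unity_val g ^+ (a + \sum_j W (s (val l j))) = 1.
Proof. by rewrite -[RHS](unity_valP g) weight_predK. Qed.

Lemma chart_scaling_rot g x : chart_scaling d0 s (chart_rot g *m x) = chart_scaling d0 s x.
Proof.
exact: (congr1 (fun p : R => diag_mx (\row_j (if j == Ordinal d0 then p^-1%:C else 1)))
  (plucker_norm_rot g x)).
Qed.

(** Rotating the disc multiplies the frame by diag(g^w) on the left and by inverse pivot phases on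
    the right. The latter have determinant g^(- sum of pivot weights), which equals g^a since g^c =
    1, as the equivalence demands. *)
Lemma chart_map_rot g x : chart_map d0 W a s (chart_rot g *m x) = chart_map d0 W a s x.
Proof.
apply/esym/pi_WGrP; set S := chart_scaling d0 s x.
have uS : S \in unitmx := chart_scaling_unit d0 s x.
have SE : chart_scaling d0 s (chart_rot g *m x) = S := chart_scaling_rot g x.
exists (unity_val g), (invmx S *m pivot_phase g *m S); split.
- exact: unity_neq0.
- by rewrite !unitmx_mul unitmx_inv uS pivot_phase_unit.
- rewrite !det_mulmx det_inv mulrAC mulVf ?mul1r; last by rewrite -unitfE -unitmxE.
  rewrite det_pivot_phase; have := unity_weight g; rewrite exprD => /(canRL (mulfK _)) ->.
    exact: mul1r.
  exact: (expf_neq0 _ (unity_neq0 g)).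
- have E1 := val_rmul (chart_point s (chart_rot g *m x)) (chart_scaling_unit d0 s (chart_rot g *m x)).
  have E2 := val_rmul (chart_point s x) uS.
  have E3 : chart_frame s (chart_rot g *m x) *m chart_scaling d0 s (chart_rot g *m x) =
      wdiag W (unity_val g) *m (chart_frame s x *m S) *m (invmx S *m pivot_phase g *m S).
    rewrite SE chart_frame_rot !mulmxA (mulmxK uS); reflexivity.
  exact: etrans E1 (etrans E3 (congr1
    (fun B => wdiag W (unity_val g) *m B *m (invmx S *m pivot_phase g *m S)) (esym E2))).
Qed.

(** Phases leave the moduli of all minors unchanged, hence also the flow time. The flow commutes
    with diag(g^w), and the right factor disappears in [Gr]. *)
Lemma chart_cell_rot g x : chart_cell W a s (chart_rot g *m x) =
  gr_lmul (wdiag W (unity_val g)) (chart_cell W a s x).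
Proof.
have uD := wdiag_unit W (unity_neq0 g).
have FD : flow W a s x *m wdiag W (unity_val g) = wdiag W (unity_val g) *m flow W a s x.
  by rewrite -[LHS]wdiagM -[RHS]wdiagM mulrC.
rewrite (gr_lmul_pi _ uD); apply/esym/pi_GrP; exists (pivot_phase g); first exact: pivot_phase_unit.
have E1 := val_lmul (chart_point s (chart_rot g *m x)) (flow_unit W a s (chart_rot g *m x)).
have E2 := val_lmul (lmul (flow W a s x) (chart_point s x)) uD.
have E3 := val_lmul (chart_point s x) (flow_unit W a s x).
have FE : flow W a s (chart_rot g *m x) = flow W a s x.
  exact: (f_equal2 (fun p q : R => wdiag W (expR (ln (p / q) / weight%:R))%:C)
    (plucker_norm_rot g x) (pivot_det_rot g x)).
have E4 : flow W a s (chart_rot g *m x) *m chart_frame s (chart_rot g *m x) =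
    wdiag W (unity_val g) *m (flow W a s x *m chart_frame s x) *m pivot_phase g.
  rewrite FE chart_frame_rot !mulmxA FD; reflexivity.
apply: etrans E1 (etrans E4 _).
exact: (congr1 (fun B => B *m pivot_phase g)
  (esym (etrans E2 (congr1 (mulmx (wdiag W (unity_val g))) E3)))).
Qed.

Lemma chart_frame_in_cell x : norm2 x < 1 -> in_cell s (val l) (chart_frame s x).
Proof.
move=> x1; apply: in_cell_vanish (symbol_increasing l) (@chart_frame_vanish x) _.
by rewrite unitmxE unitfE -modulus_eq0 -[modulus _]/(pivot_det s x) pivot_det_eq0 -ltNge.
Qed.

Lemma chart_point_in_cell x : norm2 x < 1 ->
  in_cell s (val l) (\val (lmul (flow W a s x) (chart_point s x))).
Proof.
move=> x1; rewrite (val_lmul _ (flow_unit W a s x)).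
apply: (in_cell_wdiag W (flow_neq0 W a s x)); exact: chart_frame_in_cell.
Qed.

Lemma chart_cell_in x : norm2 x < 1 -> schubert_cell s l (chart_cell W a s x).
Proof. by move=> x1; apply/schubert_cell_pi; exact: chart_point_in_cell. Qed.

Lemma flow_time_weight x : norm2 x < 1 ->
  (flow_time W a s x)%:C ^+ a * ((flow_time W a s x)%:C ^+ (\sum_j W (s (val l j))) * (pivot_det s x)%:C)
  = (plucker_norm (chart_frame s x))%:C :> C.
Proof.
move=> x1; rewrite mulrA -exprD -rmorphXn /= -rmorphM /=; congr (_%:C).
have := flow_timeX W s a0 x1; rewrite /schubert_weight => ->.
by rewrite mulfVK // gt_eqF // pivot_det_gt0.
Qed.

Lemma det_pivot_flow x :
  \det (pivot_rows s l (flow W a s x *m chart_frame s x)) =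
  (flow_time W a s x)%:C ^+ (\sum_j W (s (val l j))) * (pivot_det s x)%:C.
Proof.
rewrite pivot_rows_wdiag det_mulmx det_diag pivot_detE -prodrXr; congr (_ * _).
by apply: eq_bigr => j _; rewrite mxE.
Qed.

(** The equivalence is realized by t = r, the flow time. Its condition on determinants says that r^a
    times the pivot minor of the flowed frame is the Pluecker norm of the frame, which is the
    defining equation of r. *)
Lemma chart_map_proj x : norm2 x < 1 ->
  chart_map d0 W a s x = schubert_proj W a s l (chart_cell W a s x).
Proof.
move=> x1; rewrite (schubert_proj_pi W a (chart_point_in_cell x1)); apply/pi_WGrP.
set S := chart_scaling d0 s x; have uS : S \in unitmx := chart_scaling_unit d0 s x.
have uB : pivot_rows s l (flow W a s x *m chart_frame s x) \in unitmx.
  have [uB _] := in_cell_wdiag W (flow_neq0 W a s x) (chart_frame_in_cell x1).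
  exact: uB.
have dS : \det S = (plucker_norm (chart_frame s x))^-1%:C := det_chart_scaling d0 s x.
have n0 : (plucker_norm (chart_frame s x))%:C != 0 :> C.
  by rewrite -[0]/(0%:C) (inj_eq (@complexI R)) gt_eqF ?plucker_norm_frame_gt0.
exists (flow_time W a s x)%:C, (invmx S *m invmx (pivot_rows s l (flow W a s x *m chart_frame s x))).
split.
- exact: flow_neq0.
- by rewrite unitmx_mul !unitmx_inv uS uB.
- rewrite det_mulmx !det_inv dS det_pivot_flow fmorphV invrK.
  apply: (canRL (mulfK _)); last exact: flow_time_weight.
  by have := uB; rewrite unitmxE unitfE det_pivot_flow.
have E0 : flow W a s x *m chart_frame s x *m invmx (pivot_rows s l (flow W a s x *m chart_frame s x)) =
    flow W a s x *m (chart_frame s x *m S) *m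
    (invmx S *m invmx (pivot_rows s l (flow W a s x *m chart_frame s x))).
  by rewrite !mulmxA (mulmxK uS).
have E1 := val_normal_mx (chart_point_in_cell x1).
have E2 := val_lmul (chart_point s x) (flow_unit W a s x).
have E3 := val_rmul (chart_point s x) uS.
rewrite E1 E2; apply: etrans E0 _.
exact: (congr1 (fun B => flow W a s x *m B *m
  (invmx S *m invmx (pivot_rows s l (flow W a s x *m chart_frame s x)))) (esym E3)).
Qed.

(** The frame keeps its staircase of zeros on the boundary, so its cell m satisfies m <= l; and m =
    l is excluded because the pivot minor at l is 0. *)
Lemma chart_map_boundary x : 1 <= norm2 x -> exists m : schubert_symbol n d,
  [/\ schubert_le m l, m != l & qsupp (schubert_qcell R W a s m) (chart_map d0 W a s x)].
Proof.
move=> x1; set S := chart_scaling d0 s x.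
have uS : S \in unitmx := chart_scaling_unit d0 s x.
have [m mA] := in_cell_symbol s (rmul (chart_point s x) S).
have E3 : \val (rmul (chart_point s x) S) = chart_frame s x *m S := val_rmul (chart_point s x) uS.
have mXS : in_cell s (val m) (chart_frame s x *m S) := eq_ind _ (in_cell s (val m)) mA _ E3.
have mX := (in_cellM s (val m) (chart_frame s x) uS).1 mXS.
exists m; split; last exact: ((qsupp_pi W s m (rmul (chart_point s x) S) a0).2 mA).
- apply: (vanish_minor_le (symbol_increasing l) (symbol_increasing m) (@chart_frame_vanish x)).
  by case: mX; rewrite unitmxE unitfE.
- apply/eqP => ml; rewrite ml in mX; case: mX.
  by rewrite unitmxE unitfE -modulus_eq0 -[modulus _]/(pivot_det s x) pivot_det_eq0 x1.
Qed.

End ChartProperties.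

(** * Recovering the flow time from a subspace *)

Section Mass.
Local Open Scope ring_scope.
Local Open Scope complex_scope.
Variables (R : realType) (n d : nat).
Local Notation C := (R[i] : numClosedFieldType).
Variables (W : 'I_n -> nat) (a : nat) (s : 'S_n) (l : schubert_symbol n d).
Hypothesis a0 : (0 < a)%N.
Local Notation weight := (schubert_weight W a s l).
Implicit Types (A : 'M[C]_(n, d)) (r : R).

(** A ratio of Pluecker coordinates, hence a function of the column span alone. *)
Definition minor_ratio (f : 'I_d -> 'I_n) A : R :=
  modulus (minor f A) / modulus (\det (pivot_rows s l A)).

Lemma minor_ratio_ge0 f A : 0 <= minor_ratio f A.
Proof. by rewrite divr_ge0 ?modulus_ge0. Qed.

Lemma minor_ratioM f A T : T \in unitmx -> minor_ratio f (A *m T) = minor_ratio f A.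
Proof.
rewrite unitmxE unitfE -modulus_eq0 => T0.
rewrite /minor_ratio minorM pivot_rowsM det_mulmx !modulusM.
by rewrite invfM mulrACA divff // mulr1.
Qed.

Lemma modulus_unit_real r : 0 < r -> modulus (r%:C : C) = r.
Proof. by move=> r0; rewrite modulus_real gtr0_norm. Qed.

Lemma minor_ratio_wdiag f A r : 0 < r ->
  minor_ratio f (wdiag W r%:C *m A) = r ^+ (\sum_j W (f j)) / r ^+ (\sum_j W (s (val l j))) * minor_ratio f A.
Proof.
move=> r0; rewrite /minor_ratio minor_wdiag -[\det (pivot_rows _ _ (_ *m _))]/(minor _ _) minor_wdiag.
rewrite 2!modulusM 2!modulusX (modulus_unit_real r0).
rewrite invfM; exact: mulrACA.
Qed.

(** This is r^a times the Pluecker norm of diag(r^w) A, divided by the modulus of the pivot minor of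
    A. On the subspace [chart_cell x] the value 1 is taken at the inverse of the flow time
    ([mass_chart]), so the equation [mass r A = 1] recovers that time from the subspace. *)
Definition mass r A : R :=
  \sum_(f : {ffun 'I_d -> 'I_n}) r ^+ (a + \sum_j W (f j)) * minor_ratio f A.

Lemma massM r A T : T \in unitmx -> mass r (A *m T) = mass r A.
Proof. by move=> uT; apply: eq_bigr => f _; rewrite minor_ratioM. Qed.

Definition pivot_fun : {ffun 'I_d -> 'I_n} := finfun (fun j => s (val l j)).

Lemma minor_ratio_pivot A : pivot_rows s l A \in unitmx -> minor_ratio pivot_fun A = 1.
Proof.
rewrite unitmxE unitfE -modulus_eq0 => p0.
have E : minor pivot_fun A = \det (pivot_rows s l A).
  by congr (\det _); apply/matrixP => i j; rewrite !mxE ffunE.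
by rewrite /minor_ratio E divff.
Qed.

(** No summand decreases, and the one at the pivots, a power of r with exponent at least a > 0,
    strictly increases. *)
Lemma mass_lt A r r' : pivot_rows s l A \in unitmx -> 0 < r -> r < r' -> mass r A < mass r' A.
Proof.
move=> uA r0 rr'; have r0' := ltW (lt_trans r0 rr'); have {}r0 := ltW r0.
rewrite /mass (bigD1 pivot_fun) //= [ltRHS](bigD1 pivot_fun) //=.
apply: ltr_leD.
  by rewrite minor_ratio_pivot // !mulr1 ltr_pXn2r // addn_gt0 a0.
apply: ler_sum => f _; apply: ler_wpM2r; first exact: minor_ratio_ge0.
by rewrite lerXn2r // ltW.
Qed.

Lemma mass_inj A r r' : pivot_rows s l A \in unitmx -> 0 < r -> 0 < r' ->
  mass r A = mass r' A -> r = r'.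
Proof.
move=> uA r0 r0' E; case: (ltgtP r r') => // H.
  by have := mass_lt uA r0 H; rewrite E ltxx.
by have := mass_lt uA r0' H; rewrite E ltxx.
Qed.

(** The mass is a polynomial in r. It is 0 at r = 0, since all exponents are positive, and at least
    1 at r = 1, already by its pivot term. *)
Lemma mass_exists A : pivot_rows s l A \in unitmx -> exists2 r, 0 < r & mass r A = 1.
Proof.
move=> uA.
pose p : {poly R} := \sum_(f : {ffun 'I_d -> 'I_n}) (minor_ratio f A)%:P * 'X^(a + \sum_j W (f j)) - 1.
have pE r : p.[r] = mass r A - 1.
  rewrite hornerD hornerN hornerC horner_sum; congr (_ - _); apply: eq_bigr => f _.
  by rewrite hornerM hornerC hornerXn mulrC.
have m0 : mass 0 A = 0.
  by rewrite /mass big1 // => f _; rewrite expr0n addn_eq0 (gtn_eqF a0) mul0r.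
have m1 : 1 <= mass 1 A.
  rewrite /mass (bigD1 pivot_fun) //= minor_ratio_pivot // expr1n mul1r lerDl.
  by apply: sumr_ge0 => f _; rewrite expr1n mul1r minor_ratio_ge0.
have [|r /andP[r0 r1] /rootP] := @poly_ivt R p 0 1 ler01.
  by rewrite !pE m0 sub0r oppr_le0 ler01 subr_ge0.
rewrite pE => /eqP; rewrite subr_eq0 => /eqP mr; exists r => //.
rewrite lt_def r0 andbT; apply: contra_eq_neq mr => ->.
by rewrite m0 eq_sym oner_neq0.
Qed.

Lemma mass_flow A r : 0 < r -> mass r^-1 (wdiag W r%:C *m A) =
  (\sum_(f : {ffun 'I_d -> 'I_n}) minor_ratio f A) / r ^+ weight.
Proof.
move=> r0; rewrite mulr_suml; apply: eq_bigr => f _; rewrite minor_ratio_wdiag //.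
have rk k : r ^+ k != 0 by rewrite expf_neq0 // gt_eqF.
rewrite /schubert_weight !exprD exprVn exprVn [_ * _ * minor_ratio _ _]mulrC [RHS]mulrC; rewrite mulrCA.
rewrite [RHS]mulrC; congr (_ * _).
rewrite invfM -mulrA; congr (_ * _).
by rewrite mulKf.
Qed.

Lemma sum_minor_ratio A : \sum_(f : {ffun 'I_d -> 'I_n}) minor_ratio f A =
  plucker_norm A / modulus (\det (pivot_rows s l A)).
Proof. by rewrite mulr_suml. Qed.

End Mass.

(** * Bijectivity of the chart onto the Schubert cell *)

Section Bijectivity.
Local Open Scope classical_set_scope.
Local Open Scope ring_scope.
Local Open Scope complex_scope.
Local Open Scope quotient_scope.
Variables (R : realType) (n d : nat).
Local Notation C := (R[i] : numClosedFieldType).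
Local Notation M := (full_rank R n d).
Variables (W : 'I_n -> nat) (a : nat) (s : 'S_n) (l : schubert_symbol n d).
Hypothesis a0 : (0 < a)%N.
Local Notation disc := 'cV[R]_(2 * schubert_dim l).
Local Notation weight := (schubert_weight W a s l).
Implicit Types (x : disc).

Lemma mass_chart x : norm2 x < 1 ->
  mass W a s l (flow_time W a s x)^-1 (flow W a s x *m chart_frame s x) = 1.
Proof.
move=> x1; rewrite (mass_flow W a s l _ (flow_time_gt0 W a s x)) sum_minor_ratio.
rewrite -[modulus _]/(pivot_det s x) -(flow_timeX W s a0 x1) divff //.
by rewrite expf_neq0 // gt_eqF // flow_time_gt0.
Qed.

Lemma chart_polydisc_eq x : norm2 x < 1 ->
  chart_polydisc s x = iframe s (val l) (@sup_norm R n)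
    (chart_frame s x *m invmx (pivot_rows s l (chart_frame s x))).
Proof.
move=> x1; apply: (iframe_frame (symbol_increasing l) (@sup_normZ R n) (@chart_supported R n d s l x)).
move=> j; rewrite /sup_norm modulusE -[1]/(1%:C) ltcR.
exact: le_lt_trans (modulus_col _ _) (polydisc_lt1 (card_free_dim s l) x1).
Qed.

(** The mass depends only on the span and is injective in r, so equal subspaces have equal flow
    times. After the flow is undone the two frames have the same span, hence the same normalized
    matrix, from which [iframe] recovers the point. *)
Lemma chart_cell_inj x x' : norm2 x < 1 -> norm2 x' < 1 ->
  chart_cell W a s x = chart_cell W a s x' -> x = x'.
Proof.
move=> x1 x1' /pi_GrP[T uT].
rewrite (val_lmul _ (flow_unit W a s x)) (val_lmul _ (flow_unit W a s x')).
rewrite -[\val (chart_point s x)]/(chart_frame s x) -[\val (chart_point s x')]/(chart_frame s x').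
move=> E.
have uX (y : disc) : norm2 y < 1 -> pivot_rows s l (flow W a s y *m chart_frame s y) \in unitmx.
  move=> y1; have [uB _] := in_cell_wdiag W (flow_neq0 W a s y) (chart_frame_in_cell s y1).
  exact: uB.
have tE : flow_time W a s x = flow_time W a s x'.
  have t0 (y : disc) : 0 < (flow_time W a s y)^-1 by rewrite invr_gt0 flow_time_gt0.
  have M1 := etrans (congr1 (mass W a s l (flow_time W a s x)^-1) E)
    (etrans (massM W a s l _ _ uT) (mass_chart x1)).
  exact: invr_inj (@mass_inj R n d W a s l a0 _ _ _ (uX x' x1') (t0 x) (t0 x')
    (etrans M1 (esym (mass_chart x1')))).
have FE : flow W a s x = flow W a s x' by rewrite /flow tE.
have XE : chart_frame s x' = chart_frame s x *m T.
  rewrite -[LHS](mulKmx (flow_unit W a s x')) E -FE -mulmxA.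
  exact: (mulKmx (flow_unit W a s x) (chart_frame s x *m T)).
apply: (polydisc_inj x1 x1' (cardF := card_free_dim s l)).
rewrite -[LHS]/(chart_polydisc s x) -[RHS]/(chart_polydisc s x').
rewrite (chart_polydisc_eq x1) (chart_polydisc_eq x1') XE pivot_rowsM.
have [uX1 _] := chart_frame_in_cell s x1.
rewrite (invmx_mul uX1 uT) mulmxA (mulmxK uT); reflexivity.
Qed.

(** Flow A by the solution r of [mass r A = 1] and take the point x whose frame has the span of the
    result B. The flow time of x is then 1 / r, so its flow carries the span of B back to that of
    A. *)
Lemma chart_cell_surj (z : Gr R n d) : schubert_cell s l z ->
  exists2 x : disc, norm2 x < 1 & chart_cell W a s x = z.
Proof.
have [A ->] := Gr_pi z; move=> /schubert_cell_pi lA.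
have [r r0 mr] := mass_exists W a0 (proj1 lA).
have r0' : r%:C != 0 :> C by rewrite -[0]/(0%:C) (inj_eq (@complexI R)) gt_eqF.
pose B := wdiag W r%:C *m \val A.
have lB : in_cell s (val l) B := in_cell_wdiag W r0' lA.
have [uB vB] := lB.
pose N := B *m invmx (pivot_rows s l B).
have N1 : pivot_block s (val l) N = 1%:M by rewrite -[LHS]/(pivot_rows s l N) pivot_rowsM mulmxV.
pose Y := iframe s (val l) (@sup_norm R n) N.
have sY : on_support (free_set s l) Y by apply/on_support_free/supported_iframe.
have Y1 : modulus Y < 1.
  have [->|Y0] := eqVneq Y 0.
    by rewrite [modulus _](_ : _ = 0) ?ltr01 //; apply/eqP; rewrite modulus_eq0.
  have [j <-] := modulus_col_attained Y0; rewrite -ltcR -modulusE.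
  exact: (iframe_lt1 s (val l) (@sup_norm_ge0 R n) (@sup_normZ R n) N j).
have [x x1 xY] := polydisc_surj (card_free_dim s l) sY Y1.
exists x => //.
have XN : chart_frame s x *m invmx (pivot_rows s l (chart_frame s x)) = N.
  have := frame_iframe (symbol_increasing l) (@sup_norm_ge0 R n) (@sup_normZ R n) N1 vB.
  by rewrite -[iframe _ _ _ _]/Y -xY.
have [uX _] := chart_frame_in_cell s x1.
have XE : chart_frame s x = N *m pivot_rows s l (chart_frame s x) by rewrite -XN mulmxKV.
(* The c-th power of the flow time is the sum of the minor ratios of B, which is r^(- c) times
   [mass r A], and this mass is 1. *)
have tE : flow_time W a s x = r^-1.
  have c0 := weight_gt0 W s l a0.
  apply/eqP; rewrite -(eqrXn2 c0) ?ltW ?invr_gt0 ?flow_time_gt0 //; apply/eqP.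
  rewrite (flow_timeX W s a0 x1) -[pivot_det s x]/(modulus _) -(sum_minor_ratio s l).
  rewrite exprVn -[RHS]mulr1 -mr /mass mulr_sumr; apply: eq_bigr => f _.
  rewrite XE minor_ratioM // /N minor_ratioM ?unitmx_inv // /B minor_ratio_wdiag //.
  move: (minor_ratio _ _ _ _) => q; rewrite [RHS]mulrA; congr (_ * _).
  have ra : r ^+ a != 0 by rewrite expf_neq0 // gt_eqF.
  by rewrite /schubert_weight !exprD invfM [RHS]mulrACA mulVf // mul1r mulrC.
apply/esym/pi_GrP; exists (invmx (pivot_rows s l B) *m pivot_rows s l (chart_frame s x)).
  by rewrite unitmx_mul unitmx_inv uB.
rewrite (val_lmul _ (flow_unit W a s x)) -[\val (chart_point s x)]/(chart_frame s x).
have FB : flow W a s x *m B = \val A.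
  rewrite /flow tE /B mulmxA -wdiagM -rmorphM mulVf; last by rewrite gt_eqF.
  by rewrite wdiag1 mul1mx.
rewrite -FB -mulmxA; apply: (congr1 (mulmx (flow W a s x))).
exact: etrans XE (esym (mulmxA _ _ _)).
Qed.

End Bijectivity.

(** * The q-cell structure *)

Section Discs.
Local Open Scope classical_set_scope.
Local Open Scope ring_scope.
Variables (R : realType) (k : nat).

Lemma sum_sqr_continuous : continuous (fun x : 'cV[R]_k => \sum_i x i 0 ^+ 2).
Proof.
move=> x; apply: (@cvg_sumr _ _ (nbhs x)) => i _; apply: (@cvg_exp _ _ (nbhs x)).
exact: coord_continuous.
Qed.

Lemma open_disc_open : open (@open_disc R k).
Proof.
have /continuousP/(_ _ (@open_lt R 1)) := sum_sqr_continuous.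
exact.
Qed.

Lemma closed_disc_compact : compact (@closed_disc R k).
Proof.
apply: subclosed_compact (@cV_box_compact R k 1) _.
  have /continuous_closedP/(_ _ (@closed_le R 1)) := sum_sqr_continuous.
  exact.
move=> x x1 i; rewrite -ler_norml -(expr_le1 (n := 2)) // real_normK ?num_real //.
apply: le_trans x1; rewrite (bigD1 i) //= lerDl.
by apply: sumr_ge0 => j _; rewrite sqr_ge0.
Qed.
End Discs.

Section DiscNorm.
Local Open Scope classical_set_scope.
Local Open Scope ring_scope.
Variables (R : realType) (k : nat).

Lemma open_disc_norm2 (x : 'cV[R]_(2 * k)) : open_disc x <-> norm2 x < 1.
Proof. by rewrite /norm2 -{1}(@sqrtr1 R) ltr_sqrt. Qed.

Lemma open_disc_closed (x : 'cV[R]_(2 * k)) : open_disc x -> closed_disc x.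
Proof. exact: ltW. Qed.
End DiscNorm.

Section QCellStructure.
Local Open Scope classical_set_scope.
Local Open Scope ring_scope.
Local Open Scope complex_scope.
Local Open Scope quotient_scope.
Variables (R : realType) (n d : nat).
Hypothesis d0 : (0 < d)%N.
Variable lam : 'I_'C(n, d) -> schubert_symbol n d.
Hypothesis lam_bij : bijective lam.
Hypothesis lam_mono : forall i j, schubert_le (lam i) (lam j) -> (i <= j)%N.
Variables (W : 'I_n -> nat) (a : nat) (s : 'S_n).
Hypothesis a0 : (0 < a)%N.
Local Notation cell := (fun i => schubert_qcell R W a s (lam i)).
Local Notation X := (WGr R d W a).

Definition below (i : 'I_'C(n, d)) : set X :=
  [set x | exists2 j : 'I_'C(n, d), (j < i)%N & qsupp (cell j) x].

Lemma qsupp_cover (x : X) : exists i, qsupp (cell i) x.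
Proof.
have [A ->] := WGr_pi x; have [m mA] := in_cell_symbol s A.
have [mu _ muK] := lam_bij; exists (mu m); rewrite muK.
exact: (qsupp_pi W s m A a0).2 mA.
Qed.

Lemma qsupp_disjoint i j (x : X) : qsupp (cell i) x -> qsupp (cell j) x -> i = j.
Proof.
have [A ->] := WGr_pi x.
move=> /(qsupp_pi W s _ A a0) iA /(qsupp_pi W s _ A a0) jA.
exact: (bij_inj lam_bij (symbol_unique iA jA)).
Qed.

Lemma chart_map_qsupp i (x : 'cV[R]_(2 * schubert_dim (lam i))) : norm2 x < 1 ->
  qsupp (cell i) (chart_map d0 W a s x).
Proof.
move=> x1; exists (chart_cell W a s x); first exact: (chart_cell_in W a s x1).
by rewrite (chart_map_proj d0 W s a0 x1).
Qed.

Lemma chart_map_below i (x : 'cV[R]_(2 * schubert_dim (lam i))) : 1 <= norm2 x ->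
  below i (chart_map d0 W a s x).
Proof.
move=> /(chart_map_boundary d0 W s a0)[m [ml mNl qm]].
have [mu _ muK] := lam_bij; exists (mu m); last by rewrite muK.
rewrite ltn_neqAle lam_mono ?muK // andbT; apply: contra mNl => /eqP mi.
by rewrite -(muK m) (val_inj mi).
Qed.

Lemma qsupp_sub_chart i :
  qsupp (cell i) `<=` @chart_map R n d d0 W a s (lam i) @` @closed_disc R (2 * schubert_dim (lam i)).
Proof.
move=> _ [z /(chart_cell_surj W a0)[x x1 <-] <-]; exists x.
  exact/open_disc_closed/open_disc_norm2.
exact: chart_map_proj.
Qed.

(** The union of the earlier cells is also the union of the compact images of their closed discs,
    because the boundary of each disc is sent to still earlier cells. *)
Lemma below_closed i : closed (below i).
Proof.
have -> : below i = \bigcup_(j in [set j : 'I_'C(n, d) | (j < i)%N])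
    (@chart_map R n d d0 W a s (lam j) @` @closed_disc R (2 * schubert_dim (lam j))).
  apply/seteqP; split=> [x [j ji jx]|x [j ji [y _ <-]]].
    by exists j => //; exact: qsupp_sub_chart.
  have [y1|y1] := ltP (norm2 y) 1; first by exists j => //; exact: chart_map_qsupp.
  have [m mj mx] := chart_map_below y1; exists m => //; exact: ltn_trans mj ji.
apply: closed_bigcup => [|j _]; first exact: finite_finset.
apply: (compact_closed (@WGr_hausdorff R n d W a a0)); apply: continuous_compact.
  apply: continuous_subspaceT; exact: chart_map_continuous.
exact: closed_disc_compact.
Qed.

Lemma schubert_qcell_attached i : qcell_attached R (below i) (cell i).
Proof.
set l := lam i; set k := schubert_dim l.
split.
  apply/seteqP; split=> // x [[j ji jx] ix].
  by move: ji; rewrite (qsupp_disjoint jx ix) ltnn.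
(* The inverse chart is merely chosen, with default 0 off the cell; its continuity comes from
   [chart_inverse_continuous]. *)
pose psi' z : 'cV[R]_(2 * k) := xget 0 [set x | norm2 x < 1 /\ chart_cell W a s x = z].
have psi'P z : schubert_cell s l z -> norm2 (psi' z) < 1 /\ chart_cell W a s (psi' z) = z.
  move=> /(chart_cell_surj W a0)[x x1 xz].
  exact: (@xgetPex _ _ [set x | norm2 x < 1 /\ chart_cell W a s x = z] (ex_intro _ x (conj x1 xz))).
have psiK x : norm2 x < 1 -> psi' (chart_cell W a s x) = x.
  move=> x1; have [p1 pE] := psi'P _ (chart_cell_in W a s x1).
  exact: (chart_cell_inj a0 p1 x1 pE).
have psi_cont : {within @open_disc R (2 * k), continuous (@chart_cell R n d W a s l)}.
  apply/subspace_continuousP => x /open_disc_norm2 x1 B nB.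
  have nB' : nbhs x [set y | B (chart_cell W a s y)] := chart_cell_cvg x1 nB.
  change (nbhs x [set y | open_disc y -> B (chart_cell W a s y)]).
  apply: (@filterS _ (nbhs x) _ _ _ _ nB') => y By _; exact: By.
exists (chart_representation R W a s l), (@chart_cell R n d W a s l), psi', (@chart_map R n d d0 W a s l).
split.
- by move=> g; exact: (phase_mx_orthogonal _ (norm_phase g)).
- split=> //.
  + apply: (@chart_inverse_continuous _ _ _ (@open_disc R (2 * k)) (@closed_disc R (2 * k)) _
      (@chart_cell R n d W a s l) psi' (@chart_map R n d d0 W a s l) (@schubert_proj R n d W a s l)).
    * exact: norm_hausdorff.
    * exact: WGr_hausdorff.
    * exact: Gr_hausdorff.
    * exact: open_disc_open.
    * exact: closed_disc_compact.
    * exact: open_disc_closed.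
    * exact: psi_cont.
    * exact: chart_map_continuous.
    * exact: schubert_proj_continuous.
    * by move=> x /open_disc_norm2 x1; split; [exact: chart_cell_in|exact: psiK].
    * by move=> z /psi'P[p1 pz]; split=> //; exact/open_disc_norm2.
    * by move=> x /open_disc_norm2 x1; exact: chart_map_proj.
    (* A boundary point is sent to an earlier cell, which is disjoint from the cell of z. *)
    * move=> x z _ /open_disc_norm2/negP; rewrite -leNgt => x1 lz xz.
      have [j ji jx] := chart_map_below x1.
      have iz : qsupp (cell i) (schubert_proj W a s l z) by exists z.
      by move: ji; rewrite -xz in iz; rewrite (qsupp_disjoint jx iz) ltnn.
  + apply/seteqP; split=> [_ [x /open_disc_norm2 x1 <-]|z lz]; first exact: chart_cell_in.
    have [p1 pz] := psi'P z lz; exists (psi' z) => //; exact/open_disc_norm2.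
  + by move=> x /open_disc_norm2; exact: psiK.
  + by move=> g x _; exact: chart_cell_rot.
- by move=> z1 z2 lz1 lz2; exact: schubert_proj_orbit.
- split.
  + apply: continuous_subspaceT; exact: chart_map_continuous.
  + by move=> x /open_disc_norm2 x1; exact: chart_map_proj.
  + move=> x x1; apply: chart_map_below; rewrite /norm2 [\sum_i _]x1 sqrtr1 //.
  + by move=> g x _; exact: chart_map_rot.
- apply: attach_closed.
  + exact: WGr_hausdorff.
  + exact: closed_disc_compact.
  + exact: chart_map_continuous.
  + exact: below_closed.
  + exact: qsupp_sub_chart.
Qed.

Lemma schubert_qcell_structure : qcell_structure R cell.
Proof. by split; [exact: qsupp_cover|exact: schubert_qcell_attached]. Qed.

End QCellStructure.

(** * Permutations of the coordinates *)

Section Permutation.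
Local Open Scope classical_set_scope.
Local Open Scope ring_scope.
Local Open Scope quotient_scope.
Variables (R : realType) (n d : nat).
Local Notation C := (R[i] : numClosedFieldType).
Local Notation M := (full_rank R n d).
Implicit Types (W : 'I_n -> nat) (s : 'S_n) (A : M).

Lemma perm_wdiag W s (t : C) : perm_mx s *m wdiag W t = wdiag (W \o s) t *m perm_mx s.
Proof.
rewrite -row_permE /wdiag mul_diag_mx; apply/matrixP => i j; rewrite !mxE /=.
by case: (s i =P j); rewrite ?mulr1 ?mulr0.
Qed.

Lemma perm_mxK s : perm_mx s *m perm_mx s^-1 = 1%:M :> 'M[C]_n.
Proof. by rewrite -perm_mxM mulgV perm_mx1. Qed.

Lemma perm_mxVK s : perm_mx s^-1 *m perm_mx s = 1%:M :> 'M[C]_n.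
Proof. by rewrite -perm_mxM mulVg perm_mx1. Qed.

Lemma permV_wdiag W s (t : C) :
  perm_mx s^-1 *m wdiag (W \o s) t = wdiag W t *m perm_mx s^-1.
Proof.
rewrite -[LHS]mulmx1 -(perm_mxK s) mulmxA -(mulmxA (perm_mx s^-1)) -perm_wdiag.
by rewrite mulmxA perm_mxVK mul1mx.
Qed.

Lemma lmulK (D D' : 'M[C]_n) A : D \in unitmx -> D' \in unitmx -> D' *m D = 1%:M ->
  lmul D' (lmul D A) = A.
Proof.
move=> uD uD' DD; apply: val_inj.
by rewrite (val_lmul _ uD') (val_lmul _ uD) mulmxA DD mul1mx.
Qed.

Lemma lmul_comm (D D1 E E1 : 'M[C]_n) A :
  D \in unitmx -> D1 \in unitmx -> E \in unitmx -> E1 \in unitmx -> D *m D1 = E *m E1 ->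
  lmul D (lmul D1 A) = lmul E (lmul E1 A).
Proof.
move=> uD uD1 uE uE1 DE; apply: val_inj.
by rewrite (val_lmul _ uD) (val_lmul _ uD1) (val_lmul _ uE) (val_lmul _ uE1) !mulmxA DE.
Qed.

Lemma wgr_lmul_continuous W W' a (D : 'M[C]_n) : D \in unitmx ->
  (forall t, D *m wdiag W t = wdiag W' t *m D) ->
  continuous (@wgr_lmul R n d W W' a D).
Proof.
move=> uD DW; apply/(@quotient_continuous M {eq_quot (wgr_equiv R d W a)}).
have -> : @wgr_lmul R n d W W' a D \o \pi_(WGr R d W a) = \pi_(WGr R d W' a) \o @lmul R n d D.
  by apply/funext => A /=; exact: wgr_lmul_pi.
move=> A; apply: (@continuous_comp _ _ _ (@lmul R n d D) (\pi_(WGr R d W' a) : M -> WGr R d W' a)).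
  exact: lmul_continuous.
exact: (@pi_continuous M {eq_quot (wgr_equiv R d W' a)}).
Qed.

Lemma gr_lmul_continuous (D : 'M[C]_n) : D \in unitmx -> continuous (@gr_lmul R n d D).
Proof.
move=> uD; apply/(@quotient_continuous M {eq_quot (gr_equiv R n d)}).
have -> : @gr_lmul R n d D \o \pi_(Gr R n d) = \pi_(Gr R n d) \o @lmul R n d D.
  by apply/funext => A /=; exact: gr_lmul_pi.
move=> A; apply: (@continuous_comp _ _ _ (@lmul R n d D) (\pi_(Gr R n d) : M -> Gr R n d)).
  exact: lmul_continuous.
exact: (@pi_continuous M {eq_quot (gr_equiv R n d)}).
Qed.

Lemma coord_perm_homeomorphism W a s : homeomorphism (@coord_perm R n d W a s).
Proof.
have us : perm_mx s \in @unitmx C n := unitmx_perm _ s.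
have us' : perm_mx s^-1 \in @unitmx C n := unitmx_perm _ s^-1.
split; first exact: (wgr_lmul_continuous us (perm_wdiag W s)).
exists (wgr_lmul W (perm_mx s^-1)); split.
- exact: (wgr_lmul_continuous us' (permV_wdiag W s)).
- move=> x; have [A ->] := WGr_pi x; rewrite coord_perm_pi.
  by rewrite (wgr_lmul_pi _ _ us' (permV_wdiag W s)) (lmulK _ us us' (perm_mxVK s)).
- move=> x; have [A ->] := WGr_pi x; rewrite (wgr_lmul_pi _ _ us' (permV_wdiag W s)).
  by rewrite coord_perm_pi (lmulK _ us' us (perm_mxK s)).
Qed.

Lemma gr_lmul_homeomorphism s : homeomorphism (@gr_lmul R n d (perm_mx s)).
Proof.
have us : perm_mx s \in @unitmx C n := unitmx_perm _ s.
have us' : perm_mx s^-1 \in @unitmx C n := unitmx_perm _ s^-1.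
refine (conj (gr_lmul_continuous us) _).
exists (gr_lmul (perm_mx s^-1)); split; first exact: gr_lmul_continuous.
- move=> x; have [A ->] := Gr_pi x; rewrite (gr_lmul_pi _ us) (gr_lmul_pi _ us').
  by rewrite (lmulK _ us us' (perm_mxVK s)).
- move=> x; have [A ->] := Gr_pi x; rewrite (gr_lmul_pi _ us') (gr_lmul_pi _ us).
  by rewrite (lmulK _ us' us (perm_mxK s)).
Qed.

Lemma torus_perm_subproof s (t : torus R n) : (\row_j \val t 0 (s j)) \in @nonzero_rows R n.
Proof. by apply/mem_set => j; rewrite mxE; exact: (set_mem (valP t)). Qed.

Definition torus_perm s (t : torus R n) : torus R n :=
  exist (fun v => v \in @nonzero_rows R n) _ (torus_perm_subproof s t).

Lemma torus_perm_continuous s : continuous (torus_perm s).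
Proof.
move=> t B [_ [[U oU <-] Ut] UB].
have c : (fun v : torus R n => \row_j \val v 0 (s j) : 'rV[C]_n) @ t --> (\row_j \val t 0 (s j) : 'rV[C]_n).
  apply: (@cvg_row _ _ (nbhs t)) => j.
  have ct : (fun v : torus R n => \val v : 'rV[C]_n) @ t --> (\val t : 'rV[C]_n).
    exact: initial_continuous.
  exact: (@cvg_coord _ _ (nbhs t) _ _ _ _ 0 (s j) ct).
have nU := c _ (open_nbhs_nbhs (conj oU Ut)).
apply: (@filterS _ (nbhs t) _ _ _ _ nU) => v Uv; exact: UB.
Qed.

Lemma torus_perm_automorphism s : topological_automorphism (@torus_mul R n) (torus_perm s).
Proof.
split; last by move=> t u; apply: val_inj; apply/rowP => j; rewrite /= !mxE.
split; first exact: torus_perm_continuous.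
exists (torus_perm s^-1); split; first exact: torus_perm_continuous.
- by move=> t; apply: val_inj; apply/rowP => j; rewrite /= !mxE permKV.
- by move=> t; apply: val_inj; apply/rowP => j; rewrite /= !mxE permK.
Qed.

Lemma perm_torus s (t : torus R n) :
  perm_mx s *m diag_mx (\val t) = diag_mx (\val (torus_perm s t)) *m perm_mx s.
Proof.
rewrite -row_permE mul_diag_mx; apply/matrixP => i j; rewrite !mxE.
by case: (s i =P j) => [->|]; rewrite ?mulr1 ?mulr0.
Qed.

Lemma coord_perm_equivariant W a s :
  weakly_equivariant_homeomorphism (@torus_mul R n)
    (@torus_act R n d W a) (@torus_act R n d (W \o s) a) (@coord_perm R n d W a s).
Proof.
split; first exact: coord_perm_homeomorphism.
exists (torus_perm s); split; first exact: torus_perm_automorphism.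
move=> t x; have [A ->] := WGr_pi x; rewrite torus_act_pi !coord_perm_pi torus_act_pi.
apply: (congr1 (fun B => \pi_(WGr R d (W \o s) a) B)).
have us : perm_mx s \in @unitmx C n := unitmx_perm _ s.
have ud (u : torus R n) : diag_mx (\val u) \in unitmx.
  by rewrite unitmxE det_diag unitfE; apply/prodf_neq0 => i _; exact: (set_mem (valP u)).
exact: (lmul_comm _ us (ud t) (ud _) us (perm_torus s t)).
Qed.

Lemma pivot_block_perm s (l : 'I_d -> 'I_n) (A : 'M[C]_(n, d)) :
  pivot_block 1%g l (perm_mx s *m A) = pivot_block s l A.
Proof. by apply/matrixP => i j; rewrite -row_permE !mxE perm1. Qed.

Lemma in_cell_perm s (l : 'I_d -> 'I_n) (A : 'M[C]_(n, d)) :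
  in_cell 1%g l (perm_mx s *m A) <-> in_cell s l A.
Proof.
rewrite /in_cell pivot_block_perm -mulmxA.
by split=> -[uA vA]; split=> // i j lij; have := vA i j lij;
  rewrite -row_permE [row_perm _ _ _ _]mxE perm1.
Qed.

Lemma schubert_cell_perm s l (X : Gr R n d) :
  schubert_cell 1%g l (gr_lmul (perm_mx s) X) <-> schubert_cell s l X.
Proof.
have us : perm_mx s \in @unitmx C n := unitmx_perm _ s.
have [A ->] := Gr_pi X; rewrite (gr_lmul_pi _ us).
apply: iff_trans (schubert_cell_pi _ _ _) _; apply: iff_trans (iff_sym (schubert_cell_pi _ _ _)).
by rewrite (val_lmul _ us); exact: in_cell_perm.
Qed.

(** The weights of corresponding cells agree only after a computation, so the identity map between
    their groups has to be transported along that equality. *)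
Lemma unity_group_cast c c' : c = c' -> exists alpha : unity_group R c -> unity_group R c',
  [/\ bijective alpha, {morph alpha : g h / (g * h)%g} &
      forall g, unity_val (alpha g) = unity_val g].
Proof. by move=> <-; exists id; split=> //; exists id. Qed.

Lemma schubert_weight_perm W a s (l : schubert_symbol n d) :
  schubert_weight W a s l = schubert_weight (W \o s) a 1%g l.
Proof. by congr (_ + _)%N; apply: eq_bigr => j _; rewrite /= perm1. Qed.

Lemma carries_schubert_qcell W a s (l : schubert_symbol n d) :
  carries_qcell (@coord_perm R n d W a s)
    (schubert_qcell R W a s l) (schubert_qcell R (W \o s) a 1%g l).
Proof.
have us : perm_mx s \in @unitmx C n := unitmx_perm _ s.
have [alpha [alpha_bij alphaM alphaE]] := unity_group_cast (schubert_weight_perm W a s l).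
refine (conj (erefl (2 * schubert_dim l)%N) _).
exists (gr_lmul (perm_mx s)), alpha; split.
- exact: gr_lmul_homeomorphism.
- have [_ [g [_ fK gK]]] := gr_lmul_homeomorphism s.
  apply/seteqP; split=> [_ [X lX <-]|X lX]; first exact/schubert_cell_perm.
  by exists (g X); [apply/schubert_cell_perm; rewrite gK|exact: gK].
- by split.
- move=> t X _; rewrite /= alphaE; set z := unity_val t.
  have uz (V : 'I_n -> nat) : wdiag V z \in unitmx by apply: wdiag_unit; exact: unity_neq0.
  have [A ->] := Gr_pi X; rewrite (gr_lmul_pi _ (uz W)) !(gr_lmul_pi _ us) (gr_lmul_pi _ (uz _)).
  apply: (congr1 (fun B => \pi_(Gr R n d) B)).
  exact: (lmul_comm _ us (uz _) (uz _) us (perm_wdiag W s z)).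
- move=> X; have [A ->] := Gr_pi X; move=> /schubert_cell_pi lA.
  have lA' : in_cell 1%g (val l) (\val (lmul (perm_mx s) A)).
    by rewrite (val_lmul _ us); apply/in_cell_perm.
  rewrite /= (schubert_proj_pi _ _ lA) (gr_lmul_pi _ us) (schubert_proj_pi _ _ lA').
  rewrite coord_perm_pi; apply: (congr1 (fun B => \pi_(WGr R d (W \o s) a) B)); apply: val_inj.
  rewrite (val_lmul _ us) (val_normal_mx lA) (val_normal_mx lA') (val_lmul _ us) mulmxA.
  exact: (congr1 (fun P => _ *m invmx P) (esym (pivot_block_perm s (val l) (\val A)))).
Qed.

End Permutation.

(** * Two permutations with different q-cell structures *)

Section DifferentStructures.
Local Open Scope classical_set_scope.
Local Open Scope ring_scope.
Local Open Scope quotient_scope.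
Variables (R : realType) (n d : nat).
Hypotheses (d0 : (0 < d)%N) (dn : (d < n)%N).
Local Notation C := (R[i] : numClosedFieldType).

Definition low_fun : {ffun 'I_d -> 'I_n} := [ffun i => widen_ord (ltnW dn) i].

Lemma low_symbol_subproof : [forall i : 'I_d, forall j : 'I_d, (i < j)%N ==>
  (low_fun i < low_fun j)%N].
Proof. by apply/forallP => i; apply/forallP => j; rewrite !ffunE; exact/implyP. Qed.

(** Its cell is the only one of dimension 0, so a matching of q-cells that preserves dimensions must
    fix it. *)
Definition low_symbol : schubert_symbol n d :=
  exist (fun l : {ffun 'I_d -> 'I_n} => [forall i : 'I_d, forall j : 'I_d, (i < j)%N ==> (l i < l j)%N])
    low_fun low_symbol_subproof.

Lemma low_symbolE j : val low_symbol j = j :> nat.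
Proof. by rewrite /= ffunE. Qed.

Lemma symbol_ge (l : schubert_symbol n d) (j : 'I_d) : (j <= val l j)%N.
Proof.
case: j => k; elim: k => [//|k IH] kd.
apply: leq_ltn_trans (IH (ltnW kd)) _; exact: symbol_increasing.
Qed.

Lemma schubert_dim_low : schubert_dim low_symbol = 0%N.
Proof. by apply: big1 => j _; rewrite low_symbolE subnn. Qed.

Lemma schubert_dim_eq0 (l : schubert_symbol n d) : schubert_dim l = 0%N -> l = low_symbol.
Proof.
move=> /eqP; rewrite sum_nat_eq0 => /forallP l0; apply/val_inj/ffunP => j; apply/val_inj.
by apply/eqP; rewrite [X in _ == X]low_symbolE eqn_leq symbol_ge andbT; exact: (l0 j).
Qed.

Let first : 'I_n := Ordinal (ltn_trans d0 dn).
Lemma last_ord_subproof : (n.-1 < n)%N. Proof. by rewrite prednK // (ltn_trans d0 dn). Qed.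
Let last : 'I_n := Ordinal last_ord_subproof.
Let t : 'S_n := tperm first last.
Let W (i : 'I_n) : nat := i == last.

Lemma low_lt_last (j : 'I_d) : (val low_symbol j < last)%N.
Proof. by rewrite low_symbolE /=; case: n dn => // k dk; exact: leq_trans (ltn_ord j) dk. Qed.

Lemma low_neq_last (j : 'I_d) : val low_symbol j != last.
Proof. by rewrite -val_eqE neq_ltn low_lt_last. Qed.

Lemma weight_low1 : schubert_weight W 1 1%g low_symbol = 1%N.
Proof.
by rewrite /schubert_weight big1 ?addn0 // => j _; rewrite perm1 /W (negbTE (low_neq_last j)).
Qed.

(** [t] moves the first coordinate to the last, which carries the weight; the smallest symbol
    contains the first coordinate but, as d < n, not the last. *)
Lemma weight_low_tperm : schubert_weight W 1 t low_symbol = 2%N.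
Proof.
rewrite /schubert_weight (bigD1 (Ordinal d0)) //= big1 => [|j j0].
  have -> : low_fun (Ordinal d0) = first.
    by apply: val_inj; rewrite ffunE.
  by rewrite tpermL /W eqxx.
have jl := low_neq_last j.
have jf : val low_symbol j != first by apply: contra j0 => /eqP E; apply/eqP/val_inj; rewrite -[LHS]low_symbolE E.
by rewrite -[low_fun]/(val low_symbol) tpermD 1?eq_sym // /W (negbTE jl).
Qed.

Lemma unity_group_neq : ~ ([set: unity_group R 1]%SET \isog [set: unity_group R 2]%SET)%g.
Proof.
move=> /card_isog; rewrite !cardsT.
have -> : #|{: unity_group R 1}| = 1%N.
  apply/eqP/fintype1P; exists (unity_one R 1) => x; apply: val_inj.
  by have := unity_valP x; rewrite expr1.
have m1 : (-1 : C) \in unity_roots R 2 by rewrite Defs.mem_unity_roots sqrrN expr1n.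
move=> /esym/eqP/fintype1P[y yE].
have := congr1 (@unity_val R 2) (etrans (yE (SeqSub m1)) (esym (yE (unity_one R 2)))).
by move=> /eqP; rewrite /unity_val /= -subr_eq0 -opprD oppr_eq0 -mulr2n pnatr_eq0.
Qed.

(** [A] and [A'] differ only in the last row. They lie in different cells for the standard flag,
    where that row is below all pivots of the smallest symbol, but in a common cell for the flag
    permuted by [t], where that row comes first. *)
Let A : 'M[C]_(n, d) := pid_mx d.
Let A' : 'M[C]_(n, d) := A + delta_mx last (Ordinal d0).

Lemma pivot_low : pivot_block 1%g (val low_symbol) A = 1%:M.
Proof.
apply/matrixP => i j; rewrite !mxE perm1 low_symbolE ltn_ord andbT //.
Qed.

Lemma perturbE (i : 'I_n) j : i != last -> A' i j = A i j.
Proof. by move=> il; rewrite mxE [delta_mx _ _ _ _]mxE (negbTE il) addr0. Qed.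

Lemma pivot_perturb (s : 'S_n) (l : 'I_d -> 'I_n) : (forall j, s (l j) != last) ->
  pivot_block s l A' = pivot_block s l A.
Proof. by move=> ll; apply/matrixP => i j; rewrite mxE [RHS]mxE perturbE. Qed.

Lemma pivot_low_perturb : pivot_block 1%g (val low_symbol) A' = 1%:M.
Proof. by rewrite pivot_perturb ?pivot_low // => j; rewrite perm1; exact: low_neq_last. Qed.

Lemma in_cell_low : in_cell 1%g (val low_symbol) A.
Proof.
rewrite /in_cell pivot_low; split; first exact: unitmx1.
rewrite invmx1 mulmx1 => i j; rewrite low_symbolE perm1 => ji.
by rewrite mxE eq_sym (ltn_eqF ji).
Qed.

Lemma not_in_cell_low : ~ in_cell 1%g (val low_symbol) A'.
Proof.
rewrite /in_cell pivot_low_perturb invmx1 mulmx1 => -[_ /(_ last (Ordinal d0))].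
have l0 := low_lt_last (Ordinal d0).
move=> /(_ l0)/eqP; rewrite perm1 !mxE !eqxx.
have -> : (last == Ordinal d0 :> nat) = false by rewrite -(low_symbolE (Ordinal d0)) gtn_eqF.
by rewrite add0r oner_eq0.
Qed.

(** The last row of [A] is zero, so it is no pivot row and the pivot blocks of [A] and [A']
    coincide. In the order given by [t] this row is the first, hence never below a pivot, and the
    change made in it is not seen. *)
Lemma in_cell_perturb (l : schubert_symbol n d) : in_cell t (val l) A -> in_cell t (val l) A'.
Proof.
move=> [uA vA].
have tl j : t (val l j) != last.
  apply: contraTneq uA => tlj; rewrite unitmxE unitfE negbK.
  apply/eqP; rewrite (expand_det_row _ j) big1 // => k _.
  by rewrite 2!mxE tlj (gtn_eqF _) ?mul0r // -(low_symbolE k) low_lt_last.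
have pE := pivot_perturb tl.
split; first by rewrite pE.
rewrite pE => i j lij.
have [til|il] := eqVneq (t i) last.
  move: lij; have -> : i = first by apply: (@perm_inj _ t); rewrite til tpermL.
  by rewrite ltn0.
rewrite -[RHS](vA i j lij) !mxE; apply: eq_bigr => k _.
by rewrite perturbE.
Qed.

Lemma full_rank_pivot (s : 'S_n) (l : 'I_d -> 'I_n) (B : 'M[C]_(n, d)) :
  pivot_block s l B = 1%:M -> B \in [set B : 'M[C]_(n, d) | \rank B = d].
Proof.
move=> BE; apply/mem_set/(@minor_rank _ _ _ (fun j => s (l j))).
by rewrite /minor -/(pivot_block s l B) BE det1 oner_neq0.
Qed.

Let X : full_rank R n d :=
  exist (fun B => B \in [set B : 'M[C]_(n, d) | \rank B = d]) A (full_rank_pivot pivot_low).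
Let X' : full_rank R n d :=
  exist (fun B => B \in [set B : 'M[C]_(n, d) | \rank B = d]) A' (full_rank_pivot pivot_low_perturb).

(** A cell for [t] equal to the point cell of the standard flag would contain the class of [A],
    hence that of [A'], which is outside. For the second claim, the point cell must match the point
    cell, but the groups there have orders 1 and 2. *)
Lemma different_schubert_qcells (lam : 'I_'C(n, d) -> schubert_symbol n d) : bijective lam ->
  exists (W : 'I_n -> nat) (a : nat) (s t : 'S_n), (0 < a)%N /\
    different_qcell_structures
      (fun i => schubert_qcell R W a s (lam i))
      (fun i => schubert_qcell R W a t (lam i)).
Proof.
move=> [mal lamK malK]; exists W, 1%N, 1%g, t; split=> //.
split=> -[p pE].
- have := pE (mal low_symbol); rewrite malK; set m := lam _ => E.
  have tm : in_cell t (val m) (\val X).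
    have lX := (qsupp_pi W 1%g low_symbol X (ltn0Sn 0)).2 in_cell_low.
    rewrite E in lX; exact: (qsupp_pi W t m X (ltn0Sn 0)).1 lX.
  have lX' := (qsupp_pi W t m X' (ltn0Sn 0)).2 (in_cell_perturb tm).
  rewrite -E in lX'; exact: (not_in_cell_low ((qsupp_pi W 1%g low_symbol X' (ltn0Sn 0)).1 lX')).
- have := pE (mal low_symbol); rewrite malK /= => -[dE].
  have -> : lam (p (mal low_symbol)) = low_symbol.
    apply: schubert_dim_eq0; apply/eqP; rewrite -(eqn_pmul2l (isT : 0 < 2)%N).
    by rewrite -dE schubert_dim_low.
  rewrite weight_low1 weight_low_tperm; exact: unity_group_neq.
Qed.

End DifferentStructures.

Theorem theorem3p5 (R : realType) (d n : nat) (hd : 0 < d) (hdn : d < n)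
    (lam : 'I_'C(n, d) -> schubert_symbol n d) (lam_bij : bijective lam)
    (lam_mono : forall i j, schubert_le (lam i) (lam j) -> i <= j) :
  (forall (W : 'I_n -> nat) (a : nat) (s : 'S_n), 0 < a ->
    [/\ weakly_equivariant_homeomorphism (@torus_mul R n)
          (@torus_act R n d W a) (@torus_act R n d (W \o s) a)
          (@coord_perm R n d W a s),
        qcell_structure R (fun i => @schubert_qcell R n d W a s (lam i))
      & forall i, carries_qcell (@coord_perm R n d W a s)
          (@schubert_qcell R n d W a s (lam i))
          (@schubert_qcell R n d (W \o s) a 1%g (lam i))]) /\
  (exists (W : 'I_n -> nat) (a : nat) (s t : 'S_n), 0 < a /\
    different_qcell_structures
      (fun i => @schubert_qcell R n d W a s (lam i))
      (fun i => @schubert_qcell R n d W a t (lam i))).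
Proof.
split; last exact: different_schubert_qcells hd hdn lam lam_bij.
move=> W a s a0; split.
- exact: coord_perm_equivariant.
- exact: schubert_qcell_structure.
- by move=> i; exact: carries_schubert_qcell.
Qed.
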